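(* Let $Z=(Z_n)_{n\ge 0}$ be a subcritical Bienaymé--Galton--Watson process whose offspring distribution has mean $m\in(0,1)$, let $\nu_{\min}$ be its Yaglom limit and let $H(z)=\sum_{n\ge1}\nu_{\min}(n)z^n$. Then: 1. There exist no non-trivial (i.e. $\not\equiv0$) true $\lambda$-invariant measures for $Z$ with $\lambda<1$. 2. The only true ($1$-)invariant measures for $Z$ are multiples of $\delta_0$. 3. Let $\alpha<0$. A measure $\nu$ on $\mathbb{N}$ is a true $m^\alpha$-invariant measure for $Z$ if and only if its generating function $G(z)=\sum_{n\ge0}\nu(n)z^n$ satisfies $$G(z)=\int_0^\infty e^{(H(z)-1)x}\frac{1}{x^\alpha}\,\Lambda(dx),\qquad |z|<1,\qquad ( * )$$ where $\Lambda$ is a locally finite measure on $(0,\infty)$ satisfying $\Lambda(A)=\Lambda(mA)$ for every Borel set $A\subset(0,\infty)$. The measure $\Lambda$ is uniquely determined from $\nu$. Moreover, for every such measure $\Lambda$, $( * )$ defines the generating function of a true $m^\alpha$-invariant measure for $Z$ with radius of convergence at least $1$.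
   Context: $\mathbb{N}=\{0,1,2,\ldots\}$, $\mathbb{N}^*=\{1,2,\ldots\}$. All measures are non-negative and locally finite; on $\mathbb{N}$ this means $\nu(n)<\infty$ for every $n$. $P_0$ denotes the (full, non-killed) transition matrix of $Z$ on $\mathbb{N}$, for which $0$ is absorbing. A measure $\nu$ on $\mathbb{N}$, viewed as a row vector, is a true $\lambda$-invariant measure for $Z$ if $\nu P_0=\lambda\nu$; equivalently, $G(F(z))=\lambda G(z)$ for every $|z|<1$, where $G$ is the generating function of $\nu$ and $F$ that of the offspring distribution. $\mathbf{P}_1$ is the law of $Z$ started from $Z_0=1$. The Yaglom limit is the probability measure on $\mathbb{N}^*$ given by $\nu_{\min}=\lim_{n\to\infty}\mathbf{P}_1(Z_n\in\cdot\mid Z_n>0)$ (weak limit), which is known to exist. For $A\subset(0,\infty)$, $mA=\{ma:a\in A\}$. *)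

(* Defs.v *)
From HB Require Import structures.
From mathcomp Require Import all_boot all_order all_algebra.
From mathcomp Require Import complex.
From mathcomp Require Import all_classical all_reals all_analysis.

Set Implicit Arguments.
Unset Strict Implicit.
Unset Printing Implicit Defensive.

Import Order.TTheory GRing.Theory Num.Theory.
Import numFieldNormedType.Exports.

Local Open Scope classical_set_scope.
Local Open Scope ring_scope.

Section branching.
Context {R : realType}.

(* convolution_power p i is the law on nat of the sum of i independent
   variables with probability mass function p. *)
Fixpoint convolution_power (p : nat -> R) (i j : nat) : R :=
  if i is i'.+1 then \sum_(k < j.+1) p k * convolution_power p i' (j - k)
  else (j == 0%N)%:R.

(* The full (non-killed) transition matrix P_0 : the state 0 is absorbing. *)
Definition transition (xi : probability nat R) (i j : nat) : R :=
  convolution_power (fun k => fine (xi [set k])) i j.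

Definition true_invariant (xi : probability nat R) (lambda : R)
    (nu : {measure set nat -> \bar R}) : Prop :=
  forall j : nat,
    (\sum_(0 <= i <oo) nu [set i] * (transition xi i j)%:E
     = lambda%:E * nu [set j])%E.

Definition locally_finite_nat (nu : {measure set nat -> \bar R}) : Prop :=
  forall n : nat, (nu [set n] < +oo)%E.

(* Z is, under P, a Markov chain with transition matrix P_0 started from x0;
   the Markov property is written without division, on the cylinder events
   {Z_0 = i_0, ..., Z_n = i_n}. *)
Definition galton_watson_from (xi : probability nat R)
    d (T : measurableType d) (P : probability T R)
    (Z : nat -> {RV P >-> nat}) (x0 : nat) : Prop :=
  P [set w | Z 0%N w = x0] = 1%E /\
  forall (n : nat) (i : nat -> nat),
    P [set w | forall k, (k <= n.+1)%N -> Z k w = i k]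
    = (P [set w | forall k, (k <= n)%N -> Z k w = i k]
       * (transition xi (i n) (i n.+1))%:E)%E.

(* nu is the weak limit of the conditional laws P(Z_n \in . | Z_n > 0), tested
   against bounded functions (on nat every function is continuous). A measure
   on {1, 2, ...} is a measure on nat not charging 0. *)
Definition yaglom_limit d (T : measurableType d) (P : probability T R)
    (Z : nat -> {RV P >-> nat}) (nu : probability nat R) : Prop :=
  nu [set 0%N] = 0%E /\
  forall f : nat -> R, (exists M : R, forall k, `|f k| <= M) ->
    (fun n : nat =>
       (\int[P]_(w in [set w | (0 < Z n w)%N]) f (Z n w))
       / fine (P [set w | (0 < Z n w)%N])) @ \oo
    --> \int[nu]_k f k.

End branching.

Section complex_analysis.
Context {R : realType}.

Definition cexp (z : R[i]) : R[i] :=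
  Complex (expR (complex.Re z) * cos (complex.Im z))
          (expR (complex.Re z) * sin (complex.Im z)).

Definition cintegrable d (T : measurableType d) (mu : {measure set T -> \bar R})
    (D : set T) (f : T -> R[i]) : Prop :=
  mu.-integrable D (fun x => (complex.Re (f x))%:E) /\
  mu.-integrable D (fun x => (complex.Im (f x))%:E).

Definition cintegral d (T : measurableType d) (mu : {measure set T -> \bar R})
    (D : set T) (f : T -> R[i]) : R[i] :=
  Complex (\int[mu]_(x in D) complex.Re (f x))
          (\int[mu]_(x in D) complex.Im (f x)).

(* The copy R[i]^o carries the topology of the complex modulus. *)
Definition genfun_series (nu : {measure set nat -> \bar R}) (z : R[i]) :
    nat -> R[i]^o :=
  series (fun n => real_complex R (fine (nu [set n])) * z ^+ n : R[i]^o).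

Definition genfun (nu : {measure set nat -> \bar R}) (z : R[i]) : R[i] :=
  lim (genfun_series nu z @ \oo).

Definition convergence_radius (nu : {measure set nat -> \bar R}) : \bar R :=
  ereal_sup [set r%:E | r in [set r : R | 0 <= r /\
    (\sum_(0 <= n <oo) nu [set n] * (r ^+ n)%:E < +oo)%E]].

End complex_analysis.

Section representation.
Context {R : realType}.

(* Measures on (0, +oo) are encoded as Borel measures on R that vanish on the
   complement of (0, +oo). *)
Definition scale_invariant_measure (m : R)
    (Lambda : {measure set (measurableTypeR R) -> \bar R}) : Prop :=
  [/\ Lambda (~` `]0, +oo[) = 0%E,
      forall x : R, 0 < x -> exists2 e : R, 0 < e & (Lambda (ball x e) < +oo)%E
    & forall A : set (measurableTypeR R), measurable A -> A `<=` `]0, +oo[ ->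
        Lambda A = Lambda [set m * a | a in A]].

(* G(z) = \int_0^oo e^{(H(z)-1)x} x^{-alpha} Lambda(dx) for |z| < 1, where G and
   H are the generating functions of nu and nu_min. As nu_min does not charge 0
   in its intended use, the sum defining H effectively starts at n = 1. *)
Definition has_representation (nu_min : {measure set nat -> \bar R}) (alpha : R)
    (nu : {measure set nat -> \bar R})
    (Lambda : {measure set (measurableTypeR R) -> \bar R}) : Prop :=
  forall z : R[i], `|z| < 1 ->
    let integrand (x : measurableTypeR R) : R[i] :=
      cexp ((genfun nu_min z - 1) * real_complex R x)
      * real_complex R (1 / (x `^ alpha)) in
    [/\ cvg (genfun_series nu z @ \oo),
        cintegrable Lambda `]0, +oo[ integrand
      & genfun nu z = cintegral Lambda `]0, +oo[ integrand].

End representation.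

(* Main.v *)
Require Import Defs.
From HB Require Import structures.
From mathcomp Require Import all_boot all_order all_algebra.
From mathcomp Require Import complex ring lra.
From mathcomp Require Import all_classical all_reals all_analysis.
From mathcomp Require Import measurable_realfun.

Set Implicit Arguments.
Unset Strict Implicit.
Unset Printing Implicit Defensive.

Import Order.TTheory GRing.Theory Num.Theory.
Import numFieldNormedType.Exports.

Local Open Scope classical_set_scope.
Local Open Scope ring_scope.

(** Write F and H for the generating functions of the offspring law and of
    nu_min, F_n for the n-th iterate of F, and lambda = m ^ alpha. Tested on k
    |-> s ^ k, the definition of nu_min says that (1 - F_n s) / (1 - F_n 0)
    tends to 1 - H s; as (1 - F u) / (1 - u) tends to m when u tends to 1,
    this gives Schroeder's equation 1 - H (F s) = m (1 - H s)
    (yaglom_schroeder). On the other hand nu is lambda-invariant if and only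
    if its generating function G is finite and satisfies G (F s) = lambda G s
    on (0, 1) (invariant_genfun, invariant_genfun_lty, genfun_invariant). In
    the variable t = 1 - H s, which ranges over (0, 1], invariance of nu is
    therefore the homogeneity phi (m t) = lambda phi t of the function phi
    defined by G s = phi (1 - H s). The theorem amounts to saying that phi is
    then the Laplace transform of a measure M on (0, +oo): homogeneity means
    that x ^ alpha M(dx) is preserved by x |-> m x, and this measure is
    Lambda.

    From Lambda to nu: the function exp ((H z - 1) x) is the generating
    function of the compound Poisson law with parameter x and jump law nu_min
    (compound_poisson_genfun), so integrating these laws against x ^ (- alpha)
    Lambda(dx) produces nonnegative masses whose generating function is the
    required one (mixture_representation). Convergence holds because the
    segments between consecutive powers of m all have the same finite
    Lambda-measure (weighted_laplace_lty), and invariance is homogeneity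
    combined with Schroeder's equation (mixture_invariant).

    From nu to Lambda: let b_n(s) = - ln F_(n+1)(s), and let M_n be the
    measure with mass lambda ^ (- n - 1) nu {i} at the point i b_n(0). Since
    F_(n+1)(s) ^ i = exp (- i b_n(s)), the Laplace transform of M_(n+j) at
    b_n(s) / b_(n+j)(0) is lambda ^ (- n - j - 1) G (F_(n+1) s), which by
    invariance is lambda ^ (- j) G s for every n. The arguments b_n(s) /
    b_(n+j)(0) tend to (1 - H s) / m ^ j (cvg_log_survival_ratio), so a limit
    point M of the M_n has a Laplace transform taking the value lambda ^ (- j)
    G s at (1 - H s) / m ^ j (invariant_laplace). The M_n may have infinite
    mass; compactness is obtained by applying Helly's theorem to the functions
    exp (- Q_n), where Q_n is the quantile function of M_n, which take values
    in [0, 1] (laplace_compactness). Uniqueness of Laplace transforms then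
    converts homogeneity into scale invariance (homogeneous_laplace_density).
    The measure nu has the same power series on (0, 1) as the mixture built
    from Lambda, hence the same masses (power_series_inj), so that it inherits
    the representation at complex points.

    Uniqueness of Lambda: real points determine the Laplace transform of x ^
    (- alpha) Lambda(dx) on (0, 1], scale invariance determines it everywhere,
    and the measure follows (weighted_laplace_inj).

    When lambda <= 1 it suffices to look at state 0: the equation there is
    that the sum over i of nu {i} F(0) ^ i equals lambda nu {0}. The term i =
    0 is nu {0}, so the rest of the sum is (lambda - 1) nu {0}, and F(0) >= 1
    - m > 0. For lambda < 1 this forces nu = 0, and for lambda = 1 it forces
    nu to be carried by 0. *)

(** * Densities, and measures on the natural numbers *)

Section weighted_simple_functions.
Context d (T : measurableType d) (R : realType).
Variables (kappa : {measure set T -> \bar R}) (v : T -> R) (E : set T).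
Hypotheses (v0 : forall x, 0 <= v x) (mv : measurable_fun setT v) (mE : measurable E).
Local Open Scope ereal_scope.
Import HBNNSimple.

Lemma ge0_integral_simpleM (h : {nnsfun T >-> R}) :
  \int[kappa]_(x in E) ((h x)%:E * (v x)%:E) =
  \sum_(y \in range h) y%:E * \int[kappa]_(x in E `&` h @^-1` [set y]) (v x)%:E.
Proof.
pose term y x : \bar R := (y * \1_(h @^-1` [set y]) x)%:E * (v x)%:E.
have mvE : measurable_fun E (fun x => (v x)%:E) by apply/measurable_EFinP; exact: measurable_funTS.
have term0 y x : 0 <= term y x by rewrite mule_ge0 ?lee_fin// -lee_fin nnfun_muleindic_ge0.
have mterm y : measurable_fun E (term y).
  apply: emeasurable_funM => //.
  by apply/measurable_EFinP; apply: measurable_funM.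
transitivity (\int[kappa]_(x in E) \sum_(y \in range h) term y x).
  apply: eq_integral => x _; rewrite {1}fimfunE -fsumEFin//.
  by rewrite ge0_mule_fsuml// => y; exact: nnfun_muleindic_ge0.
rewrite ge0_integral_fsum//; apply: eq_fsbigr => y; rewrite inE => -[t _ ty].
have y0 : (0 <= y)%R by rewrite -ty.
under eq_integral do rewrite /term EFinM -muleA.
rewrite ge0_integralZl ?lee_fin//; last 2 first.
- apply: emeasurable_funM => //.
  by apply/measurable_EFinP.
- by move=> x _; rewrite mule_ge0 ?lee_fin.
congr (_ * _); rewrite [RHS]integral_mkcondr; apply: eq_integral => x _.
by rewrite epatch_indic muleC.
Qed.

Lemma ge0_integral_approxM (f : T -> \bar R) (mf : measurable_fun E f) :
  (forall x, E x -> 0 <= f x) ->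
  \int[kappa]_(x in E) (f x * (v x)%:E) =
  limn (fun n => \int[kappa]_(x in E) ((nnsfun_approx mE mf n x)%:E * (v x)%:E)).
Proof.
move=> f0; rewrite -monotone_convergence//.
- apply: eq_integral => x /[!inE] Ex; apply/esym/cvg_lim => //.
  by apply: cvgeZr => //; exact: cvg_nnsfun_approx.
- move=> n; by apply/measurable_EFinP; apply: measurable_funM; apply: measurable_funTS.
- by move=> n x _; rewrite mule_ge0 ?lee_fin.
- move=> x _ k n kn; rewrite lee_wpmul2r ?lee_fin//.
  exact/lefP/nd_nnsfun_approx.
Qed.

End weighted_simple_functions.

Section density.
Context d (T : measurableType d) (R : realType).
Variables (mu : {measure set T -> \bar R}) (w : T -> R).
Hypotheses (w0 : forall x, 0 <= w x) (mw : measurable_fun setT w).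
Local Open Scope ereal_scope.

Lemma density_measure_exists : exists nu : {measure set T -> \bar R},
  forall A, measurable A -> nu A = \int[mu]_(x in A) (w x)%:E.
Proof.
have mE : measurable_fun setT (EFin \o w) by exact/measurable_EFinP.
pose f (A : set T) := \int[mu]_(x in A) (w x)%:E.
have f0 : f set0 = 0 by rewrite /f integral_set0.
have fge0 A : 0 <= f A by apply: integral_ge0 => x _; rewrite lee_fin.
have fs : semi_sigma_additive f.
  move=> F mF tF mUF; rewrite /f ge0_integral_bigcup//; last first.
  - by move=> x _; rewrite lee_fin.
  - exact: measurable_funTS.
  apply: is_cvg_ereal_nneg_natsum_cond => n _ _; exact: fge0.
pose M := isMeasure.Build d T R f f0 fge0 fs.
pose nu : {measure set T -> \bar R} := HB.pack f M.
by exists nu => A mA.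
Qed.

Import HBNNSimple.

(** Both sides are limits along the same simple functions increasing to f, and
    on a simple function the identity is nuE applied to its level sets. *)
Lemma ge0_integral_density (nu : {measure set T -> \bar R}) :
  (forall A, measurable A -> nu A = \int[mu]_(x in A) (w x)%:E) ->
  forall (E : set T) (f : T -> \bar R), measurable E ->
    measurable_fun E f -> (forall x, E x -> 0 <= f x) ->
  \int[nu]_(x in E) f x = \int[mu]_(x in E) (f x * (w x)%:E).
Proof.
move=> nuE E f mE mf f0.
under [LHS]eq_integral do rewrite -[f _]mule1.
rewrite (ge0_integral_approxM nu (fun=> ler01) (measurable_cst _) mE mf f0).
rewrite (ge0_integral_approxM mu w0 mw mE mf f0).
congr (lim (_ @ \oo)); apply/funext => n.
rewrite (ge0_integral_simpleM nu (fun=> ler01) (measurable_cst _) mE).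
rewrite (ge0_integral_simpleM mu w0 mw mE).
apply: eq_fsbigr => y _; congr (_ * _).
have mEy : measurable (E `&` nnsfun_approx mE mf n @^-1` [set y]) by apply: measurableI.
by rewrite -nuE// integral_cst// mul1e.
Qed.

End density.

Section nat_measure.
Context {R : realType}.
Local Open Scope ereal_scope.
Implicit Type nu : {measure set nat -> \bar R}.

Lemma integral_nat_set1 nu (f : nat -> \bar R) k :
  \int[nu]_(x in [set k]) f x = f k * nu [set k].
Proof.
rewrite (eq_integral (cst (f k))) ?integral_cst//.
by move=> x; rewrite inE /= => ->.
Qed.

Lemma ge0_integral_nat nu (f : nat -> \bar R) : (forall k, 0 <= f k) ->
  \int[nu]_k f k = \sum_(0 <= k <oo) nu [set k] * f k.
Proof.
move=> f0; have -> : [set: nat] = \bigcup_k [set k].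
  by apply/seteqP; split => // k _; exists k.
rewrite ge0_integral_bigcup//; last first.
  by move=> i j _ _ [x [/= -> ->]].
by apply: eq_eseriesr => k _; rewrite integral_nat_set1 muleC.
Qed.

Lemma measure_nat_series nu (A : set nat) :
  nu A = \sum_(0 <= k <oo) nu [set k] * (\1_A k)%:E.
Proof.
by rewrite -ge0_integral_nat// integral_indic// setIT.
Qed.

Lemma nat_measure_exists (a : nat -> R) : (forall k, 0 <= a k)%R ->
  exists nu, forall k, nu [set k] = (a k)%:E.
Proof.
move=> a0.
have [|nu nuE] := density_measure_exists (@counting nat R : {measure set nat -> \bar R}) a0.
  by [].
exists nu => k; rewrite nuE// integral_nat_set1.
by rewrite /= /counting asboolT//= fset_set1 finmap.cardfs1 mule1.
Qed.

End nat_measure.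

(** * Uniqueness of Laplace transforms *)

Section bernoulli_bounds.
Context {R : realType}.

Lemma bernoulli_ge (a : R) n : -1 <= a -> 1 + n%:R * a <= (1 + a) ^+ n.
Proof.
move=> a1; elim: n => [|n IH]; first by rewrite mul0r addr0 expr0.
have a10 : 0 <= 1 + a by rewrite -lerBlDl sub0r.
apply: (@le_trans _ _ ((1 + a) * (1 + n%:R * a))); last first.
  by rewrite exprS ler_wpM2l.
rewrite -natr1; have := sqr_ge0 a; have : (0:R) <= n%:R by []. nra.
Qed.

Lemma cvg_nat_geometric (r : R) : 0 <= r < 1 -> n%:R * r ^+ n @[n --> \oo] --> 0.
Proof.
move=> /andP[r0 r1].
have [->|rn0] := eqVneq r 0.
  by apply: cvg_near_cst; near=> n; rewrite expr0n gtn_eqF ?mulr0//; near: n; exists 1%N.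
have rp : 0 < r by rewrite lt_def rn0.
set s := Num.sqrt r.
have s0 : 0 < s by rewrite sqrtr_gt0.
have s1 : s < 1 by rewrite -sqrtr1 ltr_sqrt.
have sr : s ^+ 2 = r by rewrite sqr_sqrtr.
set e := s^-1 - 1; have e0 : 0 < e by rewrite subr_gt0 invf_gt1.
have b n : n%:R * s ^+ n <= e^-1.
  rewrite -(@ler_pM2r _ (s ^- n))// ?invr_gt0 ?exprn_gt0// mulfK ?expf_neq0 ?gt_eqF//.
  rewrite ler_pdivlMl// mulrC.
  have : 1 + n%:R * e <= (1 + e) ^+ n.
    by apply: bernoulli_ge; rewrite (le_trans _ (ltW e0)).
  by rewrite [1 + e]addrC subrK exprVn; apply: le_trans; rewrite lerDr.
apply: (@squeeze_cvgr _ _ _ _ (cst 0) (fun n => e^-1 * s ^+ n)).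
- near=> n; rewrite mulr_ge0 ?exprn_ge0//= -sr -exprM mulnC muln2 -addnn exprD mulrA.
  by rewrite ler_wpM2r// exprn_ge0 ?ltW.
- exact: cvg_cst.
- rewrite -(mulr0 e^-1); apply: cvgMr; apply: cvg_expr; by rewrite ger0_norm ?ltW.
Unshelve. all: by end_near. Qed.

(** Expanded for q = expR (- s * x), the left side is a linear combination of
    exponentials of x, while the limit is the indicator of x > ln 2 / s: this
    is how Laplace transforms give access to tails. The exponent n * 2 ^ n is
    small compared with q ^- n when q < 1/2 and large when q >= 1/2, the
    factor n settling the case q = 1/2. *)
Lemma cvg_indicator_half (q : R) : 0 <= q <= 1 ->
  (fun n => (1 - q ^+ n) ^+ (n * 2 ^ n)) @ \oo --> ((q < 2^-1)%R%:R : R).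
Proof.
move=> /andP[q0 q1].
have qn n : 0 <= q ^+ n <= 1 by rewrite exprn_ge0// exprn_ile1.
have e n : (n * 2 ^ n)%:R * q ^+ n = n%:R * (2 * q) ^+ n.
  by rewrite natrM natrX exprMn mulrA.
have [qh|qh] := ltP q 2^-1.
- apply: (@squeeze_cvgr _ _ _ _ (fun n => 1 - n%:R * (2 * q) ^+ n) (cst 1)).
  + near=> n; have /andP[a b] := qn n; rewrite exprn_ile1 ?subr_ge0 ?andbT//; last first.
      by rewrite gerBl.
    rewrite -e -mulrN; apply: bernoulli_ge; by rewrite lerN2.
  + rewrite -[X in _ --> X](subr0 1); apply: cvgB; first exact: cvg_cst.
    apply: cvg_nat_geometric; rewrite mulr_ge0//=; lra.
  + exact: cvg_cst.
- apply: (@squeeze_cvgr _ _ _ _ (cst 0) (fun n => (n.+1%:R)^-1)).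
  + near=> n; have /andP[a b] := qn n; rewrite exprn_ge0 ?subr_ge0//=.
    rewrite -[_^-1]mul1r ler_pdivlMr//.
    apply: (@le_trans _ _ ((1 - q ^+ n) ^+ (n * 2 ^ n) * (1 + q ^+ n) ^+ (n * 2 ^ n))).
      rewrite ler_wpM2l ?exprn_ge0 ?subr_ge0//.
      apply: le_trans (bernoulli_ge _ _); last by rewrite (le_trans _ a).
      rewrite e -nat1r lerD2l ler_peMr//; apply: exprn_ege1; lra.
    rewrite -exprMn -subr_sqr expr1n exprn_ile1// ?subr_ge0 ?gerBl ?sqr_ge0//.
    by rewrite exprn_ile1.
  + exact: cvg_cst.
  + exact: cvg_harmonic.
Unshelve. all: by end_near. Qed.

End bernoulli_bounds.

Section laplace_uniqueness.
Context {R : realType}.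
Local Notation D := (`[0, +oo[%classic : set (measurableTypeR R)).
Implicit Types mu : {measure set (measurableTypeR R) -> \bar R}.

Let mD : measurable D. Proof. exact: measurable_itv. Qed.

Lemma measurable_expRZ (E : set (measurableTypeR R)) (c : R) :
  measurable_fun E (fun x : measurableTypeR R => expR (c * x)).
Proof.
apply: measurable_funTS; apply: measurableT_comp; first exact: measurable_expR.
exact: measurable_funM.
Qed.

Let expRN01 (c x : R) : 0 <= c -> 0 <= x -> 0 <= expR (- c * x) <= 1.
Proof.
by move=> c0 x0; rewrite expR_ge0/= -expR0 ler_expR mulNr oppr_le0 mulr_ge0.
Qed.

Let cst1_integrable mu : (mu D < +oo)%E -> mu.-integrable D (cst 1%E).
Proof.
move=> muD; apply: (@measurable_bounded_integrable _ _ _ mu (cst 1)) => //.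
by exists 1; split => // M M1 x _ /=; rewrite normr1 ltW.
Qed.

Let unit_integrable mu (f : measurableTypeR R -> R) : (mu D < +oo)%E ->
  measurable_fun D f -> (forall x, D x -> 0 <= f x <= 1) ->
  mu.-integrable D (EFin \o f).
Proof.
move=> muD mf f01; apply: (@le_integrable _ _ _ _ _ _ _ (cst 1%E)) => //.
- exact/measurable_EFinP.
- move=> x Dx /=; have /andP[a b] := f01 x Dx.
  by rewrite lee_fin normr1 ger0_norm.
- exact: cst1_integrable.
Qed.

Let g (t e : R) N : measurableTypeR R -> R :=
  fun x => expR (- e * x) * (1 - expR (- t * x)) ^+ N.

Let mg t e N E : measurable_fun E (g t e N).
Proof.
apply: measurable_funM; first exact: measurable_expRZ.
apply: measurable_funX; apply: measurable_funB => //; exact: measurable_expRZ.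
Qed.

Let g01 t e N x : 0 <= t -> 0 <= e -> D x -> 0 <= g t e N x <= 1.
Proof.
move=> t0 e0; rewrite /= in_itv/= andbT => x0.
have /andP[a b] := expRN01 t0 x0; have /andP[a' b'] := expRN01 e0 x0.
rewrite mulr_ge0//=; last by rewrite exprn_ge0// subr_ge0.
by rewrite mulr_ile1// ?exprn_ge0 ?exprn_ile1 ?subr_ge0 ?gerBl.
Qed.

Section finite.
Variables mu mu' : {measure set (measurableTypeR R) -> \bar R}.
Hypotheses (muD : (mu D < +oo)%E) (muD' : (mu' D < +oo)%E).
Hypothesis eL : forall t, 0 <= t ->
  (\int[mu]_(x in D) (expR (- t * x))%:E = \int[mu']_(x in D) (expR (- t * x))%:E)%E.

Let integral_g t e N : 0 <= t -> 0 <= e ->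
  (\int[mu]_(x in D) (g t e N x)%:E = \int[mu']_(x in D) (g t e N x)%:E)%E.
Proof.
move=> t0; elim: N e => [|N IH] e e0.
  under eq_integral do rewrite /g expr0 mulr1.
  by under [RHS]eq_integral do rewrite /g expr0 mulr1; exact: eL.
have gS x : ((g t e N.+1 x)%:E = (g t e N x)%:E - (g t (e + t) N x)%:E)%E.
  rewrite -EFinB; congr EFin; rewrite /g opprD mulrDl expRD exprS; ring.
have et0 : 0 <= e + t by rewrite addr_ge0.
under eq_integral do rewrite gS; under [RHS]eq_integral do rewrite gS.
rewrite !integralB_EFin//.
- by rewrite !IH.
- by apply: unit_integrable => // x; exact: g01.
- by apply: unit_integrable => // x; exact: g01.
- by apply: unit_integrable => // x; exact: g01.
- by apply: unit_integrable => // x; exact: g01.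
Qed.

Let dct_eq (f_ : nat -> measurableTypeR R -> R) (f : measurableTypeR R -> R) :
  (forall n, measurable_fun D (f_ n)) -> measurable_fun D f ->
  (forall n x, D x -> 0 <= f_ n x <= 1) ->
  (forall n, \int[mu]_(x in D) (f_ n x)%:E = \int[mu']_(x in D) (f_ n x)%:E)%E ->
  (forall x, D x -> f_ ^~ x @ \oo --> f x) ->
  (\int[mu]_(x in D) (f x)%:E = \int[mu']_(x in D) (f x)%:E)%E.
Proof.
move=> mf_ mf f01 ef cf.
have key (m : {measure set (measurableTypeR R) -> \bar R}) : (m D < +oo)%E ->
    ((\int[m]_(x in D) (f_ n x)%:E) @[n --> \oo] --> \int[m]_(x in D) (f x)%:E)%E.
  move=> mDoo.
  have [] := @dominated_convergence _ _ _ m _ mD (fun n x => (f_ n x)%:E)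
      (fun x => (f x)%:E) (cst 1%E) => //.
  - by move=> n; exact/measurable_EFinP.
  - exact/measurable_EFinP.
  - by apply: aeW => x Dx; apply: cvg_EFin; [exact: nearW|exact: cf].
  - exact: cst1_integrable.
  - apply: aeW => x n Dx; have /andP[a b] := f01 n x Dx.
    by rewrite lee_fin ger0_norm.
have h := key _ muD; have h' := key _ muD'.
have {}h : ((fun n => \int[mu']_(x in D) (f_ n x)%:E) @ \oo -->
    \int[mu]_(x in D) (f x)%:E)%E by rewrite -(funext ef).
exact: (cvg_unique _ h h').
Qed.

(** By cvg_indicator_half the functions g (n * s) 0 (n * 2 ^ n) converge
    boundedly to the indicator of the ray, and expanding the power shows that
    the two measures agree on them. For the ray at 0 the functions 1 - expR (-
    n * x) serve the same purpose. *)
Let measure_ray t : mu (D `&` `]t, +oo[) = mu' (D `&` `]t, +oo[).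
Proof.
have [t0|t0] := ltP t 0.
  suff -> : D `&` `]t, +oo[ = D.
    have := @eL 0 (lexx _).
    under eq_integral do rewrite oppr0 mul0r expR0.
    under [RHS]eq_integral do rewrite oppr0 mul0r expR0.
    by rewrite !integral_cst// !mul1e.
  apply/seteqP; split => [x []//|x /=]; rewrite !in_itv/= !andbT => x0.
  by split => //; exact: lt_le_trans x0.
have mt : measurable (`]t, +oo[ : set (measurableTypeR R)) by exact: measurable_itv.
have E (m : {measure set (measurableTypeR R) -> \bar R}) : (m (D `&` `]t, +oo[) = \int[m]_(x in D) (\1_(`]t, +oo[) x : R)%:E)%E.
  by rewrite setIC; exact/esym/integral_indic.
rewrite !{}E.
have [tp|tn] := ltP 0 t.
- pose s := ln 2 / t.
  have s0 : 0 < s by rewrite divr_gt0// ln_gt0// ltr1n.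
  apply: (@dct_eq (fun n => g (n%:R * s) 0 (n * 2 ^ n))) => //.
  + by move=> n x; apply: g01 => //; rewrite mulr_ge0// ltW.
  + by move=> n; apply: integral_g => //; rewrite mulr_ge0// ltW.
  + move=> x; rewrite /= in_itv/= andbT => x0.
    have q01 := expRN01 (ltW s0) x0.
    have := cvg_indicator_half q01.
    have -> : (expR (- s * x) < 2^-1)%R%:R = \1_(`]t, +oo[) x :> R.
      rewrite indicE; congr (nat_of_bool _)%:R.
      rewrite -(@lnK _ (2^-1)) ?posrE ?invr_gt0// ltr_expR lnV ?posrE// mulNr ltrN2.
      rewrite /s mulrAC ltr_pdivlMr// ltr_pM2l ?ln_gt0 ?ltr1n//.
      by apply/idP/idP; rewrite ?inE /= in_itv/= andbT.
    apply: cvg_trans; apply: near_eq_cvg; near=> n.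
    by rewrite /g oppr0 mul0r expR0 mul1r -expRM_natl mulrA mulrN.
- have {tn t0} -> : t = 0 by apply/eqP; rewrite eq_le tn.
  apply: (@dct_eq (fun n => g n%:R 0 1)) => //.
  + by move=> n x; apply: g01.
  + by move=> n; apply: integral_g.
  + move=> x; rewrite /= in_itv/= andbT le_eqVlt => /predU1P[<-|x0].
      rewrite indicE memNset/=; last by rewrite in_itv/= ltxx.
      apply: cvg_near_cst; near=> n.
      by rewrite /g !mulr0 expR0 subrr expr1 mulr0.
    rewrite indicE mem_set/=; last by rewrite in_itv/= x0.
    have e1 : `|expR (- x)| < 1 by rewrite ger0_norm ?expR_ge0// expR_lt1 oppr_lt0.
    have := cvg_expr e1 => h.
    have {h} : (fun n => 1 - expR (- x) ^+ n) @ \oo --> (1 - 0 : R).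
      by apply: cvgB => //; exact: cvg_cst.
    rewrite subr0; apply: cvg_trans; apply: near_eq_cvg; near=> n.
    by rewrite /g oppr0 mul0r expR0 mul1r expr1 -expRM_natl mulNr mulrN.
Unshelve. all: by end_near. Qed.

Lemma finite_laplace_inj A : measurable A -> A `<=` D -> mu A = mu' A.
Proof.
move=> mA AD.
suff : mrestr mu mD A = mrestr mu' mD A by rewrite /mrestr !(setIidl AD).
apply: (@measure_unique _ R (measurableTypeR R) (@RGenOInfty.G R)
  (fun n => `](- n%:R), +oo[%classic) (RGenOInfty.measurableE R)
  _ _ _ (mrestr mu mD) (mrestr mu' mD)) => //.
- move=> X Y [x ->] [y ->]; exists (Num.max x y).
  apply/seteqP; split => z /=; rewrite !in_itv/= !andbT gt_max.
    by move=> [-> ->].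
  by move=> /andP.
- by move=> n; eexists.
- apply/seteqP; split => // x _; exists (Num.bound x) => //=.
  by rewrite in_itv/= andbT ltrNl; exact: unstable.ltrNbound.
- by move=> _ [t ->]; have := measure_ray t; rewrite setIC.
- move=> n; apply: le_lt_trans muD; rewrite /mrestr.
  apply: le_measure; rewrite ?inE//.
  by apply: measurableI => //; exact: measurable_itv.
Qed.

End finite.

(** The density expR (- x) makes both measures finite and shifts their
    transforms by 1. *)
Lemma laplace_inj mu mu' :
  (forall t, (0 < t)%R -> \int[mu]_(x in D) (expR (- t * x))%:E < +oo)%E ->
  (forall t, (0 < t)%R -> \int[mu]_(x in D) (expR (- t * x))%:E =
                      \int[mu']_(x in D) (expR (- t * x))%:E)%E ->
  forall A, measurable A -> A `<=` D -> mu A = mu' A.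
Proof.
move=> fin eL A mA AD.
pose w (x : measurableTypeR R) := expR (- 1 * x).
have w0 x : 0 <= w x by exact: expR_ge0.
have mw : measurable_fun setT w by exact: measurable_expRZ.
have [nu nuE] := density_measure_exists mu w0 mw.
have [nu' nuE'] := density_measure_exists mu' w0 mw.
have dE (m n : {measure set (measurableTypeR R) -> \bar R}) (mE : forall A, measurable A -> n A = (\int[m]_(x in A) (w x)%:E)%E) t :
    (\int[n]_(x in D) (expR (- t * x))%:E = \int[m]_(x in D) (expR (- (t + 1) * x))%:E)%E.
  rewrite (ge0_integral_density w0 mw mE)//; last first.
    by apply/measurable_EFinP; exact: measurable_expRZ.
  by apply: eq_integral => x _; rewrite -EFinM -expRD opprD mulrDl.
have E : forall B, measurable B -> B `<=` D -> nu B = nu' B.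
  apply: finite_laplace_inj.
  - by rewrite nuE// fin.
  - by rewrite nuE'// -eL// fin.
  - by move=> t t0; rewrite (dE _ _ nuE) (dE _ _ nuE'); apply: eL; rewrite ltr_wpDl.
have F (m n : {measure set (measurableTypeR R) -> \bar R}) (mE : forall A, measurable A -> n A = (\int[m]_(x in A) (w x)%:E)%E) :
    m A = (\int[n]_(x in A) (expR (1 * x))%:E)%E.
  rewrite (ge0_integral_density w0 mw mE)//; last first.
    by apply/measurable_EFinP; exact: measurable_expRZ.
  rewrite -[LHS]mul1e -integral_cst//; apply: eq_integral => x _.
  by rewrite -EFinM -expRD mulNr subrr expR0.
rewrite (F mu nu)// (F mu' nu')//; apply: eq_measure_integral => B mB BA.
by apply: E => //; exact: subset_trans AD.
Qed.

End laplace_uniqueness.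

Section power_series_uniqueness.
Context {R : realType}.

(** With s = expR (- t) a power series in s is the Laplace transform of the
    image measure on the integers of the real line. *)
Lemma power_series_inj (a b : {measure set nat -> \bar R}) :
  (forall s : R, (0 < s < 1)%R -> \int[a]_k (s ^+ k)%:E < +oo)%E ->
  (forall s : R, (0 < s < 1)%R -> \int[a]_k (s ^+ k)%:E = \int[b]_k (s ^+ k)%:E)%E ->
  forall k, a [set k] = b [set k].
Proof.
move=> fin eab k.
pose phi (n : nat) : measurableTypeR R := n%:R.
have mphi : measurable_fun setT phi by [].
pose D : set (measurableTypeR R) := `[0, +oo[%classic.
have mD : measurable D by exact: measurable_itv.
have phiD : phi @^-1` D = setT.
  by apply/seteqP; split => // n _; rewrite /D/= in_itv/= /phi ler0n.
have phik : phi @^-1` [set k%:R] = [set k].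
  apply/seteqP; split => [n|_ ->//].
  by rewrite /phi/= => /eqP; rewrite eqr_nat => /eqP.
have E (m : {measure set nat -> \bar R}) t :
    (\int[pushforward m phi]_(x in D) (expR (- t * x))%:E = \int[m]_k (expR (- t) ^+ k)%:E)%E.
  rewrite ge0_integral_pushforward//.
  - by rewrite phiD; apply: eq_integral => n _; rewrite /= /phi -expRM_natr.
  - by apply/measurable_EFinP; exact: measurable_expRZ.
have e01 (t : R) : 0 < t -> 0 < expR (- t) < 1.
  by move=> t0; rewrite expR_gt0/= expR_lt1 oppr_lt0.
rewrite -phik -!/(pushforward _ phi _).
apply: laplace_inj.
- by move=> t t0; rewrite E fin// e01.
- by move=> t t0; rewrite !E eab// e01.
- exact: measurable_set1.
- by move=> _ /= ->; rewrite in_itv/= ler0n.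
Qed.

End power_series_uniqueness.

(** * Helly's theorem and compactness for Laplace transforms *)

Section helly.
Context {R : realType}.
Import ArrowAsProduct.

(** The limit g is a cluster point of the sequence in the compact product of
    copies of [0, 1], hence monotone with countably many discontinuities. The
    subsequence is chosen to converge to g on the rationals; at a continuity
    point of g, monotonicity squeezes the values between those at rational
    neighbours. *)
Lemma helly_selection (f_ : nat -> R -> R) :
  (forall n, {homo f_ n : x y / x <= y}) -> (forall n x, 0 <= f_ n x <= 1) ->
  exists g : R -> R,
    [/\ {homo g : x y / x <= y}, forall x, 0 <= g x <= 1 &
     exists2 n_ : nat -> nat, (forall k, (k <= n_ k)%N) &
     exists2 C : set R, countable C &
       forall x, 0 < x -> ~ C x -> (f_ (n_ k) x) @[k --> \oo] --> g x].
Proof.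
move=> ndf f01.
have cpt := @tychonoff R (fun=> R) (fun=> `[0, 1]%classic)
  (fun=> @segment_compact R 0 1).
have [|g [g01 clg]] := cpt (f_ @ \oo) _.
  by exists 0%N => // n _ x /=; rewrite in_itv/=.
have [F FF [projF clF]] : exists2 F : set_system (R -> R), Filter F &
    (forall a (e : R), 0 < e -> F [set f | `|g a - f a| < e]) /\
    forall A B, (f_ @ \oo) A -> F B -> A `&` B !=set0.
  exists (nbhs (g : prod_topology (fun=> R))); first exact: nbhs_filter.
  split; last by move=> A B; exact: clg.
  move=> a e e0.
  exact: (@proj_continuous R (fun=> R) a g _ (nbhsx_ballx (g a) e e0)).
have nbg (s : seq R) (e : R) : 0 < e ->
    F [set f | forall x, x \in s -> `|g x - f x| < e].
  move=> e0; elim: s => [|a s IH]; first by apply: filterE => f x; rewrite in_nil.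
  apply: filterS2 IH (projF a e e0) => f fs fa x; rewrite inE => /predU1P[->//|].
  exact: fs.
have key N (s : seq R) (e : R) : 0 < e ->
    exists2 n, (N <= n)%N & forall x, x \in s -> `|g x - f_ n x| < e.
  move=> e0.
  have [|h [[n /= Nn <-] hs]] := clF [set f_ n | n in [set n | (N <= n)%N]]
      [set f | forall x, x \in s -> `|g x - f x| < e] _ (nbg s e e0).
    by exists N => // n /= Nn; exists n.
  by exists n.
have gnd : {homo g : x y / x <= y}.
  move=> x y xy; apply/ler_addgt0Pl => e e0.
  have [n _ h] := key 0%N [:: x; y] (e / 2) (divr_gt0 e0 (ltr0Sn _ _)).
  have := h x; rewrite inE eqxx => /(_ isT).
  have := h y; rewrite !inE eqxx orbT => /(_ isT).
  have := ndf n x y xy; rewrite !ltr_norml => ? /andP[? ?] /andP[? ?]; lra.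
exists g; split => //.
(* q enumerates the rationals; codes of no rational are sent to 0. *)
pose q (j : nat) : R := ratr (odflt 0 (unpickle j)).
have /choice[n_ n_P] k : exists n, (k <= n)%N /\
    forall j, (j <= k)%N -> `|g (q j) - f_ n (q j)| < k.+1%:R^-1.
  have k0 : 0 < k.+1%:R^-1 :> R by rewrite invr_gt0.
  have [n kn h] := key k [seq q j | j <- iota 0 k.+1] _ k0.
  by exists n; split => // j jk; apply: h; apply: map_f; rewrite mem_iota.
exists n_; first by move=> k; have [] := n_P k.
exists (\bigcup_j [set x | (x \in `]0, j%:R[) /\ discontinuity g x]).
  apply: bigcup_countable => // j _; apply: discontinuity_countable.
  by move=> x y _ _; exact: gnd.
move=> x x0 Cx.
have cl : cvg (g y @[y --> x^'-]).
  apply: nondecreasing_at_left_is_cvgr.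
    by near=> y => a b _ _; exact: gnd.
  near=> y; exists 1 => _ [z _ <-]; by have := g01 z; rewrite /= in_itv/= => /andP[].
have cr : cvg (g y @[y --> x^'+]).
  apply: nondecreasing_at_right_is_cvgr.
    by near=> y => a b _ _; exact: gnd.
  near=> y; exists 0 => _ [z _ <-]; by have := g01 z; rewrite /= in_itv/= => /andP[].
have elr : lim (g y @[y --> x^'-]) = lim (g y @[y --> x^'+]).
  apply/eqP/negPn/negP => ne; apply: Cx; exists (Num.bound x) => //=.
  split; last by split.
  by rewrite in_itv/= x0; exact: unstable.ltr_bound.
have gl : g x = lim (g y @[y --> x^'-]).
  apply/eqP; rewrite eq_le {1}elr; apply/andP; split.
    by apply: limr_ge => //; near=> y; apply: gnd; near: y; exact: nbhs_right_ge.
  by apply: limr_le => //; near=> y; apply: gnd; near: y; exact: nbhs_left_le.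
have {}cl : g y @[y --> x^'-] --> g x by rewrite gl.
have {}cr : g y @[y --> x^'+] --> g x by rewrite gl elr.
apply/cvgrPdist_lt => /= e e0.
have e20 : 0 < e / 2 by rewrite divr_gt0.
have [y1 [y1x hy1]] : exists y, y < x /\ `|g x - g y| < e / 2.
  have /cvgrPdist_lt/(_ _ e20) := cl => h.
  have /filter_ex [y [? ?]] : \forall y \near x^'-, y < x /\ `|g x - g y| < e / 2.
    by near=> y; split; [near: y; exact: nbhs_left_lt|near: y].
  by exists y.
have [y2 [y2x hy2]] : exists y, x < y /\ `|g x - g y| < e / 2.
  have /cvgrPdist_lt/(_ _ e20) := cr => h.
  have /filter_ex [y [? ?]] : \forall y \near x^'+, x < y /\ `|g x - g y| < e / 2.
    by near=> y; split; [near: y; exact: nbhs_right_gt|near: y].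
  by exists y.
have [q1] := rat_in_itvoo y1x; rewrite in_itv/= => /andP[yq1 q1x].
have [q2] := rat_in_itvoo y2x; rewrite in_itv/= => /andP[xq2 qy2].
have qE (r : rat) : q (pickle r) = ratr r by rewrite /q pickleK.
have squeeze (gx g1 g2 h1 h2 fx f1 f2 d c : R) : c < d / 2 ->
    - (d / 2) < gx - h1 < d / 2 -> - (d / 2) < gx - h2 < d / 2 ->
    gx <= g2 -> g1 <= gx -> g2 <= h2 -> h1 <= g1 -> fx <= f2 -> f1 <= fx ->
    - c < g2 - f2 < c -> - c < g1 - f1 < c -> - d < gx - fx < d by lra.
near=> k.
have [_ hk] := n_P k.
have kq1 : (pickle q1 <= k)%N by near: k; exact: nbhs_infty_ge.
have kq2 : (pickle q2 <= k)%N by near: k; exact: nbhs_infty_ge.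
have := hk _ kq1; have := hk _ kq2; rewrite !qE.
have ke : k.+1%:R^-1 < e / 2.
  by near: k; exact: near_infty_natSinv_lt (PosNum e20).
have := ndf (n_ k) _ _ (ltW q1x); have := ndf (n_ k) _ _ (ltW xq2).
have := gnd _ _ (ltW yq1); have := gnd _ _ (ltW qy2).
have := gnd _ _ (ltW q1x); have := gnd _ _ (ltW xq2).
move: ke hy1 hy2; rewrite !ltr_norml.
move=> ? ? ? ? ? ? ? ? ? ? ?.
by apply: (@squeeze (g x) (g (ratr q1)) (g (ratr q2)) (g y1) (g y2)
  (f_ (n_ k) x) (f_ (n_ k) (ratr q1)) (f_ (n_ k) (ratr q2)) e k.+1%:R^-1).
Unshelve. all: by end_near. Qed.

End helly.

Section powR_limits.
Context {R : realType}.

Lemma ge0_ler_powR_base (r x y : R) : 0 <= r -> 0 <= x -> x <= y -> x `^ r <= y `^ r.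
Proof.
move=> r0 x0 xy; apply: ge0_ler_powR => //; rewrite nnegrE//.
exact: le_trans xy.
Qed.

Lemma ler_powR_exp (a x y : R) : 0 <= a <= 1 -> 0 < x -> x <= y -> a `^ y <= a `^ x.
Proof.
move=> /andP[a0 a1] x0 xy; have [->|an0] := eqVneq a 0.
  by rewrite !powR0// gt_eqF// (lt_le_trans x0).
by apply: ger_powR => //; rewrite lt_def an0 a0.
Qed.

(** Where the bases tend to 0 the limit relies on the exponents staying away
    from 0. *)
Lemma cvg_powR2 (a t : nat -> R) (a0 t0 : R) : 0 < t0 -> (forall n, 0 <= a n <= 1) ->
  a @ \oo --> a0 -> t @ \oo --> t0 -> (fun n => a n `^ t n) @ \oo --> a0 `^ t0.
Proof.
move=> t00 a01 ca ct.
have a00 : 0 <= a0.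
  rewrite -(cvg_lim (@Rhausdorff R) ca); apply: limr_ge; first exact: cvgP ca.
  by apply: nearW => n; have /andP[] := a01 n.
have [a0E|a0n] := eqVneq a0 0.
  rewrite a0E powR0 ?gt_eqF//; apply/cvgrPdist_lt => e e0.
  have t20 : 0 < t0 / 2 by rewrite divr_gt0.
  near=> n; rewrite sub0r normrN ger0_norm ?powR_ge0//.
  have tn : t0 / 2 <= t n.
    by near: n; apply: (cvgr_ge _ ct); rewrite ltr_pdivrMr// mulr_natr mulr2n ltrDl.
  apply: le_lt_trans (ler_powR_exp (a01 n) t20 tn) _.
  have an : a n < (e / 2) `^ (t0 / 2)^-1.
    near: n; apply: (cvgr_lt _ ca); rewrite a0E powR_gt0// divr_gt0//.
  apply: (@le_lt_trans _ _ (((e / 2) `^ (t0 / 2)^-1) `^ (t0 / 2))).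
    have /andP[an0 _] := a01 n.
    by apply: ge0_ler_powR_base => //; exact: ltW.
  by rewrite -powRrM mulVf ?gt_eqF// powRr1 ?ltW ?divr_gt0// ltr_pdivrMr// mulr_natr mulr2n ltrDl.
have a0p : 0 < a0 by rewrite lt_def a0n.
rewrite {2}/powR (negbTE a0n).
have : (fun n => expR (t n * ln (a n))) @ \oo --> expR (t0 * ln a0).
  apply: continuous_cvg; first exact: continuous_expR.
  by apply: cvgM => //; apply: continuous_cvg => //; exact: continuous_ln.
apply: cvg_trans; apply: near_eq_cvg; near=> n.
have an : 0 < a n by near: n; exact: (cvgr_gt _ ca).
by rewrite /powR gt_eqF.
Unshelve. all: by end_near. Qed.

End powR_limits.

Section laplace_compactness.
Context {R : realType}.
Local Notation D := (`]0, +oo[%classic : set R).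
Local Notation leb := (@lebesgue_measure R).

(** If Q is the quantile function of a measure on [0, +oo), the change of
    variables x = Q v turns its Laplace transform at t into the integral over
    v > 0 of E v `^ t, where E = exp (- Q). Such an E is nonincreasing with
    values in [0, 1] even when the measure is infinite, so Helly's theorem
    applies to the E_n without any normalization. The bounds on v * E_n v `^ e
    rule out an escape of mass: they dominate E_n v `^ t by a multiple of 1 /
    (1 + v ^ 2). The measure M is the image of the Lebesgue measure under - ln
    of the limit function. *)
Lemma laplace_compactness (E_ : nat -> R -> R) :
  (forall n, {homo E_ n : x y /~ x <= y}) -> (forall n x, 0 <= E_ n x <= 1) ->
  (forall e, 0 < e -> exists C : R, exists N : nat, forall n, (N <= n)%N ->
     forall v, 0 < v -> v * E_ n v `^ e <= C) ->
  exists (M : {measure set (measurableTypeR R) -> \bar R}) (n_ : nat -> nat),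
    (forall k, (k <= n_ k)%N) /\
    forall (t_ : nat -> R) (t : R), 0 < t -> t_ @ \oo --> t ->
      ((fun k => \int[leb]_(v in D) (E_ (n_ k) v `^ t_ k)%:E)%E @ \oo -->
       \int[M]_(x in `[0%R, +oo[) (expR (- t * x))%:E)%E.
Proof.
move=> niE E01 bE.
have [||g [gnd g01 [n_ n_k [C cC cg]]]] := @helly_selection R (fun n v => 1 - E_ n v).
- by move=> n x y xy; rewrite lerD2l lerN2 niE.
- by move=> n x; have := E01 n x; lra.
pose G v := 1 - g v.
have G01 v : 0 <= G v <= 1 by have := g01 v; rewrite /G; lra.
have mG : measurable_fun setT G.
  by apply: measurable_funB => //; exact: nondecreasing_measurable.
have mE n : measurable_fun setT (E_ n).
  rewrite (_ : E_ n = fun v => - (- E_ n v)); last by apply/funext => v; rewrite opprK.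
  apply: measurableT_comp => //; apply: nondecreasing_measurable => // x y xy.
  by rewrite lerN2 niE.
have cE v : 0 < v -> ~ C v -> E_ (n_ k) v @[k --> \oo] --> G v.
  move=> v0 Cv; have := cg v v0 Cv => h.
  rewrite (_ : (fun k => E_ (n_ k) v) = fun k => 1 - (1 - E_ (n_ k) v)).
    by apply: cvgB => //; exact: cvg_cst.
  by apply/funext => k; rewrite opprB addrC subrK.
(* Where the limit function vanishes the quantile is infinite; these v are
   sent outside of [0, +oo). *)
pose phi (v : R) : measurableTypeR R := if (0 < v) && (0 < G v) then - ln (G v) else -1.
have mphi : measurable_fun setT phi.
  apply: measurable_fun_ifT => //.
    apply: measurable_and; apply: measurable_fun_ltr => //.
  apply: measurableT_comp => //; exact: measurableT_comp.
exists (pushforward leb phi), n_; split => // t_ t t0 ct.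
have mD : measurable D by exact: measurable_itv.
have phiD : phi @^-1` `[0, +oo[ = [set v | (0 < v) && (0 < G v)].
  apply/seteqP; split => v; rewrite /= in_itv/= andbT /phi.
    by case: ifP => // _; rewrite ler0N1.
  move=> /[dup] /andP[v0 Gv0] ->; rewrite oppr_ge0 ln_le0//.
  by have /andP[] := G01 v.
have mphiD : measurable (phi @^-1` `[0, +oo[).
  by rewrite -[X in measurable X]setTI; apply: mphi => //; exact: measurable_itv.
rewrite ge0_integral_pushforward//=; last first.
  by apply/measurable_EFinP; exact: measurable_expRZ.
rewrite [X in _ --> X](_ : _ = \int[leb]_(v in D) (G v `^ t)%:E)%E; last first.
  rewrite phiD integral_mkcond [RHS]integral_mkcond; apply: eq_integral => v _.
  rewrite !patchE /phi; case: ifPn => [|].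
    rewrite inE/= => /[dup] vG /andP[v0 Gv0]; rewrite vG mem_set/=; last by rewrite in_itv/= v0.
    by rewrite mulrNN /powR gt_eqF.
  rewrite notin_setE/= => vG; case: ifPn => // /[!inE]/=; rewrite in_itv/= andbT => v0.
  suff -> : G v = 0 by rewrite powR0 ?gt_eqF.
  apply/eqP; rewrite eq_le; have /andP[-> _] := G01 v; rewrite andbT leNgt.
  by apply/negP => Gv0; apply: vG; rewrite v0.
(* The square of v * E v `^ (t / 4) <= K bounds E v `^ (t / 2) by K ^+ 2 / v
   ^+ 2, which is integrable at infinity; eventually t_ k >= t / 2. *)
have e0 : 0 < t / 4 by rewrite divr_gt0.
have [K [N KN]] := bE _ e0.
have K0 : 0 <= K.
  by apply: le_trans (KN N (leqnn _) 1 ltr01); rewrite mul1r powR_ge0.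
have [N' _ hN'] : \forall k \near \oo, t / 2 <= t_ k.
  by apply: (cvgr_ge _ ct); rewrite ltr_pdivrMr// mulr_natr mulr2n ltrDl.
pose N2 := maxn N N'.
have bnd k v : (N2 <= k)%N -> 0 < v ->
    E_ (n_ k) v `^ t_ k <= (1 + K ^+ 2) * (oneDsqr v)^-1.
  move=> N2k v0; have Nk : (N <= n_ k)%N.
    by apply: leq_trans (n_k k); apply: leq_trans N2k; rewrite leq_maxl.
  have tk : t / 2 <= t_ k by apply: hN' => /=; apply: leq_trans N2k; rewrite leq_maxr.
  have := KN _ Nk v v0; set a := E_ (n_ k) v; set b := a `^ (t / 4) => hb.
  have ab : a `^ (t / 2) = b ^+ 2.
    by rewrite -powR_mulrn ?powR_ge0// -powRrM; congr (_ `^ _); lra.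
  have b0 : 0 <= b by rewrite powR_ge0.
  have b1 : b <= 1.
    have /andP[a0 a1] := E01 (n_ k) v.
    by have := ge0_ler_powR_base (ltW e0) a0 a1; rewrite powR1.
  apply: le_trans (_ : _ <= b ^+ 2) _.
    by rewrite -ab; apply: ler_powR_exp => //; rewrite ?divr_gt0//; exact: E01.
  rewrite ler_pdivlMr /oneDsqr; last by rewrite ltr_wpDr ?sqr_ge0.
  rewrite mulrDr mulr1 lerD//; first by rewrite expr_le1.
  by rewrite -exprMn mulrC lerXn2r// ?nnegrE// mulr_ge0// ltW.
rewrite -(cvg_shiftn N2).
have [] := @dominated_convergence _ _ _ leb D mD
  (fun n v => (E_ (n_ (n + N2)) v `^ t_ (n + N2))%:E) (fun v => (G v `^ t)%:E)
  (fun v => ((1 + K ^+ 2) * (oneDsqr v)^-1)%:E) => //.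
- move=> n; apply/measurable_EFinP; apply: measurable_funTS.
  exact: (measurableT_comp (measurable_powR _) (mE _)).
- apply/measurable_EFinP; apply: measurable_funTS.
  exact: (measurableT_comp (measurable_powR _) mG).
- exists C; split.
  + exact: countable_measurable.
  + exact: countable_lebesgue_measure0.
  + move=> v /= h; apply: contrapT => Cv; apply: h => /=; rewrite in_itv/= andbT => v0.
    apply: cvg_EFin; first exact: nearW.
    apply: cvg_powR2 => //.
    * by have := cE v v0 Cv; rewrite -(cvg_shiftn N2).
    * by rewrite (cvg_shiftn N2).
- apply: (@integrableS _ _ _ leb `[0, +oo[%classic) => //.
  + by move=> x /=; rewrite !in_itv/= !andbT => /ltW.
  + have mD0 : measurable (`[0, +oo[%classic : set (measurableTypeR R)) by exact: measurable_itv.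
    have h : leb.-integrable `[0, +oo[ (fun v => ((oneDsqr v)^-1)%:E).
      apply/integrableP; split.
        apply/measurable_EFinP; apply: measurable_funTS.
        by apply: continuous_measurable_fun; exact: continuous_oneDsqrV.
      rewrite (_ : (\int[leb]_(x in _) _)%E = (\int[leb]_(x in `[0%R, +oo[) ((oneDsqr x)^-1)%:E)%E).
        by rewrite integral0y_oneDsqr ltry.
      by apply: eq_integral => x _; rewrite gee0_abs.
    by have := integrableZl mD0 (1 + K ^+ 2) h.
- apply: aeW => v n /=; rewrite in_itv/= andbT => v0.
  by rewrite lee_fin ger0_norm ?powR_ge0// bnd// leq_addl.
Unshelve. all: exact: mphi.
Qed.

End laplace_compactness.

(** * Absolutely convergent complex series *)

Section cauchy_product.
Context {R : realType}.
Implicit Types a b : nat -> R.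

Definition convolve (K : pzSemiRingType) (a b : nat -> K) (n : nat) : K :=
  \sum_(i < n.+1) a i * b (n - i)%N.

Let tri a b N : R := \sum_(0 <= i < N) a i * \sum_(0 <= j < N - i) b j.

Let series_convolve a b N : series (convolve a b) N = tri a b N.
Proof.
elim: N => [|N IH]; first by rewrite /series/= /tri !big_geq.
rewrite seriesSr IH /tri [RHS]big_nat_recr//= subSnn.
rewrite big_nat1 /convolve big_ord_recr/= subnn addrA; congr (_ + _).
rewrite -(big_mkord xpredT (fun i => a i * b (N - i)%N)) -big_split/= big_nat [RHS]big_nat.
apply: eq_bigr => i /andP[_ iN]; rewrite -mulrDr; congr (_ * _).
by rewrite subSn ?(ltnW iN)// big_nat_recr.
Qed.

(** The square i, j < N lies between the triangles i + j < N and i + j < 2 N. *)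
Let nnseries_convolve a b (A B : R) :
  (forall n, 0 <= a n) -> (forall n, 0 <= b n) ->
  series a @ \oo --> A -> series b @ \oo --> B ->
  series (convolve a b) @ \oo --> A * B.
Proof.
move=> a0 b0 cA cB.
have s0 (u : nat -> R) : (forall n, 0 <= u n) -> forall n, 0 <= series u n :> R.
  by move=> u0 n; apply: sumr_ge0.
have nd (u : nat -> R) : (forall n, 0 <= u n) -> nondecreasing_seq (series u : R^nat).
  move=> u0; apply/nondecreasing_seqP => n.
  by rewrite /series/= big_nat_recr//= lerDl.
have nds (u : nat -> R) : (forall n, 0 <= u n) -> forall m n, (m <= n)%N ->
    \sum_(0 <= j < m) u j <= \sum_(0 <= j < n) u j.
  by move=> u0 m n mn; exact: (nd u u0).
have cAB : (fun n => series a n * series b n) @ \oo --> A * B by exact: cvgM.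
have c0 n : 0 <= convolve a b n by apply: sumr_ge0 => i _; rewrite mulr_ge0.
have up N : series (convolve a b) N <= series a N * series b N.
  rewrite series_convolve /series/= mulr_suml; apply: ler_sum => i _.
  by rewrite ler_wpM2l// nds// leq_subr.
have lo N : series a N * series b N <= series (convolve a b) (N + N).
  rewrite series_convolve /series/= mulr_suml /tri.
  rewrite [X in _ <= X](big_cat_nat (n := N))//= ?leq_addr//.
  rewrite -[X in X <= _]addr0 lerD//.
    rewrite big_nat [X in _ <= X]big_nat; apply: ler_sum => i /andP[_ iN].
    rewrite ler_wpM2l// nds// -addnBA ?leq_addr//; exact: ltnW.
  by apply: sumr_ge0 => i _; rewrite mulr_ge0// sumr_ge0.
have AB N : series a N * series b N <= A * B.
  apply: ler_pM; rewrite ?s0//.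
    by rewrite -(cvg_lim (@Rhausdorff R) cA); apply: nondecreasing_cvgn_le; [exact: nd|exact: cvgP cA].
  by rewrite -(cvg_lim (@Rhausdorff R) cB); apply: nondecreasing_cvgn_le; [exact: nd|exact: cvgP cB].
have cc : cvgn (series (convolve a b)).
  apply: nondecreasing_is_cvgn; first exact: nd.
  by exists (A * B) => _ [n _ <-]; exact: le_trans (up n) (AB n).
suff -> : A * B = limn (series (convolve a b)) by [].
apply/eqP; rewrite eq_le; apply/andP; split.
- rewrite -(cvg_lim (@Rhausdorff R) cAB); apply: limr_le; first exact: cvgP cAB.
  apply: nearW => n; apply: le_trans (lo n) _.
  by apply: nondecreasing_cvgn_le => //; exact: nd.
- apply: limr_le => //; apply: nearW => n; exact: le_trans (up n) (AB n).
Qed.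

(** The square and the triangular partial sums differ by at most the
    corresponding difference for the absolute values, which tends to 0. *)
Lemma series_convolve_cvg a b (A B : R) :
  cvgn (series (fun n => `|a n|)) -> cvgn (series (fun n => `|b n|)) ->
  series a @ \oo --> A -> series b @ \oo --> B ->
  cvgn (series (fun n => `|convolve a b n|)) /\
  series (convolve a b) @ \oo --> A * B.
Proof.
move=> ca cb cA cB.
have h := nnseries_convolve (fun n => normr_ge0 (a n)) (fun n => normr_ge0 (b n)) ca cb.
split.
  apply: (@series_le_cvg _ _ (convolve (fun n => `|a n|) (fun n => `|b n|))) => //.
  - by move=> n; apply: sumr_ge0 => i _; rewrite mulr_ge0.
  - move=> n; apply: le_trans (ler_norm_sum _ _ _) _.
    by apply: ler_sum => i _; rewrite normrM.
  - exact: cvgP h.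
pose d N := series (fun n => `|a n|) N * series (fun n => `|b n|) N
            - series (convolve (fun n => `|a n|) (fun n => `|b n|)) N.
have d0 : d @ \oo --> (0 : R).
  rewrite -(subrr (limn (series (fun n => `|a n|)) * limn (series (fun n => `|b n|)))).
  by apply: cvgB => //; exact: cvgM.
have dif u v N : series u N * series v N - tri u v N =
    \sum_(0 <= i < N) u i * \sum_(N - i <= j < N) v j :> R.
  rewrite /series/= mulr_suml /tri -sumrB; apply: eq_bigr => i _.
  rewrite -mulrBr; congr (_ * _).
  by rewrite (big_cat_nat (n := N - i)%N)//= ?leq_subr// addrAC subrr add0r.
have le_d N : `|series a N * series b N - series (convolve a b) N| <= d N.
  rewrite /d !series_convolve !dif; apply: le_trans (ler_norm_sum _ _ _) _.
  apply: ler_sum => i _; rewrite normrM ler_wpM2l//; exact: ler_norm_sum.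
have e0 : (fun N => series a N * series b N - series (convolve a b) N) @ \oo --> (0 : R).
  apply/norm_cvg0P; apply: (@squeeze_cvgr _ _ _ _ (cst 0) d) => //; last exact: cvg_cst.
  by near=> N; rewrite normr_ge0/= le_d.
rewrite (_ : series _ = (fun N => series a N * series b N -
    (series a N * series b N - series (convolve a b) N))); last first.
  by apply/funext => N; rewrite opprB addrC subrK.
by rewrite -[A * B]subr0; apply: cvgB => //; exact: cvgM.
Unshelve. all: by end_near. Qed.

End cauchy_product.

Section complex_sums.
Context {R : realType}.
Local Open Scope complex_scope.
Local Notation Re := complex.Re.
Local Notation Im := complex.Im.
Implicit Types (a b : nat -> R[i]) (s t z w : R[i]).

Lemma ReM z w : Re (z * w) = Re z * Re w - Im z * Im w.
Proof. by case: z => ? ?; case: w. Qed.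

Lemma ImM z w : Im (z * w) = Re z * Im w + Im z * Re w.
Proof. by case: z => ? ?; case: w. Qed.

Lemma Re_sum I (r : seq I) (F : I -> R[i]) : Re (\sum_(i <- r) F i) = \sum_(i <- r) Re (F i).
Proof. by apply: (@big_morph _ _ (@complex.Re R) 0 +%R 0 +%R) => // -[x y] [x' y']. Qed.

Lemma Im_sum I (r : seq I) (F : I -> R[i]) : Im (\sum_(i <- r) F i) = \sum_(i <- r) Im (F i).
Proof. by apply: (@big_morph _ _ (@complex.Im R) 0 +%R 0 +%R) => // -[x y] [x' y']. Qed.

(** Absolute convergence of the series a to the complex number s, stated by
    coordinates so that the theory of real series applies. *)
Definition has_csum a s :=
  [/\ cvgn (series (fun n => `|Re (a n)|)), cvgn (series (fun n => `|Im (a n)|)),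
      series (fun n => Re (a n)) @ \oo --> Re s &
      series (fun n => Im (a n)) @ \oo --> Im s].

Lemma has_csum_convolve a b s t : has_csum a s -> has_csum b t ->
  has_csum (convolve a b) (s * t).
Proof.
move=> [ra ia ras ias] [rb ib rbs ibs].
have [n1 c1] := series_convolve_cvg ra rb ras rbs.
have [n2 c2] := series_convolve_cvg ia ib ias ibs.
have [n3 c3] := series_convolve_cvg ra ib ras ibs.
have [n4 c4] := series_convolve_cvg ia rb ias rbs.
have rE n : Re (convolve a b n) = convolve (fun n => Re (a n)) (fun n => Re (b n)) n - convolve (fun n => Im (a n)) (fun n => Im (b n)) n.
  by rewrite /convolve Re_sum -sumrB; apply: eq_bigr => i _; rewrite ReM.
have iE n : Im (convolve a b n) = convolve (fun n => Re (a n)) (fun n => Im (b n)) n + convolve (fun n => Im (a n)) (fun n => Re (b n)) n.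
  by rewrite /convolve Im_sum -big_split; apply: eq_bigr => i _; rewrite ImM.
have nc (u v w' : nat -> R) : cvgn (series (fun n => `|u n|)) -> cvgn (series (fun n => `|v n|)) ->
    (forall n, `|w' n| <= `|u n| + `|v n|) -> cvgn (series (fun n => `|w' n|)).
  move=> cu cv le.
  apply: (@series_le_cvg _ _ (fun n => `|u n| + `|v n|)) => //.
  rewrite (_ : series _ = series (fun n => `|u n|) + series (fun n => `|v n|)).
    exact: is_cvgD.
  by apply/funext => n; rewrite !fctE /series/= big_split.
split.
- by apply: nc n1 n2 _ => n; rewrite rE; exact: ler_normB.
- by apply: nc n3 n4 _ => n; rewrite iE; exact: ler_normD.
- rewrite ReM (_ : series _ = series (convolve (fun n => Re (a n)) (fun n => Re (b n))) - series (convolve (fun n => Im (a n)) (fun n => Im (b n)))).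
    exact: cvgB.
  by apply/funext => n; rewrite !fctE /series/= -sumrB; apply: eq_bigr => i _; rewrite rE.
- rewrite ImM (_ : series _ = series (convolve (fun n => Re (a n)) (fun n => Im (b n))) + series (convolve (fun n => Im (a n)) (fun n => Re (b n)))).
    exact: cvgD.
  by apply/funext => n; rewrite !fctE /series/= -big_split; apply: eq_bigr => i _; rewrite iE.
Qed.

Lemma eq_has_csum a b s : a =1 b -> has_csum a s -> has_csum b s.
Proof. by move=> /funext ->. Qed.

Lemma has_csum_delta0 a : (forall n, (0 < n)%N -> a n = 0) -> has_csum a (a 0%N).
Proof.
move=> a0.
have key (u : nat -> R) : (forall n, (0 < n)%N -> u n = 0) -> series u @ \oo --> u 0%N.
  move=> u0; apply: cvg_near_cst; near=> n.
  have n0 : (0 < n)%N by near: n; exact: nbhs_infty_gt.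
  rewrite /series/= big_ltn// big_nat big1 ?addr0// => i /andP[i1 _].
  exact: u0.
split.
- by apply: cvgP; apply: key => n /a0 ->; rewrite normr0.
- by apply: cvgP; apply: key => n /a0 ->; rewrite normr0.
- by apply: key => n /a0 ->.
- by apply: key => n /a0 ->.
Unshelve. all: by end_near. Qed.

(** The generating function of a sum of k independent variables is the k-th
    power of the common one. *)
Lemma has_csum_convolution_power (p : nat -> R) z h :
  has_csum (fun n => (p n)%:C * z ^+ n) h ->
  forall k, has_csum (fun n => (convolution_power p k n)%:C * z ^+ n) (h ^+ k).
Proof.
move=> ph; elim=> [|k IH].
  rewrite expr0 -[1](_ : ((convolution_power p 0 0)%:C * z ^+ 0) = _)//=.
    by apply: has_csum_delta0 => n n0 /=; rewrite gtn_eqF// mul0r.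
  by rewrite expr0 mulr1.
rewrite exprS; apply: eq_has_csum (has_csum_convolve ph IH) => n.
rewrite /convolve /= rmorph_sum mulr_suml; apply: eq_bigr => i _.
by rewrite rmorphM/= mulrACA -exprD subnKC// -ltnS.
Qed.

Let expt w n : R[i] := w ^+ n * ((n`!%:R)^-1)%:C.

Let real_complexX (x : R) n : x%:C ^+ n = (x ^+ n)%:C :> R[i].
Proof. by rewrite rmorphXn. Qed.

Let has_csum_exp_real (u : R) : has_csum (expt u%:C) (expR u)%:C.
Proof.
have e n : expt u%:C n = (exp_coeff u n)%:C.
  by rewrite /expt real_complexX -rmorphM.
split.
- rewrite (_ : series _ = series (exp_coeff `|u|)); first exact: is_cvg_series_exp_coeff.
  by apply/funext => n; rewrite /series/=; apply: eq_bigr => i _; rewrite e/= /exp_coeff/= normrM normrX [X in _ * X]ger0_norm.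
- apply: cvgP; rewrite (_ : series _ = cst 0); first exact: cvg_cst.
  by apply/funext => n; rewrite /series/= big1// => i _; rewrite e/= normr0.
- rewrite (_ : series _ = series (exp_coeff u)) /=; first exact: is_cvg_series_exp_coeff.
  by apply/funext => n; rewrite /series/=; apply: eq_bigr => i _; rewrite e.
- rewrite (_ : series _ = cst 0) /=; first exact: cvg_cst.
  by apply/funext => n; rewrite /series/= big1// => i _; rewrite e.
Qed.

Let expr_imag (v : R) n : (Complex 0 v) ^+ n =
  Complex ((~~ odd n)%:R * (-1) ^+ n./2 * v ^+ n) ((odd n)%:R * (-1) ^+ n.-1./2 * v ^+ n).
Proof.
elim: n => [|n IH]; first by rewrite !expr0 /= !mul1r !mul0r.
rewrite exprS IH; apply/eqP; rewrite eq_complex ReM ImM /=.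
apply/andP; split; apply/eqP; last by rewrite mul0r add0r exprS; ring.
rewrite mul0r sub0r exprS negbK; case: (boolP (odd n)) => on; last by rewrite !mul0r mulr0 oppr0.
have -> : (uphalf n = n.-1./2.+1)%N by case: n on {IH}.
by rewrite exprS; ring.
Qed.

Let has_csum_exp_imag (v : R) : has_csum (expt (Complex 0 v)) (Complex (cos v) (sin v)).
Proof.
have er n : Re (expt (Complex 0 v) n) = cos_coeff v n.
  by rewrite /expt expr_imag ReM /= mulr0 subr0.
have ei n : Im (expt (Complex 0 v) n) = sin_coeff v n.
  by rewrite /expt expr_imag ImM /= mulr0 add0r.
have le1 (c : bool) m : `|c%:R * (-1) ^+ m| <= 1 :> R.
  by rewrite normrM normrX normrN1 expr1n mulr1; case: c; rewrite ?normr1 ?normr0.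
have dom (c : nat -> bool) (m : nat -> nat) :
    cvgn (series (fun n => `|(c n)%:R * (-1) ^+ m n * v ^+ n / n`!%:R|)).
  apply: (@series_le_cvg _ _ (exp_coeff `|v|)) => //.
  - by move=> n; exact: exp_coeff_ge0.
  - move=> n; rewrite /exp_coeff/= -mulrA normrM.
    have -> : `|v ^+ n / n`!%:R| = `|v| ^+ n / n`!%:R by rewrite normrM normrX [X in _ * X]ger0_norm.
    by rewrite ler_piMl// divr_ge0// exprn_ge0.
  - exact: is_cvg_series_exp_coeff.
split.
- by under [X in series X]eq_fun do rewrite er; exact: dom.
- by under [X in series X]eq_fun do rewrite ei; exact: dom.
- under [X in series X]eq_fun do rewrite er; rewrite /= cos.unlock.
  exact: is_cvg_series_cos_coeff.
- under [X in series X]eq_fun do rewrite ei; rewrite /= sin.unlock.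
  exact: is_cvg_series_sin_coeff.
Qed.

(** The exponential is given by its coordinates; its power series is the
    Cauchy product of those of expR u and of cos v + i sin v. *)
Lemma has_csum_cexp w : has_csum (fun n => w ^+ n * ((n`!%:R)^-1)%:C) (cexp w).
Proof.
case: w => u v.
have -> : cexp (Complex u v) = (expR u)%:C * Complex (cos v) (sin v).
  by apply/eqP; rewrite eq_complex ReM ImM /= !mul0r subr0 addr0 !eqxx.
apply: eq_has_csum (has_csum_convolve (has_csum_exp_real u) (has_csum_exp_imag v)) => n.
have -> : Complex u v = Complex 0 v + u%:C.
  by apply/eqP; rewrite eq_complex /= add0r addr0 !eqxx.
rewrite exprDn mulr_suml /convolve; apply: eq_bigr => i _.
have iN : (i <= n)%N by rewrite -ltnS.
rewrite /expt mulrnAl -mulrnAr [u%:C ^+ i * _ * _]mulrACA [u%:C ^+ i * _]mulrC -!mulrA.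
congr (_ * (_ * _)); rewrite -rmorphM -rmorphMn; congr (_%:C).
rewrite -mulr_natr -(bin_fact iN) !natrM; field.
by rewrite !pnatr_eq0 -!lt0n bin_gt0 iN !fact_gt0.
Qed.

End complex_sums.

Section complex_limits.
Import ComplexField.Normc.
Context {R : realType}.
Local Open Scope complex_scope.
Local Notation Re := complex.Re.
Local Notation Im := complex.Im.
Implicit Types (u : nat -> R[i]^o) (z : R[i]).

Lemma norm_normcE z : `|z| = (normc z)%:C.
Proof. by rewrite normc_def; case: z. Qed.

Lemma normc_ltE z (r : R) : (`|z| < r%:C) = (normc z < r).
Proof. by rewrite norm_normcE ltcR. Qed.

Lemma normc_ge0 z : 0 <= normc z.
Proof. by case: z => a b; exact: sqrtr_ge0. Qed.

Lemma normcX z n : normc (z ^+ n) = normc z ^+ n.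
Proof. by elim: n => [|n IH]; rewrite ?expr0 ?normc1// !exprS normcM IH. Qed.

Lemma normc_real (x : R) : normc x%:C = `|x|.
Proof. by rewrite /normc /= expr0n addr0 sqrtr_sqr. Qed.

Lemma Re_le_normc z : `|Re z| <= normc z.
Proof.
case: z => a b /=; rewrite -sqrtr_sqr ler_wsqrtr// lerDl; exact: sqr_ge0.
Qed.

Lemma Im_le_normc z : `|Im z| <= normc z.
Proof.
case: z => a b /=; rewrite -sqrtr_sqr ler_wsqrtr// lerDr; exact: sqr_ge0.
Qed.

Lemma normc_le_ReIm z : normc z <= `|Re z| + `|Im z|.
Proof.
case: z => a b /=; rewrite -[leRHS]ger0_norm ?addr_ge0// -sqrtr_sqr ler_wsqrtr//.
by rewrite sqrrD !real_normK ?num_real// addrAC lerDl mulrn_wge0// mulr_ge0.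
Qed.

Lemma ReB (x y : R[i]) : Re (x - y) = Re x - Re y.
Proof. by case: x; case: y. Qed.

Lemma ImB (x y : R[i]) : Im (x - y) = Im x - Im y.
Proof. by case: x; case: y. Qed.

Lemma cvg_complex u z : (fun n => Re (u n)) @ \oo --> Re z ->
  (fun n => Im (u n)) @ \oo --> Im z -> u @ \oo --> (z : R[i]^o).
Proof.
move=> cr ci; apply/cvgrPdist_lt => e e0.
have [e' e'0 eE] : exists2 e' : R, 0 < e' & e = e'%:C.
  case: e e0 => a b; rewrite ltcE /= => /andP[/eqP -> a0]; by exists a.
rewrite eE; have e20 : 0 < e' / 2 by rewrite divr_gt0.
move/cvgrPdist_lt: cr => /(_ _ e20) hr; move/cvgrPdist_lt: ci => /(_ _ e20) hi.
near=> n.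
have h1 : `|Re z - Re (u n)| < e' / 2 by near: n.
have h2 : `|Im z - Im (u n)| < e' / 2 by near: n.
rewrite normc_ltE; apply: le_lt_trans (normc_le_ReIm _) _.
by rewrite [ltRHS]splitr; rewrite ReB ImB; exact: ltrD.
Unshelve. all: by end_near. Qed.

Lemma cvg_Re u z : u @ \oo --> (z : R[i]^o) -> (fun n => Re (u n)) @ \oo --> Re z.
Proof.
move=> /cvgrPdist_lt cu; apply/cvgrPdist_lt => e e0.
have e0' : 0 < e%:C by rewrite ltcR.
near=> n; have : `|z - u n| < e%:C by near: n; exact: cu.
rewrite normc_ltE; apply: le_lt_trans; apply: le_trans (Re_le_normc _).
by rewrite ReB.
Unshelve. all: by end_near. Qed.

End complex_limits.

(** * Exchanging series and integrals *)

Section mixture.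
Context d (T : measurableType d) (R : realType).
Variables (mu : {measure set T -> \bar R}) (D : set T).
Hypothesis mD : measurable D.
Variables (c : nat -> T -> R) (a : nat -> R).
Hypotheses (mc : forall n, measurable_fun D (c n))
  (c0 : forall n x, D x -> 0 <= c n x)
  (ca : forall n, (\int[mu]_(x in D) (c n x)%:E = (a n)%:E)%E).
Variables (f g : nat -> R) (S S' : T -> R).
Hypotheses (fg : forall n, `|f n| <= g n)
  (cS : forall x, D x -> series (fun n => c n x * f n) @ \oo --> S x)
  (cS' : forall x, D x -> series (fun n => c n x * g n) @ \oo --> S' x)
  (iS' : (\int[mu]_(x in D) (S' x)%:E < +oo)%E).

Let g0 n : 0 <= g n. Proof. exact: le_trans (fg n). Qed.

Let m_series (h : nat -> R) n : measurable_fun D (fun x => series (fun k => c k x * h k) n).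
Proof. by apply: measurable_sum => k; apply: measurable_funM. Qed.

Let mS : measurable_fun D S.
Proof. exact: (measurable_fun_cvg (m_series f) cS). Qed.

Let mS' : measurable_fun D S'.
Proof. exact: (measurable_fun_cvg (m_series g) cS'). Qed.

Let le_series_S' n x : D x -> series (fun k => c k x * g k) n <= S' x.
Proof.
move=> Dx; rewrite -(cvg_lim (@Rhausdorff R) (cS' Dx)).
apply: nondecreasing_cvgn_le; last exact: cvgP (cS' Dx).
by apply/nondecreasing_seqP => k; rewrite seriesSr lerDl mulr_ge0// c0.
Qed.

Let S'0 x : D x -> 0 <= S' x.
Proof. by move=> Dx; apply: le_trans (le_series_S' 0 Dx); rewrite /series/= big_geq. Qed.

Let integrable_S' : mu.-integrable D (EFin \o S').
Proof.
apply/integrableP; split; first exact/measurable_EFinP.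
rewrite (eq_integral (EFin \o S'))// => x /[!inE] Dx.
by rewrite gee0_abs//= lee_fin S'0.
Qed.

Let series_le_S' n x : D x -> `|series (fun k => c k x * f k) n| <= S' x.
Proof.
move=> Dx; apply: le_trans (le_series_S' n Dx).
apply: le_trans (ler_norm_sum _ _ _) _; apply: ler_sum => k _.
by rewrite normrM ger0_norm ?c0// ler_wpM2l// c0.
Qed.

Lemma mixture_le x : D x -> `|S x| <= S' x.
Proof.
move=> Dx; have h := cvg_norm (cS Dx) _; rewrite -(cvg_lim (@Rhausdorff R) (h _)).
apply: limr_le; first exact: cvgP (h _).
by apply: nearW => n; exact: series_le_S'.
Qed.

Lemma mixture_integrable : mu.-integrable D (EFin \o S).
Proof.
apply: (le_integrable mD _ _ integrable_S'); first exact/measurable_EFinP.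
move=> x Dx; rewrite /= lee_fin [leRHS]ger0_norm ?S'0//.
exact: mixture_le.
Qed.

Let integrable_c k : mu.-integrable D (EFin \o c k).
Proof.
apply/integrableP; split; first exact/measurable_EFinP.
rewrite (eq_integral (EFin \o c k)); first by rewrite ca ltry.
by move=> x /[!inE] Dx; rewrite gee0_abs//= lee_fin c0.
Qed.

Let integral_series n : (\int[mu]_(x in D) (series (fun k => c k x * f k) n)%:E =
  (series (fun k => a k * f k) n)%:E)%E.
Proof.
elim: n => [|n IH].
  rewrite /series/= big_geq//; under eq_integral do rewrite big_geq//.
  exact: integral0.
have is_ h m : mu.-integrable D (fun x => (series (fun k => c k x * h k) m)%:E).
  elim: m => [|m IHm].
    rewrite (_ : (fun x => _) = cst 0%E); first exact: integrable0.
    by apply/funext => x; rewrite /series/= big_geq.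
  rewrite (_ : (fun x => _) = (fun x => (series (fun k => c k x * h k) m)%:E + (h m)%:E * (c m x)%:E)%E).
    by apply: integrableD => //; apply: integrableZl => //; exact: integrable_c.
  by apply/funext => x; rewrite seriesSr EFinD mulrC.
under eq_integral do rewrite seriesSr EFinD mulrC.
rewrite integralD//; last by apply: (integrableZl mD (f n) (integrable_c n)).
rewrite IH seriesSr EFinD; congr (_ + _)%E.
rewrite (eq_integral (fun x => (f n)%:E * (c n x)%:E)%E)// integralZl//.
  by rewrite ca -EFinM mulrC.
exact: integrable_c.
Qed.

(** Exchange of sum and integral for a series S with terms of any sign: the
    nonnegative series S', whose integral is finite, dominates the partial
    sums of S. *)
Lemma mixture_cvg_series :
  series (fun n => a n * f n) @ \oo --> \int[mu]_(x in D) S x.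
Proof.
have h : (\int[mu]_(x in D) (series (fun k => c k x * f k) n)%:E @[n --> \oo] -->
    \int[mu]_(x in D) (S x)%:E)%E.
  apply: (dominated_cvg mD _ _ _ integrable_S') => //.
  - by move=> n; apply/measurable_EFinP; exact: m_series.
  - by move=> x Dx; apply: cvg_EFin; [exact: nearW|exact: cS].
have {}h : ((series (fun n => a n * f n) n)%:E @[n --> \oo] --> (\int[mu]_(x in D) S x)%:E)%E.
  rewrite /Rintegral fineK; last exact: (integrable_fin_num mD mixture_integrable).
  by move: h; under eq_fun do rewrite integral_series.
exact: (fine_cvg h).
Qed.

End mixture.

Section nat_series.
Context {R : realType}.
Variable nu : {measure set nat -> \bar R}.
Hypothesis nufin : forall k, (nu [set k] < +oo)%E.
Local Notation a := (fun k => fine (nu [set k])).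

Lemma nat_massE k : nu [set k] = (fine (nu [set k]))%:E.
Proof. by rewrite fineK// ge0_fin_numE. Qed.

Let partialE (g : nat -> R) n :
  (\sum_(0 <= k < n) nu [set k] * (g k)%:E = (series (fun k => a k * g k) n)%:E)%E.
Proof.
by rewrite /series/= -sumEFin; apply: eq_bigr => k _; rewrite nat_massE.
Qed.

Lemma integral_nat_series (g : nat -> R) (l : R) : (forall k, 0 <= g k) ->
  series (fun k => a k * g k) @ \oo --> l -> (\int[nu]_k (g k)%:E = l%:E)%E.
Proof.
move=> g0 gl; rewrite ge0_integral_nat//.
apply/cvg_lim => //; under eq_fun do rewrite partialE.
by apply: cvg_EFin => //; exact: nearW.
Qed.

Lemma cvg_integral_nat (g : nat -> R) : (forall k, 0 <= g k) ->
  (\int[nu]_k (g k)%:E < +oo)%E ->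
  series (fun k => a k * g k) @ \oo --> fine (\int[nu]_k (g k)%:E)%E.
Proof.
move=> g0 goo.
suff h : ((series (fun k => a k * g k) n)%:E @[n --> \oo] -->
    (fine (\int[nu]_k (g k)%:E))%:E)%E by exact: (fine_cvg h).
rewrite fineK; last by rewrite ge0_fin_numE// integral_ge0// => k _; rewrite lee_fin.
rewrite ge0_integral_nat//.
have : (fun n => (\sum_(0 <= k < n) nu [set k] * (g k)%:E)%E) @ \oo -->
    (\sum_(0 <= k <oo) nu [set k] * (g k)%:E)%E.
  by apply: is_cvg_nneseries => n _ _; rewrite mule_ge0 ?lee_fin.
by under eq_fun do rewrite partialE.
Qed.

End nat_series.

(** * Generating functions *)

Section genfun_theory.
Context {R : realType}.
Local Open Scope complex_scope.
Import ComplexField.Normc.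
Local Notation Re := complex.Re.
Local Notation Im := complex.Im.
Implicit Types (nu : {measure set nat -> \bar R}) (z h : R[i]).

Lemma ReMl (x : R) z : Re (x%:C * z) = x * Re z.
Proof. by rewrite ReM/= mul0r subr0. Qed.

Lemma ImMl (x : R) z : Im (x%:C * z) = x * Im z.
Proof. by rewrite ImM/= mul0r addr0. Qed.

Lemma genfunP nu z h :
  series (fun n => fine (nu [set n]) * Re (z ^+ n)) @ \oo --> Re h ->
  series (fun n => fine (nu [set n]) * Im (z ^+ n)) @ \oo --> Im h ->
  cvg (genfun_series nu z @ \oo) /\ genfun nu z = h.
Proof.
move=> cr ci; have c : genfun_series nu z @ \oo --> (h : R[i]^o).
  apply: cvg_complex.
    apply: cvg_trans cr; apply: near_eq_cvg; apply: nearW => n.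
    by rewrite /genfun_series /series/= Re_sum; apply: eq_bigr => k _; rewrite ReMl.
  apply: cvg_trans ci; apply: near_eq_cvg; apply: nearW => n.
  by rewrite /genfun_series /series/= Im_sum; apply: eq_bigr => k _; rewrite ImMl.
by split; [exact: cvgP c|exact: (cvg_lim (@norm_hausdorff _ R[i]^o) c)].
Qed.

Lemma cvg_genfun_real nu (s : R) : cvg (genfun_series nu s%:C @ \oo) ->
  series (fun n => fine (nu [set n]) * s ^+ n) @ \oo --> Re (genfun nu s%:C).
Proof.
move=> /cvg_Re; apply: cvg_trans; apply: near_eq_cvg; apply: nearW => n.
rewrite /genfun_series /series/= Re_sum; apply: eq_bigr => k _.
by rewrite ReMl -rmorphXn.
Qed.

Lemma has_csum_power (p : nat -> R) (r : R) z : (forall n, 0 <= p n) ->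
  cvgn (series (fun n => p n * r ^+ n)) -> normc z <= r ->
  exists h, has_csum (fun n => (p n)%:C * z ^+ n) h.
Proof.
move=> p0 cp zr.
have r0 : 0 <= r by exact: le_trans (normc_ge0 z) zr.
have le n : normc ((p n)%:C * z ^+ n) <= p n * r ^+ n.
  rewrite normcM normc_real ger0_norm// ler_wpM2l// normcX.
  by rewrite lerXn2r ?nnegrE// normc_ge0.
have cr : cvgn (series (fun n => `|Re ((p n)%:C * z ^+ n)|)).
  apply: series_le_cvg cp => // n; first by rewrite mulr_ge0// exprn_ge0.
  exact: le_trans (Re_le_normc _) (le n).
have ci : cvgn (series (fun n => `|Im ((p n)%:C * z ^+ n)|)).
  apply: series_le_cvg cp => // n; first by rewrite mulr_ge0// exprn_ge0.
  exact: le_trans (Im_le_normc _) (le n).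
exists (Complex (limn (series (fun n => Re ((p n)%:C * z ^+ n))))
                (limn (series (fun n => Im ((p n)%:C * z ^+ n))))).
by split => //; exact: normed_cvg.
Qed.

Lemma has_csum_genfun nu (r : R) z :
  cvgn (series (fun n => fine (nu [set n]) * r ^+ n)) -> normc z <= r ->
  has_csum (fun n => (fine (nu [set n]))%:C * z ^+ n) (genfun nu z).
Proof.
move=> cr zr.
have [|h [r1 i1 r2 i2]] := has_csum_power _ cr zr; first by move=> n; exact: fine_ge0.
have [|| _ ->] := @genfunP nu z h; last by split.
- by under [X in series X]eq_fun do rewrite -ReMl.
- by under [X in series X]eq_fun do rewrite -ImMl.
Qed.

Lemma cexpD z w : cexp (z + w) = cexp z * cexp w.
Proof.
case: z => a b; case: w => a' b'.
apply/eqP; rewrite eq_complex ReM ImM /= expRD cosD sinD.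
by apply/andP; split; apply/eqP; ring.
Qed.

Lemma cexp_real (x : R) : cexp x%:C = (expR x)%:C.
Proof. by rewrite /cexp /= cos0 sin0 mulr1 mulr0. Qed.

End genfun_theory.

(** * Compound Poisson laws *)

Section compound_poisson.
Context {R : realType}.
Local Open Scope complex_scope.
Import ComplexField.Normc.
Local Notation Re := complex.Re.
Local Notation Im := complex.Im.
Variable p : nat -> R.
Hypotheses (p_ge0 : forall n, 0 <= p n) (p_sum : series p @ \oo --> (1 : R)).

Lemma convolution_power_ge0 k n : 0 <= convolution_power p k n.
Proof.
by elim: k n => [|k IH] n //=; apply: sumr_ge0 => i _; rewrite mulr_ge0.
Qed.

Lemma convolution_power_sum k : series (convolution_power p k) @ \oo --> (1 : R).
Proof.
have h : has_csum (fun n => (p n)%:C * 1 ^+ n) (1 : R[i]).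
  split.
  - under [X in series X]eq_fun do rewrite expr1n mulr1 /= ger0_norm//.
    exact: cvgP p_sum.
  - apply: cvgP; rewrite (_ : series _ = cst 0); first exact: cvg_cst.
    by apply/funext => n; rewrite /series/= big1// => i _; rewrite expr1n mulr1 /= normr0.
  - by under [X in series X]eq_fun do rewrite expr1n mulr1 /=.
  - rewrite (_ : series _ = cst 0); first exact: cvg_cst.
    by apply/funext => n; rewrite /series/= big1// => i _; rewrite expr1n mulr1 /=.
have [_ _ + _] := has_csum_convolution_power h k.
by rewrite expr1n; under [X in series X]eq_fun do rewrite expr1n mulr1 /=.
Qed.

Hypothesis p0 : p 0%N = 0.

(** A sum of k positive variables is at least k, which is what makes the sum
    over k in compound_poisson finite. *)
Lemma convolution_power_gt k n : (n < k)%N -> convolution_power p k n = 0.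
Proof.
elim: k n => // k IH n nk /=; apply: big1 => i _.
have [i0|i0] := posnP i; first by rewrite i0 p0 mul0r.
rewrite IH ?mulr0//; have := ltn_ord i; rewrite ltnS => ilen.
by rewrite ltn_subLR// (leq_trans nk)// -add1n leq_add2r.
Qed.

(** Law of the sum of a Poisson number (with parameter x) of independent
    variables with mass function p; these being positive, at most n of them
    can add up to n. *)
Definition compound_poisson (n : nat) (x : R) : R :=
  expR (- x) * \sum_(k < n.+1) x ^+ k / k`!%:R * convolution_power p k n.

Lemma compound_poisson_ge0 n x : 0 <= x -> 0 <= compound_poisson n x.
Proof.
move=> x0; rewrite mulr_ge0// ?expR_ge0// sumr_ge0// => k _.
by rewrite mulr_ge0// ?convolution_power_ge0// divr_ge0// exprn_ge0.
Qed.

Lemma measurable_compound_poisson n : measurable_fun setT (compound_poisson n).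
Proof.
apply: measurable_funM; first by apply: measurableT_comp => //; exact: measurable_expR.
apply: measurable_sum => k; apply: measurable_funM => //; exact: measurable_funM.
Qed.

Section at_point.
Variable x : R.
Hypothesis x0 : 0 <= x.
Let pi_ k : R := expR (- x) * exp_coeff x k.

Let pi_ge0 k : 0 <= pi_ k.
Proof. by rewrite mulr_ge0 ?expR_ge0 ?exp_coeff_ge0. Qed.

Let pi_sum : series pi_ @ \oo --> (1 : R).
Proof.
rewrite -[1](_ : expR (- x) * expR x = _); last by rewrite -expRD addrC subrr expR0.
rewrite (_ : series pi_ = (fun n => expR (- x) * series (exp_coeff x) n)).
  by apply: cvgMr; exact: is_cvg_series_exp_coeff.
by apply/funext => n; rewrite /series/= mulr_sumr.
Qed.

(** The compound law is the mixture of the laws convolution_power p k under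
    the Poisson distribution of k. The exchange lemma for mixtures serves
    twice: to integrate over k, and to write that integral as a series. *)
Lemma compound_poisson_series (f : nat -> R) (S : nat -> R) (l : R) :
  (forall n, `|f n| <= 1) ->
  (forall k, series (fun n => convolution_power p k n * f n) @ \oo --> S k) ->
  series (fun k => pi_ k * S k) @ \oo --> l ->
  series (fun n => compound_poisson n x * f n) @ \oo --> l.
Proof.
move=> f1 fS Sl.
have [mu muE] := nat_measure_exists pi_ge0.
have mufin k : (mu [set k] < +oo)%E by rewrite muE ltry.
have amu : (fun k => fine (mu [set k])) = pi_ by apply/funext => k; rewrite muE.
have mu1 : (\int[mu]_k (1 : R)%:E = 1)%E.
  rewrite (@integral_nat_series _ mu mufin (fun=> 1) 1)//.
  by under [X in series X]eq_fun do rewrite mulr1 muE.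
have c1 k : series (fun n => convolution_power p k n * 1) @ \oo --> (1 : R).
  by under [X in series X]eq_fun do rewrite mulr1; exact: convolution_power_sum.
have mu1' : (\int[mu]_(k in setT) (1 : R)%:E < +oo)%E by rewrite mu1 ltry.
have ca n : (\int[mu]_(k in setT) (convolution_power p k n)%:E = (compound_poisson n x)%:E)%E.
  apply: (integral_nat_series mufin) => [k|]; first exact: convolution_power_ge0.
  apply: cvg_near_cst; near=> N.
  have nN : (n.+1 <= N)%N by near: N; exact: nbhs_infty_ge.
  rewrite /series/= (big_cat_nat (n := n.+1))//= [X in _ + X]big_nat [X in _ + X]big1 ?addr0; last first.
    by move=> i /andP[ni _]; rewrite convolution_power_gt// mulr0.
  rewrite big_mkord /compound_poisson mulr_sumr; apply: eq_bigr => k _.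
  by rewrite muE/= /pi_ /exp_coeff/= !mulrA.
have S1 k : `|S k| <= 1.
  exact: (@mixture_le _ nat R setT (fun n k => convolution_power p k n) (fun n k _ => convolution_power_ge0 k n) f (fun=> 1) S (fun=> 1) f1 (fun k _ => fS k) (fun k _ => c1 k) k).
have h1 : series (fun n => compound_poisson n x * f n) @ \oo --> \int[mu]_(k in setT) S k.
  apply: (@mixture_cvg_series _ nat R mu setT _ (fun n k => convolution_power p k n) _ _ _ ca f (fun=> 1) S (fun=> 1)) => //.
  by move=> n k _; exact: convolution_power_ge0.
have h2 : series (fun n => pi_ n * S n) @ \oo --> \int[mu]_(k in setT) S k.
  apply: (@mixture_cvg_series _ nat R mu setT _ (fun n k => (k == n)%:R) _ _ _ _ S (fun=> 1) S (fun=> 1)) => //.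
  - move=> n; apply: (integral_nat_series mufin) => // .
    apply: cvg_near_cst; near=> N.
    have nN : (n < N)%N by near: N; exact: nbhs_infty_gt.
    rewrite /series/= big_mkord (bigD1 (Ordinal nN))//= eqxx mulr1 muE big1 ?addr0// => i /negP ni.
    case: eqP => [iE|_]; last by rewrite mulr0.
    by exfalso; apply: ni; apply/eqP/val_inj.
  - move=> k _; apply: cvg_near_cst; near=> N.
    have nN : (k < N)%N by near: N; exact: nbhs_infty_gt.
    rewrite /series/= big_mkord (bigD1 (Ordinal nN))//= eqxx mul1r big1 ?addr0// => i /negP ni.
    case: eqP => [iE|_]; last by rewrite mul0r.
    by exfalso; apply: ni; apply/eqP/val_inj.
  - move=> k _; apply: cvg_near_cst; near=> N.
    have nN : (k < N)%N by near: N; exact: nbhs_infty_gt.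
    rewrite /series/= big_mkord (bigD1 (Ordinal nN))//= eqxx mul1r big1 ?addr0// => i /negP ni.
    case: eqP => [iE|_]; last by rewrite mul0r.
    by exfalso; apply: ni; apply/eqP/val_inj.
by rewrite (cvg_unique (@Rhausdorff R) Sl h2).
Unshelve. all: by end_near. Qed.

(** Given k terms the generating function is h ^+ k, and the Poisson average
    of h ^+ k is exp (x h - x). *)
Lemma compound_poisson_genfun (z h : R[i]) : normc z <= 1 ->
  has_csum (fun n => (p n)%:C * z ^+ n) h ->
  series (fun n => compound_poisson n x * Re (z ^+ n)) @ \oo -->
    Re (cexp ((h - 1) * x%:C)) /\
  series (fun n => compound_poisson n x * Im (z ^+ n)) @ \oo -->
    Im (cexp ((h - 1) * x%:C)).
Proof.
move=> z1 ph.
have zn n : normc (z ^+ n) <= 1 by rewrite normcX exprn_ile1 ?normc_ge0.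
have ck := has_csum_convolution_power ph.
have [_ _ er ei] := has_csum_cexp (h * x%:C).
have -> : cexp ((h - 1) * x%:C) = (expR (- x))%:C * cexp (h * x%:C).
  rewrite mulrBl mul1r addrC cexpD; congr (_ * _).
  by rewrite -(rmorphN (real_complex R)) cexp_real.
have pE k : (pi_ k)%:C * h ^+ k = (expR (- x))%:C * ((h * x%:C) ^+ k * (k`!%:R^-1)%:C).
  rewrite /pi_ /exp_coeff/= !rmorphM/= rmorphXn/= exprMn; ring.
split.
- apply: (@compound_poisson_series _ (fun k => Re (h ^+ k))).
  + by move=> n; exact: le_trans (Re_le_normc _) (zn n).
  + by move=> k; have [_ _ + _] := ck k; under [X in series X]eq_fun do rewrite ReMl.
  + rewrite ReMl (_ : series _ = (fun n => expR (- x) * series (fun k => Re ((h * x%:C) ^+ k * (k`!%:R^-1)%:C)) n)).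
      exact: cvgMr.
    by apply/funext => n; rewrite /series/= mulr_sumr; apply: eq_bigr => k _; rewrite -ReMl pE ReMl.
- apply: (@compound_poisson_series _ (fun k => Im (h ^+ k))).
  + by move=> n; exact: le_trans (Im_le_normc _) (zn n).
  + by move=> k; have [_ _ _ +] := ck k; under [X in series X]eq_fun do rewrite ImMl.
  + rewrite ImMl (_ : series _ = (fun n => expR (- x) * series (fun k => Im ((h * x%:C) ^+ k * (k`!%:R^-1)%:C)) n)).
      exact: cvgMr.
    by apply/funext => n; rewrite /series/= mulr_sumr; apply: eq_bigr => k _; rewrite -ImMl pE ImMl.
Qed.

End at_point.

End compound_poisson.

(** * Probability generating functions *)

Section pgf.
Context {R : realType}.
Implicit Type nu : probability nat R.

Definition pgf nu (s : R) : R := \int[nu]_k s ^+ k.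

Lemma nat_bounded_integrable nu (f : nat -> R) (C : R) : (forall k, `|f k| <= C) ->
  nu.-integrable setT (EFin \o f).
Proof.
move=> fC; apply: measurable_bounded_integrable => //.
  exact: (le_lt_trans (probability_le1 nu measurableT) (ltry _)).
by exists C; split; [exact: num_real|move=> M CM x _ /=; exact: le_trans (fC x) (ltW CM)].
Qed.

Lemma expr_itv01 (s : R) k : 0 <= s <= 1 -> 0 <= s ^+ k <= 1.
Proof. by move=> /andP[s0 s1]; rewrite exprn_ge0// exprn_ile1. Qed.

Lemma power_integrable nu (s : R) : 0 <= s <= 1 ->
  nu.-integrable setT (EFin \o (fun k => s ^+ k)).
Proof.
move=> s01; apply: (@nat_bounded_integrable _ _ 1) => k.
by have /andP[a b] := expr_itv01 k s01; rewrite ger0_norm.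
Qed.

Lemma pgfE nu (s : R) : 0 <= s <= 1 -> (\int[nu]_k (s ^+ k)%:E = (pgf nu s)%:E)%E.
Proof.
move=> s01; rewrite /pgf /Rintegral fineK//.
exact: (integrable_fin_num measurableT (power_integrable nu s01)).
Qed.

Lemma pgf1 nu : pgf nu 1 = 1.
Proof.
apply: EFin_inj; rewrite -pgfE ?ler01 ?lexx//; under eq_integral do rewrite expr1n.
by rewrite integral_cst// mul1e; exact: probability_setT.
Qed.

Lemma pgf_le nu (s t : R) : 0 <= s -> s <= t -> t <= 1 -> pgf nu s <= pgf nu t.
Proof.
move=> s0 st t1; rewrite -lee_fin -!pgfE ?s0 ?(le_trans s0 st) ?(le_trans st t1)//.
apply: ge0_le_integral => //.
- by move=> k _; rewrite lee_fin exprn_ge0.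
- by move=> k _; rewrite lee_fin lerXn2r ?nnegrE// (le_trans s0).
Qed.

Lemma pgf_itv01 nu (s : R) : 0 <= s <= 1 -> 0 <= pgf nu s <= 1.
Proof.
move=> /[dup] s01 /andP[s0 s1]; apply/andP; split; last by rewrite -(pgf1 nu) pgf_le.
by rewrite -lee_fin -pgfE// integral_ge0// => k _; rewrite lee_fin exprn_ge0.
Qed.

Lemma pgf0 nu : (pgf nu 0)%:E = nu [set 0%N].
Proof.
rewrite -pgfE ?lexx ?ler01// (eq_integral (fun k => (\1_[set 0%N] k)%:E)).
  by rewrite integral_indic// setIT.
by case=> [|k] _; rewrite expr0n indicE; [rewrite mem_set|rewrite memNset].
Qed.

Lemma integral_onemX nu (s : R) : 0 <= s <= 1 ->
  (\int[nu]_k (1 - s ^+ k)%:E = (1 - pgf nu s)%:E)%E.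
Proof.
move=> s01; under eq_integral do rewrite EFinB.
rewrite (@integralB_EFin _ _ _ nu setT (fun=> 1) (fun k => s ^+ k))//.
- rewrite integral_cst// mul1e pgfE// EFinB; congr (_ - _)%E; exact: probability_setT.
- by apply: (@nat_bounded_integrable _ _ 1) => k; rewrite normr1.
- exact: power_integrable.
Qed.

Lemma pgf_eq1_mass nu (s : R) k : 0 <= s < 1 -> pgf nu s = 1 -> (0 < k)%N ->
  (nu : {measure set nat -> \bar R}) [set k] = 0%E.
Proof.
move=> /andP[s0 s1] e k0; have s01 : 0 <= s <= 1 by rewrite s0 ltW.
have i0 : (\int[nu]_k (1 - s ^+ k)%:E = 0)%E by rewrite integral_onemX// e subrr.
apply/eqP; rewrite eq_le measure_ge0 andbT.
have : (\int[nu]_(j in [set k]) (1 - s ^+ j)%:E <= 0)%E.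
  rewrite -i0; apply: ge0_subset_integral => // j _.
  by rewrite lee_fin subr_ge0; have /andP[] := expr_itv01 j s01.
by rewrite integral_nat_set1 pmule_rle0// lte_fin subr_gt0 exprn_ilt1// -lt0n.
Qed.

Lemma has_csum_pgf nu (s : R) : 0 <= s <= 1 ->
  has_csum (fun n => real_complex R (fine (nu [set n])) * (real_complex R s) ^+ n) (real_complex R (pgf nu s)).
Proof.
move=> s01; have nufin k : (nu [set k] < +oo)%E.
  by apply: le_lt_trans (probability_le1 _ _) _; rewrite // ltry.
have c : series (fun k => fine (nu [set k]) * s ^+ k) @ \oo --> pgf nu s.
  have : (\int[nu]_k (s ^+ k)%:E < +oo)%E by rewrite pgfE// ltry.
  move=> /(cvg_integral_nat nufin); rewrite pgfE//; apply => k.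
  by have /andP[] := expr_itv01 k s01.
have e n : real_complex R (fine (nu [set n])) * (real_complex R s) ^+ n =
    real_complex R (fine (nu [set n]) * s ^+ n).
  by rewrite rmorphM rmorphXn.
split.
- under [X in series X]eq_fun => n.
    rewrite e /= ger0_norm; last first.
      by rewrite mulr_ge0 ?fine_ge0//; have /andP[] := expr_itv01 n s01.
    over.
  exact: cvgP c.
- apply: cvgP; rewrite (_ : series _ = cst 0); first exact: cvg_cst.
  by apply/funext => n; rewrite /series/= big1// => i _; rewrite e/= normr0.
- by under [X in series X]eq_fun do rewrite e.
- rewrite (_ : series _ = cst 0); first exact: cvg_cst.
  by apply/funext => n; rewrite /series/= big1// => i _; rewrite e.
Qed.

Lemma pgf_continuous nu : {within `[0, 1], continuous (pgf nu)}.
Proof.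
(* Clamping the argument to [0, 1] gives a function defined and continuous on
   the whole line. *)
pose cl : R -> R := (fun=> 1) \min ((fun=> 0) \max id).
have cl01 x : 0 <= cl x <= 1.
  by rewrite /cl/= le_min ler01 le_max lexx/= ge_min lexx.
have clc : continuous cl.
  move=> x; apply: (@continuous_min R R (fun=> 1) ((fun=> 0) \max id)).
    exact: cvg_cst.
  by apply: (@continuous_max R R (fun=> 0) id); [exact: cvg_cst|exact: cvg_id].
have cc : {in `](-1), 2[%classic, continuous (fun x => \int[nu]_(k in setT) (cl x ^+ k))}.
  apply: (@continuity_under_integral R _ nat nu (fun x k => cl x ^+ k) setT _ (-1) 2 _ _ (fun=> 1)) => //.
  - by move=> x _; exact: power_integrable.
  - apply: aeW => k _ x _.
    exact: (@continuous_comp R R R cl (fun y => y ^+ k) x (clc x) (@exprn_continuous R k (cl x))).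
  - by apply: (@nat_bounded_integrable _ _ 1) => k; rewrite normr1.
  - move=> x _; apply: aeW => k _; have /andP[a b] := expr_itv01 k (cl01 x).
    by rewrite ger0_norm.
have : {within `[0, 1], continuous (fun x => pgf nu (cl x))}.
  apply: continuous_in_subspaceT => x; rewrite inE/= in_itv/= => /andP[x0 x1].
  apply: cc; rewrite inE/= in_itv/=; lra.
apply: subspace_eq_continuous => x; rewrite inE/= in_itv/= => /andP[x0 x1].
have clx : cl x = x by rewrite /cl/= max_r// min_r.
by rewrite /from_subspace clx.
Qed.

(** Intermediate values; t = 1 is reached, at s = 0, because nu does not
    charge 0. *)
Lemma pgf_onto nu (t : R) : nu [set 0%N] = 0%E -> 0 < t <= 1 ->
  exists2 s, 0 <= s < 1 & 1 - pgf nu s = t.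
Proof.
move=> nu0 /andP[t0 t1].
have h0 : pgf nu 0 = 0 by apply: EFin_inj; rewrite pgf0.
have [|s] := @IVT R (pgf nu) 0 1 (1 - t) ler01 (@pgf_continuous nu).
  by rewrite h0 pgf1 min_l ?ler01// max_r ?ler01//; lra.
rewrite in_itv/= => /andP[s0 s1] e; exists s; last by rewrite e; lra.
rewrite s0/= lt_neqAle s1 andbT; apply/eqP => s1E.
by move: e; rewrite s1E pgf1; lra.
Qed.

End pgf.

Section offspring_mean.
Context {R : realType}.
Variables (xi : probability nat R) (m : R).
Hypothesis xi_mean : (\int[xi]_k (k%:R : R)%:E)%E = m%:E.

(** Bernoulli's inequality 1 - s ^+ k <= k (1 - s), integrated. *)
Lemma onem_pgf_le (s : R) : 0 <= s <= 1 -> 1 - pgf xi s <= m * (1 - s).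
Proof.
move=> /[dup] s01 /andP[s0 s1]; rewrite -lee_fin -integral_onemX// mulrC EFinM -xi_mean.
rewrite -ge0_integralZl//; last by rewrite lee_fin subr_ge0.
apply: ge0_le_integral => //.
- by move=> k _; rewrite lee_fin subr_ge0; have /andP[] := expr_itv01 k s01.
- move=> k _; rewrite -EFinM lee_fin lerBlDr -lerBlDl.
  have h : 1 + k%:R * (s - 1) <= (1 + (s - 1)) ^+ k by apply: bernoulli_ge; lra.
  rewrite [1 + (s - 1)]addrC subrK in h; apply: le_trans h.
  by rewrite (_ : 1 - (1 - s) * k%:R = 1 + k%:R * (s - 1)); [|ring].
Qed.

Lemma offspring_pgf_lt1 (s : R) : 0 < m -> 0 <= s < 1 -> pgf xi s < 1.
Proof.
move=> m0 s1; have s01 : 0 <= s <= 1 by have /andP[-> /ltW] := s1.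
rewrite lt_neqAle; have /andP[_ ->] := pgf_itv01 xi s01; rewrite andbT; apply/eqP => e.
have : (\int[xi]_k (k%:R : R)%:E = 0)%E.
  rewrite ge0_integral_nat// eseries0// => k _ _.
  have [->|k0] := posnP k; first by rewrite mulr0n mule0.
  by rewrite (pgf_eq1_mass s1 e k0) mul0e.
by rewrite xi_mean => -[m0']; move: m0; rewrite m0' ltxx.
Qed.

(** The ratio is the integral of 1 + s + ... + s ^+ k.-1, which is dominated
    by k and tends to k as s tends to 1. *)
Lemma cvg_onem_pgf_ratio (s_ : nat -> R) : (forall n, 0 <= s_ n < 1) ->
  s_ @ \oo --> (1 : R) ->
  (fun n => (1 - pgf xi (s_ n)) / (1 - s_ n)) @ \oo --> m.
Proof.
move=> s01 s1.
pose f_ n k : R := \sum_(i < k) s_ n ^+ i.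
have f0 n k : 0 <= f_ n k.
  by apply: sumr_ge0 => i _; rewrite exprn_ge0//; have /andP[] := s01 n.
have h : ((\int[xi]_k (f_ n k)%:E) @[n --> \oo] --> \int[xi]_k (k%:R : R)%:E)%E.
  apply: (@dominated_cvg _ _ _ xi setT measurableT (fun n k => (f_ n k)%:E)
      (fun k => (k%:R : R)%:E) (fun k => (k%:R : R)%:E)) => //.
  - move=> k _; apply: cvg_EFin; first exact: nearW.
    rewrite (_ : fine \o _ = (fun n => f_ n k)); last by [].
    elim: k => [|k IH]; rewrite /f_.
      by under eq_fun do rewrite big_ord0; exact: cvg_cst.
    under eq_fun do rewrite big_ord_recr/=.
    rewrite -natr1; apply: cvgD => //; rewrite -[1](expr1n _ k).
    exact: (@cvg_comp _ _ _ s_ (fun y : R => y ^+ k) _ _ _ s1 (@exprn_continuous R k 1)).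
  - apply/integrableP; split => //.
    by under eq_integral do rewrite gee0_abs ?lee_fin//; rewrite xi_mean ltry.
  - move=> n k _; rewrite lee_fin ger0_norm//.
    rewrite -[leRHS](_ : \sum_(i < k) (1 : R) = _); last by rewrite sumr_const card_ord.
    by apply: ler_sum => i _; have /andP[a b] := s01 n; rewrite exprn_ile1// ltW.
suff e n : (\int[xi]_k (f_ n k)%:E = ((1 - pgf xi (s_ n)) / (1 - s_ n))%:E)%E.
  by move: h; under eq_fun do rewrite e; rewrite xi_mean => /fine_cvg.
have /andP[a b] := s01 n; have ds : 0 < 1 - s_ n by rewrite subr_gt0.
have := @integral_onemX R xi (s_ n); rewrite a (ltW b) => /(_ isT).
under eq_integral.
  move=> k _; rewrite -opprB subrX1 -mulNr opprB EFinM; over.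
rewrite ge0_integralZl//; last 2 first.
- by move=> k _; rewrite lee_fin; exact: (f0 n k).
- by rewrite lee_fin ltW.
move=> e.
have -> : (\int[xi]_k (f_ n k)%:E = (1 - s_ n)^-1%:E * ((1 - s_ n)%:E * \int[xi]_k (f_ n k)%:E))%E.
  by rewrite muleA -EFinM mulVf ?gt_eqF// mul1e.
by rewrite e -EFinM mulrC.
Qed.

End offspring_mean.

(** * The Galton-Watson process and its invariant measures *)

Section transition_genfun.
Context {R : realType}.
Variable xi : probability nat R.

Lemma transition_ge0 i j : 0 <= transition xi i j.
Proof. by apply: convolution_power_ge0 => k; exact: fine_ge0. Qed.

Lemma transition_pgf i (s : R) : 0 <= s <= 1 ->
  series (fun j => transition xi i j * s ^+ j) @ \oo --> pgf xi s ^+ i.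
Proof.
move=> s01; have [_ _ + _] := has_csum_convolution_power (has_csum_pgf xi s01) i.
rewrite -rmorphXn /= (_ : series _ = series (fun j => transition xi i j * s ^+ j))//.
by apply/funext => n; rewrite /series/=; apply: eq_bigr => k _; rewrite -rmorphXn -rmorphM.
Qed.

(** Both sides are the double sum of nu {i} P_0(i, j) s ^+ j. *)
Lemma step_genfun (nu : {measure set nat -> \bar R}) (s : R) : 0 <= s <= 1 ->
  (\sum_(0 <= j <oo) (\int[nu]_i (transition xi i j)%:E) * (s ^+ j)%:E
   = \int[nu]_i (pgf xi s ^+ i)%:E)%E.
Proof.
move=> s01.
have sj j : 0 <= s ^+ j by have /andP[] := expr_itv01 j s01.
transitivity (\sum_(0 <= j <oo) (\int[nu]_i (transition xi i j * s ^+ j)%:E))%E.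
  apply: eq_eseriesr => j _; under [RHS]eq_integral do rewrite EFinM.
  rewrite ge0_integralZr ?lee_fin// => i _; by rewrite lee_fin transition_ge0.
rewrite -integral_nneseries//; last first.
  by move=> n x _; rewrite lee_fin mulr_ge0// transition_ge0.
apply: eq_integral => i _; apply/cvg_lim => //.
under eq_fun do rewrite sumEFin.
by apply: cvg_EFin; [exact: nearW|exact: transition_pgf].
Qed.

Lemma invariant_genfun (lambda : R) (nu : {measure set nat -> \bar R}) (s : R) :
  0 <= s <= 1 -> 0 <= lambda -> true_invariant xi lambda nu ->
  (\int[nu]_i (pgf xi s ^+ i)%:E = lambda%:E * \int[nu]_i (s ^+ i)%:E)%E.
Proof.
move=> s01 l0 inv.
have sj j : 0 <= s ^+ j by have /andP[] := expr_itv01 j s01.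
rewrite -step_genfun// ge0_integral_nat// -nneseriesZl; last first.
  by move=> i _; rewrite mule_ge0// lee_fin.
apply: eq_eseriesr => j _; rewrite ge0_integral_nat; last first.
  by move=> i; rewrite lee_fin transition_ge0.
by rewrite inv muleA.
Qed.

(** The hypotheses at s = 1/2 make every coordinate of nu P_0 finite; the two
    sides of nu P_0 = lambda nu are then locally finite measures with the same
    power series. *)
Lemma genfun_invariant (lambda : R) (nu : {measure set nat -> \bar R}) :
  0 <= lambda -> locally_finite_nat nu ->
  (forall s : R, (0 < s < 1)%R -> \int[nu]_i (s ^+ i)%:E < +oo)%E ->
  (forall s : R, (0 < s < 1)%R ->
     \int[nu]_i (pgf xi s ^+ i)%:E = lambda%:E * \int[nu]_i (s ^+ i)%:E)%E ->
  true_invariant xi lambda nu.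
Proof.
move=> l0 nufin fin e.
have s01 (s : R) : 0 < s < 1 -> 0 <= s <= 1 by move=> /andP[/ltW -> /ltW ->].
have t0 j : (0 <= \int[nu]_i (transition xi i j)%:E)%E.
  by apply: integral_ge0 => i _; rewrite lee_fin transition_ge0.
have tfin j : (\int[nu]_i (transition xi i j)%:E < +oo)%E.
  have h : 0 < (2^-1 : R) < 1 by lra.
  have hj : 0 < 2^-1 ^+ j :> R by rewrite exprn_gt0// invr_gt0.
  have : (\int[nu]_i (transition xi i j * 2^-1 ^+ j)%:E < +oo)%E.
    apply: le_lt_trans (_ : \int[nu]_i (pgf xi 2^-1 ^+ i)%:E < +oo)%E; last first.
      by rewrite e// lte_mul_pinfty ?lee_fin// fin.
    apply: ge0_le_integral => //.
    - by move=> i _; rewrite lee_fin mulr_ge0 ?transition_ge0// ltW.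
    - move=> i _; rewrite lee_fin.
      have c := @transition_pgf i _ (s01 _ h).
      apply: (@le_trans _ _ (series (fun j => transition xi i j * 2^-1 ^+ j) j.+1)).
        rewrite seriesSr lerDr; apply: sumr_ge0 => k _.
        by rewrite mulr_ge0 ?transition_ge0// exprn_ge0.
      rewrite -(cvg_lim (@Rhausdorff R) c); apply: nondecreasing_cvgn_le; last exact: cvgP c.
      apply/nondecreasing_seqP => n; rewrite seriesSr lerDl.
      by rewrite mulr_ge0 ?transition_ge0// exprn_ge0.
  under eq_integral do rewrite EFinM.
  rewrite ge0_integralZr ?lee_fin ?(ltW hj)//; last by move=> i _; rewrite lee_fin transition_ge0.
  have := t0 j.
  case: (\int[nu]_i (transition xi i j)%:E)%E => [r||]//= _.
    by move=> _; rewrite ltry.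
  by rewrite gt0_mulye ?lte_fin.
have [A AE] := @nat_measure_exists R (fun j => fine (\int[nu]_i (transition xi i j)%:E)%E) (fun j => fine_ge0 (t0 j)).
have [|B BE] := @nat_measure_exists R (fun j => lambda * fine (nu [set j])).
  by move=> j; rewrite mulr_ge0// fine_ge0.
have sj (s : R) j : 0 < s < 1 -> 0 <= s ^+ j by move=> /andP[/ltW h _]; rewrite exprn_ge0.
have BI (s : R) : 0 < s < 1 -> (\int[B]_k (s ^+ k)%:E = lambda%:E * \int[nu]_i (s ^+ i)%:E)%E.
  move=> s1; rewrite !ge0_integral_nat//; try by move=> k; rewrite lee_fin sj.
  rewrite -nneseriesZl; last by move=> k _; rewrite mule_ge0// lee_fin sj.
  apply: eq_eseriesr => k _; rewrite BE EFinM fineK ?muleA//.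
  by rewrite ge0_fin_numE// nufin.
have AI (s : R) : 0 < s < 1 -> (\int[A]_k (s ^+ k)%:E = \int[nu]_i (pgf xi s ^+ i)%:E)%E.
  move=> s1; rewrite -step_genfun ?s01// ge0_integral_nat; last by move=> k; rewrite lee_fin sj.
  by apply: eq_eseriesr => k _; rewrite AE fineK// ge0_fin_numE.
move=> j; transitivity (A [set j]).
  rewrite AE fineK ?ge0_fin_numE// ge0_integral_nat// => i.
  by rewrite lee_fin transition_ge0.
rewrite (_ : A [set j] = B [set j]).
  by rewrite BE EFinM fineK// ge0_fin_numE// nufin.
apply: power_series_inj => s s1; last by rewrite AI// BI// e.
by rewrite AI// e// lte_mul_pinfty ?lee_fin// fin.
Qed.

End transition_genfun.

Section galton_watson.
Context {R : realType} d (T : measurableType d).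
Variables (xi : probability nat R) (P : probability T R) (Z : nat -> {RV P >-> nat}).
Hypothesis Z_gw : galton_watson_from xi Z 1%N.
Local Open Scope ereal_scope.

Let event k n (i : nat -> nat) : set T :=
  [set w | forall l, (k <= l <= n)%N -> Z l w = i l].

Let mZ n (B : set nat) : measurable (Z n @^-1` B).
Proof. by rewrite -[X in measurable X]setTI; exact: measurable_funP. Qed.

Let measurable_event k n i : measurable (event k n i).
Proof.
rewrite (_ : event k n i = \bigcap_l (if (k <= l <= n)%N then Z l @^-1` [set i l] else setT)).
  by apply: bigcapT_measurable => l; case: ifP.
apply/seteqP; split => w h l /=; first by move=> _; case: ifP => // kln; exact: h.
by move=> kln; have := h l I; rewrite kln.
Qed.

Let total k (A : set T) : measurable A ->
  P A = \sum_(0 <= a <oo) P (A `&` Z k @^-1` [set a]).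
Proof.
move=> mA; rewrite -[in LHS](setIT A).
have -> : [set: T] = \bigcup_a Z k @^-1` [set a].
  by apply/seteqP; split => // w _; exists (Z k w).
rewrite setI_bigcupr measure_bigcup//=; last 2 first.
- by move=> a _; apply: measurableI => //; exact: mZ.
- by move=> a b _ _ [w [[_ <-] [_ <-]]].
by apply: eq_eseriesl => a; rewrite in_setT.
Qed.

(** The Markov property is assumed for cylinders starting at time 0 only;
    summing over the value of Z k moves the starting time from k to k + 1. *)
Let event_transition k n i : (k <= n)%N ->
  P (event k n.+1 i) = P (event k n i) * (transition xi (i n) (i n.+1))%:E.
Proof.
elim: k i => [|k IH] i kn.
  by have [_ h] := Z_gw; exact: (h n i).
pose i_ a l := if l == k then a else i l.
have step a N : (k < N)%N -> event k.+1 N i `&` Z k @^-1` [set a] = event k N (i_ a).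
  move=> kN; apply/seteqP; split => w.
    move=> [h wa] l /andP[kl lN]; rewrite /i_; case: eqP => [->//|/eqP lk].
    by apply: h; rewrite lN ltn_neqAle kl eq_sym lk.
  move=> h; split => [l /andP[kl lN]|/=].
    by rewrite h ?lN ?(ltnW kl)// /i_ gtn_eqF.
  by rewrite h ?leqnn ?(ltnW kN)// /i_ eqxx.
rewrite (total k (measurable_event _ _ _)) (total k (measurable_event k.+1 n i)).
rewrite muleC -nneseriesZl => [|a _]; last exact: measure_ge0.
apply: eq_eseriesr => a _; rewrite !step//; last exact: ltnW.
rewrite IH ?(ltnW kn)// muleC /i_ gtn_eqF// gtn_eqF//; exact: ltnW.
Qed.

Definition law n : probability nat R := distribution P (Z n).

Lemma law_step n j : law n.+1 [set j] = \int[law n]_i (transition xi i j)%:E.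
Proof.
rewrite ge0_integral_nat => [|k]; last by rewrite lee_fin transition_ge0.
rewrite (_ : law n.+1 [set j] = P (Z n.+1 @^-1` [set j]))// (total n (mZ _ _)).
apply: eq_eseriesr => a _.
have h := @event_transition n n (fun l => if l == n.+1 then j else a) (leqnn n).
rewrite eqxx ltn_eqF// in h.
rewrite (_ : Z n.+1 @^-1` [set j] `&` Z n @^-1` [set a] =
  event n n.+1 (fun l => if l == n.+1 then j else a)); last first.
  apply/seteqP; split => w /=.
    move=> [zj za] l /andP[nl]; rewrite leq_eqVlt => /predU1P[->|ln]; first by rewrite eqxx.
    have -> : l = n by apply/eqP; rewrite eqn_leq nl andbT -ltnS.
    by rewrite ltn_eqF.
  by move=> e; split; rewrite e ?leqnn ?leqnSn ?eqxx// ltn_eqF.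
rewrite h (_ : event n n _ = Z n @^-1` [set a])//; apply/seteqP; split => w /=.
  by move=> e; rewrite e ?leqnn// ltn_eqF.
move=> za l /andP[nl ln]; have -> : l = n by apply/eqP; rewrite eqn_leq nl ln.
by rewrite ltn_eqF.
Qed.

Lemma pgf_law n (s : R) : (0 <= s <= 1)%R -> pgf (law n) s = iter n (pgf xi) s.
Proof.
have PC : P (~` (Z 0%N @^-1` [set 1%N])) = 0.
  have [h _] := Z_gw; rewrite probability_setC; last exact: mZ.
  by rewrite (_ : P (Z 0%N @^-1` [set 1%N]) = 1)// subee.
elim: n s => [|n IH] s s01; apply: EFin_inj; rewrite -pgfE//.
  rewrite ge0_integral_distribution//; last first.
    by move=> k; rewrite lee_fin; have /andP[] := expr_itv01 k s01.
  rewrite (ae_eq_integral (cst s%:E))//.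
  - rewrite integral_cst// [X in (_ * X)%E](_ : _ = 1%E) ?mule1//.
    exact: probability_setT.
  - by apply/measurable_EFinP; apply: measurableT_comp.
  - exists (~` (Z 0%N @^-1` [set 1%N])); split.
    + by apply: measurableC; exact: mZ.
    + exact: PC.
    + by move=> w /= h e; apply: h => _; rewrite e expr1.
rewrite iterSr -IH ?pgf_itv01// -pgfE ?pgf_itv01// -step_genfun//.
rewrite ge0_integral_nat; last by move=> k; rewrite lee_fin; have /andP[] := expr_itv01 k s01.
by apply: eq_eseriesr => j _; rewrite -law_step.
Qed.

(** In the generating function of Z n, the event Z n = 0 accounts for the
    value at 0. *)
Lemma survival_integral n (s : R) : (0 <= s <= 1)%R ->
  \int[P]_(w in [set w | (0 < Z n w)%N]) (s ^+ Z n w)%:E =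
  (pgf (law n) s - pgf (law n) 0)%:E.
Proof.
move=> s01; have z01 : (0 <= (0 : R) <= 1)%R by rewrite lexx ler01.
have E t : (0 <= t <= 1)%R -> \int[P]_w (t ^+ Z n w)%:E = (pgf (law n) t)%:E.
  move=> t01; rewrite -pgfE// ge0_integral_distribution// => k.
  by rewrite lee_fin; have /andP[] := expr_itv01 k t01.
have I t : (0 <= t <= 1)%R -> P.-integrable setT (EFin \o (fun w => t ^+ Z n w)%R).
  move=> t01; apply/integrableP; split.
    by apply/measurable_EFinP; apply: (measurableT_comp (f := fun k => (t ^+ k)%R)).
  under eq_integral.
    move=> w _; rewrite gee0_abs/=; last by rewrite lee_fin; have /andP[] := expr_itv01 (Z n w) t01.
    over.
  by rewrite E// ltry.
rewrite EFinB -!E// -integralB_EFin//; [|exact: I..].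
rewrite [LHS]integral_mkcond; apply: eq_integral => w _; rewrite patchE.
case: ifPn => [|]; first by rewrite inE/= => z0; rewrite expr0n gtn_eqF// sube0.
by rewrite notin_setE/= => /negP; rewrite -eqn0Ngt => /eqP ->; rewrite !expr0 subee.
Qed.

End galton_watson.

(** * The Yaglom limit *)

Section log_asymptotics.
Context {R : realType}.

Lemma onem_le_Nln (u : R) : 0 < u -> 1 - u <= - ln u.
Proof.
move=> u0; have := @le_ln1Dx R (u - 1); rewrite (_ : 1 + (u - 1) = u); last by ring.
move=> h; have {h} : ln u <= u - 1 by apply: h; lra.
lra.
Qed.

Lemma Nln_le (u : R) : 0 < u -> - ln u <= (1 - u) / u.
Proof.
move=> u0; have ui : 0 < u^-1 by rewrite invr_gt0.
have := onem_le_Nln ui; rewrite lnV ?posrE// opprK => h.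
rewrite mulrBl mul1r divff ?gt_eqF//; lra.
Qed.

Lemma cvg_Nln_ratio (u : nat -> R) : (forall n, 0 < u n < 1) -> u @ \oo --> (1 : R) ->
  (fun n => - ln (u n) / (1 - u n)) @ \oo --> (1 : R).
Proof.
move=> u01 u1; apply: (@squeeze_cvgr _ _ _ _ (cst 1) (fun n => (u n)^-1)).
- near=> n; have /andP[u0 ul] := u01 n.
  have d0 : 0 < 1 - u n by rewrite subr_gt0.
  rewrite /= ler_pdivlMr// mul1r onem_le_Nln//= ler_pdivrMr// mulrC.
  exact: Nln_le.
- exact: cvg_cst.
- by rewrite -[X in _ --> X]invr1; apply: cvgV => //; rewrite oner_eq0.
Unshelve. all: by end_near. Qed.

End log_asymptotics.

Section subcritical.
Context {R : realType}.
Variables (xi : probability nat R) (m : R).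
Hypotheses (xi_mean : (\int[xi]_k (k%:R : R)%:E)%E = m%:E) (m0 : 0 < m) (m1 : m < 1).
Local Notation F := (pgf xi).

Lemma iter_pgf_itv (s : R) n : 0 <= s < 1 -> 0 <= iter n F s < 1.
Proof.
move=> s1; elim: n => [//|n /andP[a b]] /=.
rewrite (offspring_pgf_lt1 xi_mean)// ?a ?b// andbT.
by have /andP[] : 0 <= F (iter n F s) <= 1 by apply: pgf_itv01; rewrite a ltW.
Qed.

(** At s = 0 the bound onem_pgf_le reads 1 - F 0 <= m < 1. *)
Lemma pgf0_gt0 : 0 < F 0.
Proof.
have h : 1 - F 0 <= m * (1 - 0) by apply: (onem_pgf_le xi_mean); rewrite lexx ler01.
rewrite subr0 mulr1 lerBlDr in h.
by rewrite -(ltrD2l m) addr0; exact: lt_le_trans m1 h.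
Qed.

Lemma iter_pgf_gt0 (s : R) n : 0 <= s < 1 -> 0 < iter n.+1 F s.
Proof.
move=> s1; apply: lt_le_trans pgf0_gt0 _; have /andP[a b] := iter_pgf_itv n s1.
by apply: pgf_le => //; exact: ltW.
Qed.

Lemma cvg_iter_pgf (s : R) : 0 <= s < 1 -> (fun n => iter n F s) @ \oo --> (1 : R).
Proof.
move=> s1.
have le n : 1 - iter n F s <= m ^+ n * (1 - s).
  elim: n => [|n IH]; first by rewrite expr0 mul1r.
  rewrite exprS -mulrA; have /andP[a b] := iter_pgf_itv n s1.
  apply: le_trans (onem_pgf_le xi_mean _) _; first by rewrite a ltW.
  by rewrite ler_pM2l.
apply: (@squeeze_cvgr _ _ _ _ (fun n => 1 - m ^+ n * (1 - s)) (cst 1)).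
- near=> n; have /andP[a b] := iter_pgf_itv n s1; have := le n => h.
  by rewrite /= (ltW b) andbT; lra.
- rewrite -[X in _ --> X]subr0; apply: cvgB; first exact: cvg_cst.
  rewrite -(mul0r (1 - s)); apply: cvgMl.
  by apply: cvg_expr; rewrite ger0_norm ?ltW.
- exact: cvg_cst.
Unshelve. all: by end_near. Qed.

Lemma cvg_iter_pgf_ratio (s : R) : 0 <= s < 1 ->
  (fun n => (1 - iter n.+1 F s) / (1 - iter n F s)) @ \oo --> m.
Proof.
move=> s1; apply: (@cvg_onem_pgf_ratio R xi m xi_mean (fun n => iter n F s)).
  by move=> n; exact: iter_pgf_itv.
exact: cvg_iter_pgf.
Qed.

Variables (d : measure_display) (T : measurableType d) (P : probability T R)
  (Z : nat -> {RV P >-> nat}) (nu_min : probability nat R).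
Hypotheses (Z_gw : galton_watson_from xi Z 1%N) (nu_minP : yaglom_limit Z nu_min).
Local Notation H := (pgf nu_min).

Lemma yaglom_mass0 : nu_min [set 0%N] = 0%E.
Proof. by have [] := nu_minP. Qed.

(** The definition of the Yaglom limit, tested on k |-> s ^+ k, says that (F_n
    s - F_n 0) / (1 - F_n 0) tends to H s. *)
Lemma cvg_yaglom_ratio (s : R) : 0 <= s < 1 ->
  (fun n => (1 - iter n F s) / (1 - iter n F 0)) @ \oo --> 1 - H s.
Proof.
move=> /[dup] s1 /andP[s0 sl].
have s01 : 0 <= s <= 1 by rewrite s0 ltW.
have z01 : 0 <= (0 : R) <= 1 by rewrite lexx ler01.
have z1 : 0 <= (0 : R) < 1 by rewrite lexx ltr01.
have o01 : 0 <= (1 : R) <= 1 by rewrite lexx ler01.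
have [_ h] := nu_minP.
have {}h : (fun n => (iter n F s - iter n F 0) / (1 - iter n F 0)) @ \oo --> H s.
  have bd : exists M : R, forall k, `|s ^+ k| <= M.
    by exists 1 => k; have /andP[a b] := expr_itv01 k s01; rewrite ger0_norm.
  have := h (fun k => s ^+ k) bd; apply: cvg_trans.
  apply: near_eq_cvg; apply: nearW => n.
  rewrite /Rintegral (survival_integral Z n s01) /= !(pgf_law Z_gw)//; congr (_ / _).
  have -> : P [set w | (0 < Z n w)%N] = (1 - iter n F 0)%:E.
    have := survival_integral Z n o01; rewrite pgf1 (pgf_law Z_gw)// => <-.
    under eq_integral do rewrite expr1n.
    rewrite integral_cst ?mul1e//.
    rewrite (_ : [set w | _] = Z n @^-1` [set k | (0 < k)%N])//.
    by rewrite -[X in measurable X]setTI; exact: measurable_funP.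
  by [].
rewrite (_ : (fun n => _) = (fun n => 1 - (iter n F s - iter n F 0) / (1 - iter n F 0))).
  by apply: cvgB => //; exact: cvg_cst.
apply/funext => n; have /andP[_ b] := iter_pgf_itv n z1; field.
by rewrite subr_eq0 gt_eqF.
Qed.

(** Replacing s by F s multiplies the ratio in cvg_yaglom_ratio by (1 -
    F_(n+1) s) / (1 - F_n s), which tends to m. *)
Lemma yaglom_schroeder (s : R) : 0 <= s < 1 -> 1 - H (F s) = m * (1 - H s).
Proof.
move=> s1; have Fs1 : 0 <= F s < 1 by have := iter_pgf_itv 1 s1.
apply: (cvg_unique (@Rhausdorff R) (cvg_yaglom_ratio Fs1)).
rewrite (_ : (fun n => _) = (fun n => (1 - iter n.+1 F s) / (1 - iter n F s) *
  ((1 - iter n F s) / (1 - iter n F 0)))).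
  by apply: cvgM; [exact: cvg_iter_pgf_ratio|exact: cvg_yaglom_ratio].
apply/funext => n; rewrite -iterSr mulrA divfK//.
by have /andP[_ b] := iter_pgf_itv n s1; rewrite subr_eq0 gt_eqF.
Qed.

(** If H s = 1 then nu_min is carried by 0, which it does not charge. *)
Lemma yaglom_pgf_lt1 (s : R) : 0 <= s < 1 -> 0 < 1 - H s.
Proof.
move=> /[dup] s1 /andP[s0 sl]; rewrite subr_gt0.
rewrite lt_neqAle; have /andP[_ ->] : 0 <= H s <= 1 by apply: pgf_itv01; rewrite s0 ltW.
rewrite andbT; apply/eqP => e.
have z k : (0 < k)%N -> (nu_min : {measure set nat -> \bar R}) [set k] = 0%E.
  exact: pgf_eq1_mass s1 e.
have : (\int[nu_min]_k ((1 : R) ^+ k)%:E = 0)%E.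
  rewrite ge0_integral_nat; last by move=> k; rewrite lee_fin expr1n.
  rewrite eseries0// => k _ _; have [->|k0] := posnP k; last by rewrite z// mul0e.
  by rewrite (_ : (nu_min : {measure set nat -> \bar R}) [set 0%N] = 0%E) ?mul0e//; exact: yaglom_mass0.
by rewrite pgfE ?ler01 ?lexx// pgf1 => -[/eqP]; rewrite oner_eq0.
Qed.

(** Equivalent to 1 - F_(n+1) s as n grows. The iterates start at 1 because
    F_0 0 = 0 has no logarithm. *)
Definition log_survival n (s : R) : R := - ln (iter n.+1 F s).

Lemma log_survival_gt0 n (s : R) : 0 <= s < 1 -> 0 < log_survival n s.
Proof.
move=> s1; have /andP[_ b] := iter_pgf_itv n.+1 s1.
by rewrite /log_survival oppr_gt0 ln_lt0// b iter_pgf_gt0.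
Qed.

(** Up to equivalents this is (1 - F_(n+1) s) / (1 - F_(n+j+1) 0): the ratio
    at equal times tends to 1 - H s, and each of the j further steps
    multiplies the denominator by m in the limit. *)
Lemma cvg_log_survival_ratio (s : R) j : 0 <= s < 1 ->
  (fun n => log_survival n s / log_survival (n + j) 0) @ \oo --> (1 - H s) / m ^+ j.
Proof.
move=> s1; have z1 : 0 <= (0 : R) < 1 by rewrite lexx ltr01.
pose e n (t : R) := 1 - iter n.+1 F t.
have e0 n t : 0 <= t < 1 -> e n t != 0.
  by move=> t1; have /andP[_ b] := iter_pgf_itv n.+1 t1; rewrite subr_eq0 gt_eqF.
have r (t : R) : 0 <= t < 1 -> (fun n => log_survival n t / e n t) @ \oo --> (1 : R).
  move=> t1; apply: (@cvg_Nln_ratio R (fun n => iter n.+1 F t)).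
    move=> n; rewrite (iter_pgf_gt0 n t1); by have /andP[] := iter_pgf_itv n.+1 t1.
  by have := cvg_iter_pgf t1; rewrite -cvg_shiftS.
have rj k : (fun n => e (n + k)%N 0 / e n 0) @ \oo --> m ^+ k.
  elim: k => [|k IH].
    rewrite expr0; apply: cvg_near_cst; apply: nearW => n.
    by rewrite addn0 divff// e0.
  rewrite exprS (_ : (fun n => _) = (fun n => e (n + k).+1 0 / e (n + k)%N 0 * (e (n + k)%N 0 / e n 0))).
    apply: cvgM => //.
    have := cvg_iter_pgf_ratio z1; rewrite -(cvg_shiftn k.+1) => h.
    apply: cvg_trans h; apply: near_eq_cvg; apply: nearW => n.
    by rewrite /e /= addnS.
  by apply/funext => n; rewrite addnS mulrA divfK// e0.
have ry : (fun n => e n s / e n 0) @ \oo --> 1 - H s.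
  by have := cvg_yaglom_ratio s1; rewrite -cvg_shiftS.
have mk : m ^+ j != 0 by rewrite expf_neq0// gt_eqF.
have r0 : (fun n => log_survival (n + j) 0 / e (n + j)%N 0) @ \oo --> (1 : R).
  by have := r 0 z1; rewrite -(cvg_shiftn j).
rewrite (_ : (fun n => _) = (fun n => log_survival n s / e n s * (e n s / e n 0) *
  ((e (n + j)%N 0 / e n 0)^-1 * (log_survival (n + j) 0 / e (n + j)%N 0)^-1))).
  rewrite (_ : (1 - H s) / m ^+ j = 1 * (1 - H s) * ((m ^+ j)^-1 * 1^-1)); last first.
    by rewrite invr1 mulr1 mul1r.
  have c1 : (fun n => log_survival n s / e n s * (e n s / e n 0)) @ \oo --> 1 * (1 - H s).
    by apply: cvgM => //; exact: r.
  apply: cvgM => //.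
  have c2 : (fun n => (e (n + j)%N 0 / e n 0)^-1) @ \oo --> (m ^+ j)^-1 by exact: cvgV.
  have c3 : (fun n => (log_survival (n + j) 0 / e (n + j)%N 0)^-1) @ \oo --> (1 : R)^-1.
    by apply: cvgV => //; exact: oner_neq0.
  exact: cvgM.
apply/funext => n; have l0 := log_survival_gt0 (n + j) z1.
by field; rewrite !e0//= gt_eqF.
Qed.

End subcritical.

(** * Scale-invariant measures *)

Section covering_bound.
Context d (T : measurableType d) (R : realType).
Variable mu : {measure set T -> \bar R}.

(** On D the function f is at most the sum of the C q ^+ k times the
    indicators of the F k, whose integral is bounded by a geometric series. *)
Lemma geometric_cover_integral_lty (D : set T) (f : T -> R) (F : nat -> set T) (C q K : R) :
  measurable D -> measurable_fun D f -> (forall x, D x -> 0 <= f x) ->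
  0 <= C -> 0 <= q < 1 ->
  (forall k, measurable (F k)) -> (forall k, (mu (F k) <= K%:E)%E) ->
  (forall x, D x -> exists2 k, F k x & f x <= C * q ^+ k) ->
  (\int[mu]_(x in D) (f x)%:E < +oo)%E.
Proof.
move=> mD mf f0 C0 /andP[q0 q1] mF FK fF.
have Cq k : 0 <= C * q ^+ k by rewrite mulr_ge0 ?exprn_ge0.
have K0 : 0 <= K by rewrite -lee_fin; exact: le_trans (measure_ge0 _ _) (FK 0%N).
pose g k x : \bar R := ((C * q ^+ k)%:E * (\1_(F k) x)%:E)%E.
have g0 k x : (0 <= g k x)%E by rewrite mule_ge0// lee_fin.
have mg k : measurable_fun D (g k).
  apply/measurable_EFinP; apply: measurable_funM => //; exact: measurable_indic.
apply: (@le_lt_trans _ _ (\int[mu]_(x in D) (\sum_(0 <= k <oo) g k x))%E).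
  apply: ge0_le_integral => //.
  - exact/measurable_EFinP.
  - by apply: ge0_emeasurable_sum => // k x Dx _; exact: g0.
  - move=> x Dx; have [k Fkx fle] := fF x Dx.
    apply: (@le_trans _ _ (g k x)).
      by rewrite /g indicE mem_set// mule1 lee_fin.
    apply: le_trans (@nneseries_lim_ge R (fun k => g k x) xpredT 0 k.+1 _) => //.
    by rewrite big_nat_recr//= leeDr// sume_ge0.
rewrite integral_nneseries//.
apply: (@le_lt_trans _ _ (\sum_(0 <= k <oo) (K * C * q ^+ k)%:E)%E).
  apply: lee_nneseries => [k _|k _]; first by rewrite integral_ge0.
  rewrite /g ge0_integralZl ?lee_fin//; last 1 first.
  - by apply/measurable_EFinP; exact: measurable_indic.
  rewrite integral_indic// -mulrA EFinM muleC.
  rewrite [leRHS]EFinM -EFinM; apply: lee_wpmul2r; first by rewrite lee_fin.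
  apply: le_trans (FK k); apply: le_measure; rewrite ?inE//; exact: measurableI.
suff -> : (\sum_(0 <= k <oo) (K * C * q ^+ k)%:E = (K * C / (1 - q))%:E)%E by rewrite ltry.
apply/cvg_lim => //; under eq_fun do rewrite sumEFin.
apply: cvg_EFin; first exact: nearW.
by apply: cvg_geometric_series; rewrite ger0_norm.
Qed.

End covering_bound.

Section exponential_decay.
Context {R : realType}.

Lemma expr_expRN_bounded (c : R) N : 0 < c ->
  exists C, forall x, 0 <= x -> x ^+ N * expR (- (c * x)) <= C.
Proof.
move=> c0; case: N => [|N].
  exists 1 => x x0; rewrite expr0 mul1r expRN invf_le1 ?expR_gt0//.
  by apply: le_trans (expR_ge1Dx _); rewrite lerDl mulr_ge0 ?(ltW c0).
exists ((N.+1)`!%:R / c ^+ N.+1) => x x0.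
have h : (c * x) ^+ N.+1 / (N.+1)`!%:R <= expR (c * x).
  by apply: le_trans (expR_ge1Dxn N _); rewrite ?lerDr// mulr_ge0// ltW.
rewrite expRN ler_pdivrMr ?expR_gt0//.
have f0 : 0 < ((N.+1)`!%:R : R) by rewrite ltr0n fact_gt0.
have c0' : 0 < c ^+ N.+1 by rewrite exprn_gt0.
rewrite mulrAC ler_pdivlMr// mulrC -exprMn.
by rewrite -ler_pdivrMl// mulrC.
Qed.

Lemma powR_expRN_bounded (c b : R) : 0 < c ->
  exists2 C, 0 <= C & forall x, 1 <= x -> x * (x `^ b * expR (- (c * x))) <= C.
Proof.
move=> c0; pose N := (Num.trunc b).+2.
have [C hC] := expr_expRN_bounded N c0.
have C0 : 0 <= C by apply: le_trans (hC 1 ler01); rewrite expr1n mul1r expR_ge0.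
exists C => // x x1; have x0 : 0 <= x by lra.
apply: le_trans (hC x x0); rewrite mulrA ler_wpM2r ?expR_ge0//.
rewrite exprS ler_wpM2l// -powR_mulrn//; apply: ler_powR => //.
exact: ltW (truncnS_gt b).
Qed.

End exponential_decay.

Section scale_invariant.
Context {R : realType}.
Variables (m : R) (L : {measure set (measurableTypeR R) -> \bar R}).
Hypotheses (m0 : 0 < m) (m1 : m < 1) (Lm : scale_invariant_measure m L).
Local Notation D := (`]0, +oo[%classic : set (measurableTypeR R)).

Local Notation segment a b := (`[a, b]%classic : set (measurableTypeR R)).

Let mD : measurable D. Proof. exact: measurable_itv. Qed.

(** By compactness, finitely many of the balls of finite measure cover the
    segment. *)
Lemma segment_measure_lty (a b : R) : 0 < a -> (L (segment a b) < +oo)%E.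
Proof.
move=> a0; have [_ fin _] := Lm.
have /choice [e eP] : forall x : R, exists e, 0 < x -> 0 < e /\ (L (ball x e) < +oo)%E.
  move=> x; have [/fin [e e0 h]|_] := boolP (0 < x); last by exists 1.
  by exists e.
have epos x : `[a, b]%classic x -> 0 < x.
  by rewrite /= in_itv/= => /andP[h _]; exact: lt_le_trans a0 h.
have := @segment_compact R a b; rewrite compact_cover.
move=> /(_ R `[a, b]%classic (fun x => ball x (e x))) [].
- by move=> x /= abx; apply: ball_open; exact: (eP x (epos x abx)).1.
- by move=> x abx; exists x => //; apply: ballxx; exact: (eP x (epos x abx)).1.
move=> I ID; have fI := finite_fset I; move: fI; set J := (X in cover X _) => fI cov.
have Jpos i : J i -> 0 < i by move=> /ID; rewrite inE; exact: epos.
apply: (@le_lt_trans _ _ (\sum_(i \in J) L (ball i (e i)))%E).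
  by apply: content_sub_fsum => // i _; exact: measurable_ball.
rewrite fsbig_finite//= big_seq; apply: lte_sum_pinfty => i iI; apply: (eP i _).2.
by apply: Jpos; move: iI; rewrite in_fset_set// inE.
Qed.

Let mulm (x : measurableTypeR R) : measurableTypeR R := m * x.

Let mmulm : measurable_fun setT mulm.
Proof. exact: measurable_funM. Qed.

(** Scale invariance, stated with images, says that L is preserved by x |-> m
    x. *)
Lemma scale_pushforward (A : set (measurableTypeR R)) : measurable A -> A `<=` D ->
  L (mulm @^-1` A) = L A.
Proof.
move=> mA AD; have [_ _ sc] := Lm.
have mpre : measurable (mulm @^-1` A) by rewrite -[X in measurable X]setTI; exact: mmulm.
rewrite sc//; last first.
  by move=> x /AD /=; rewrite /mulm !in_itv/= !andbT pmulr_rgt0.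
congr (L _); apply/seteqP; split => [_ [x h <-]//|x Ax].
exists (m^-1 * x); last by rewrite mulVKf// gt_eqF.
by rewrite /= /mulm mulVKf// gt_eqF.
Qed.

Lemma scale_integral (f : R -> R) : measurable_fun D f ->
  (forall x, 0 < x -> 0 <= f x) ->
  (\int[L]_(x in D) (f (m * x))%:E = \int[L]_(x in D) (f x)%:E)%E.
Proof.
move=> mf f0.
have preD : mulm @^-1` D = D.
  by apply/seteqP; split => x; rewrite /= /mulm !in_itv/= !andbT pmulr_rgt0.
rewrite -[RHS](@eq_measure_integral _ _ _ _ _ (pushforward L mulm)).
  have := @ge0_integral_pushforward _ _ _ _ _ mulm mmulm L D (fun x => (f x)%:E) mD.
  rewrite preD => ->//; first exact/measurable_EFinP.
  by move=> x; rewrite inE/= in_itv/= andbT => x0; rewrite lee_fin f0.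
by move=> A mA AD; exact: scale_pushforward.
Unshelve. all: exact: mmulm.
Qed.

Lemma segment_measure_pow k : L (segment (m ^+ k.+1) (m ^+ k)) = L (segment m 1%R).
Proof.
elim: k => [|k <-]; first by rewrite expr1 expr0.
rewrite -[LHS]scale_pushforward.

  congr (L _); apply/seteqP; split => x; rewrite /= /mulm/= !in_itv/= !exprS !ler_pM2l//.
  exact: measurable_itv.
move=> x /=; rewrite !in_itv/= andbT => /andP[h _]; exact: lt_le_trans (exprn_gt0 _ m0) h.
Qed.

Lemma segment_measure_invpow k : L (segment (m ^- k) (m ^- k.+1)) = L (segment m 1%R).
Proof.
have pos n : 0 < m ^- n by rewrite invr_gt0 exprn_gt0.
have mmul n : m * m ^- n.+1 = m ^- n by rewrite exprS invfM mulVKf ?gt_eqF// mulrA divff ?mul1r// gt_eqF.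
have step a b : 0 < a -> L (segment a b) = L (segment (m * a) (m * b)).
  move=> a0; rewrite -[RHS]scale_pushforward.
  + by congr (L _); apply/seteqP; split => x; rewrite /= /mulm/= !in_itv/= !ler_pM2l.
  + exact: measurable_itv.
  + move=> x /=; rewrite !in_itv/= andbT => /andP[h _]; apply: lt_le_trans h.
    exact: mulr_gt0.
elim: k => [|k <-]; rewrite step// ?mmul//.
by rewrite expr0 invr1 mulr1.
Qed.

Lemma expr_bracket (x : R) : 0 < x -> x <= 1 -> exists k, m ^+ k.+1 <= x <= m ^+ k.
Proof.
move=> x0 x1.
have ex : exists n, m ^+ n < x.
  have c : (fun n => m ^+ n) @ \oo --> (0 : R) by apply: cvg_expr; rewrite ger0_norm ?ltW.
  have /cvgrPdist_lt/(_ _ x0) [n _ h] := c.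
  exists n; have := h n (leqnn n); rewrite /= sub0r normrN ger0_norm// exprn_ge0//; exact: ltW.
case: (ex_minnP ex) => -[|k] h hk.
  by move: h; rewrite expr0 ltNge x1.
exists k; rewrite (ltW h) /= leNgt; apply/negP => /hk; by rewrite ltnn.
Qed.

Section weight.
Variable alpha : R.
Hypothesis alpha0 : alpha < 0.
Local Notation w := (fun x : R => 1 / (x `^ alpha)).

Lemma weightE (x : R) : 1 / (x `^ alpha) = x `^ (- alpha).
Proof. by rewrite powRN mul1r. Qed.

Lemma weight_ge0 (x : R) : 0 <= 1 / (x `^ alpha).
Proof. by rewrite weightE powR_ge0. Qed.

Lemma measurable_weight A : measurable_fun A (fun x : R => 1 / (x `^ alpha)).
Proof.
rewrite (_ : (fun x : R => _) = (fun x => x `^ (- alpha))).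
  by apply: measurable_funTS; exact: measurable_powR.
by apply/funext => x; rewrite weightE.
Qed.

(** Laplace transform of the measure x `^ (- alpha) L(dx). At a real point s
    the integral representing G s is its value at 1 - H s. *)
Definition weighted_laplace (c : R) : \bar R :=
  \int[L]_(x in D) (expR (- (c * x)) * (1 / (x `^ alpha)))%:E.

Lemma measurable_weighted_exp A (c : R) :
  measurable_fun A (fun x : R => expR (- (c * x)) * (1 / (x `^ alpha))).
Proof.
apply: measurable_funM; last exact: measurable_weight.
by under eq_fun do rewrite -mulNr; exact: measurable_expRZ.
Qed.

Lemma weighted_laplace_scale (c : R) :
  weighted_laplace (m * c) = ((m `^ alpha)%:E * weighted_laplace c)%E.
Proof.
rewrite /weighted_laplace -[in RHS](@scale_integral (fun x => expR (- (c * x)) * (1 / (x `^ alpha)))); last 2 first.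
- exact: measurable_weighted_exp.
- by move=> x _; rewrite mulr_ge0 ?expR_ge0 ?weight_ge0.
rewrite -ge0_integralZl//.
- apply: eq_integral => x; rewrite inE/= in_itv/= andbT => x0.
  rewrite -EFinM powRM ?(ltW m0) ?(ltW x0)// (_ : m * c * x = c * (m * x)); last by ring.
  by congr EFin; field; rewrite !gt_eqF// powR_gt0.
- apply/measurable_EFinP; apply: (@measurableT_comp _ _ _ _ _ _ (fun x => expR (- (c * x)) * (1 / (x `^ alpha)))).
    exact: measurable_weighted_exp.
  exact: measurable_funTS.
- by move=> x _; rewrite lee_fin mulr_ge0 ?expR_ge0 ?weight_ge0.
- by rewrite lee_fin powR_ge0.
Qed.

(** The segments [m ^+ k.+1, m ^+ k], k an integer of either sign, all have
    the same finite measure. Towards 0 the integrand is bounded by x `^ (-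
    alpha), which decays geometrically along them because alpha < 0; towards
    +oo the exponential makes it O(1 / x). *)
Lemma weighted_laplace_lty (c : R) : 0 < c -> (weighted_laplace c < +oo)%E.
Proof.
move=> c0.
have f0 x : 0 <= expR (- (c * x)) * (1 / (x `^ alpha)) by rewrite mulr_ge0 ?expR_ge0 ?weight_ge0.
have Kfin : (L (segment m 1%R) <= (fine (L (segment m 1%R)))%:E)%E.
  by rewrite fineK// ge0_fin_numE// segment_measure_lty.
rewrite /weighted_laplace (_ : D = (`]0, 1]%classic : set (measurableTypeR R)) `|` `]1, +oo[%classic); last first.
  by rewrite -(@itv_bndbnd_setU _ _ _ (BRight (1 : R)))// bnd_simp.
rewrite ge0_integral_setU//=; last 3 first.
- by apply/measurable_EFinP; exact: measurable_weighted_exp.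
- by move=> x _; rewrite lee_fin.
- apply/disj_setPS => x /= []; rewrite !in_itv/= andbT => /andP[_ a] b.
  by have := le_lt_trans a b; rewrite ltxx.
apply: lte_add_pinfty.
- apply: (@geometric_cover_integral_lty _ _ _ L _ _ (fun k => segment (m ^+ k.+1) (m ^+ k)) 1 (m `^ (- alpha)) (fine (L (segment m 1%R)))) => //.
  + exact: measurable_weighted_exp.
  + rewrite powR_ge0 /= -[X in _ < X](_ : 1 `^ (- alpha) = 1); last by rewrite powR1.
    apply: gt0_ltr_powR; rewrite ?oppr_gt0 ?nnegrE ?in_itv/= ?andbT ?ler01//.
    exact: ltW.
  + by move=> k; rewrite segment_measure_pow.
  + move=> x; rewrite /= in_itv/= => /andP[x0 x1].
    have [k /andP[a b]] := expr_bracket x0 x1; exists k.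
      by rewrite /= in_itv/= a b.
    rewrite weightE mul1r -[leRHS]mul1r ler_pM ?expR_ge0 ?powR_ge0//.
      by rewrite expR_le1 oppr_le0 mulr_ge0 ?ltW.
    rewrite -powR_mulrn ?powR_ge0// -powRrM mulrC powRrM powR_mulrn ?(ltW m0)//.
    by apply: ge0_ler_powR_base => //; rewrite ?oppr_ge0 ltW.
- have [C C0 hC] := powR_expRN_bounded (- alpha) c0.
  apply: (@geometric_cover_integral_lty _ _ _ L _ _ (fun k => segment (m ^- k) (m ^- k.+1)) C m (fine (L (segment m 1%R)))) => //.
  + exact: measurable_weighted_exp.
  + by rewrite m1 ltW.
  + by move=> k; rewrite segment_measure_invpow.
  + move=> x; rewrite /= in_itv/= andbT => x1; have x0 : 0 < x by lra.
    have xi0 : 0 < x^-1 by rewrite invr_gt0.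
    have xi1 : x^-1 <= 1 by rewrite invf_le1// ltW.
    have [k /andP[a b]] := expr_bracket xi0 xi1; exists k.
      rewrite /= in_itv/= -[x]invrK !lef_pV2 ?posrE ?exprn_gt0//.
      by rewrite a b.
    have := hC x (ltW x1); rewrite weightE [expR _ * _]mulrC => h.
    apply: (@le_trans _ _ (C * x^-1)); last by rewrite ler_wpM2l.
    by rewrite ler_pdivlMr//; apply: le_trans h; rewrite [leRHS]mulrC.
Qed.

End weight.
End scale_invariant.

(** * Mixtures of compound Poisson laws *)

Section compound_poisson_mixture.
Context {R : realType}.
Local Open Scope complex_scope.
Import ComplexField.Normc.
Local Notation Re := complex.Re.
Local Notation Im := complex.Im.
Local Notation D := (`]0, +oo[%classic : set (measurableTypeR R)).
Variables (m : R) (L : {measure set (measurableTypeR R) -> \bar R}).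
Hypotheses (m0 : 0 < m) (m1 : m < 1) (Lm : scale_invariant_measure m L).
Variables (alpha : R) (nu_min : probability nat R).
Hypotheses (alpha0 : alpha < 0) (mass0 : nu_min [set 0%N] = 0%E)
  (pgf_lt1 : forall s : R, 0 <= s < 1 -> 0 < 1 - pgf nu_min s).
Local Notation H := (pgf nu_min).
Local Notation p := (fun n => fine (nu_min [set n])).
Local Notation c := (fun n x => compound_poisson p n x * (1 / (x `^ alpha))).

Let mD : measurable D. Proof. exact: measurable_itv. Qed.

Let p_ge0 n : 0 <= p n. Proof. exact: fine_ge0. Qed.

Let p_sum : series p @ \oo --> (1 : R).
Proof.
have o : 0 <= (1 : R) <= 1 by rewrite ler01 lexx.
have [_ _ + _] := has_csum_pgf nu_min o.
by rewrite pgf1; under [X in series X]eq_fun do rewrite expr1n mulr1/=.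
Qed.

Let p0 : p 0%N = 0. Proof. exact: (congr1 fine mass0). Qed.

Let c_ge0 n x : D x -> 0 <= c n x.
Proof.
rewrite /= in_itv/= andbT => x0.
by rewrite mulr_ge0 ?weight_ge0//; apply: compound_poisson_ge0 => //; exact: ltW.
Qed.

Let mc n : measurable_fun D (c n).
Proof.
by apply: measurable_funM; [apply: measurable_funTS; exact: measurable_compound_poisson|exact: measurable_weight].
Qed.

Lemma compound_poisson_pgf (x r : R) : 0 <= x -> 0 <= r <= 1 ->
  series (fun n => compound_poisson p n x * r ^+ n) @ \oo --> expR (- ((1 - H r) * x)).
Proof.
move=> x0 /[dup] r01 /andP[r0 r1].
have z1 : normc r%:C <= 1 by rewrite normc_real ger0_norm.
have [+ _] := compound_poisson_genfun p_ge0 p_sum p0 x0 z1 (has_csum_pgf nu_min r01).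
rewrite -(rmorphB (real_complex R)) -(rmorphM (real_complex R)) cexp_real /= -mulNr opprB.
by under [X in series X]eq_fun do rewrite -rmorphXn.
Qed.

Let c_series (x r : R) : 0 <= x -> 0 <= r <= 1 ->
  series (fun n => c n x * r ^+ n) @ \oo --> expR (- ((1 - H r) * x)) * (1 / (x `^ alpha)).
Proof.
move=> x0 r01; rewrite (_ : series _ = (fun N => series (fun n => compound_poisson p n x * r ^+ n) N * (1 / (x `^ alpha)))).
  by apply: cvgMl; exact: compound_poisson_pgf.
by apply/funext => N; rewrite /series/= mulr_suml; apply: eq_bigr => k _; rewrite mulrAC.
Qed.

Let c_eseries (x r : R) : 0 <= x -> 0 <= r <= 1 ->
  (\sum_(0 <= n <oo) (c n x * r ^+ n)%:E = (expR (- ((1 - H r) * x)) * (1 / (x `^ alpha)))%:E)%E.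
Proof.
move=> x0 r01; apply/cvg_lim => //; under eq_fun do rewrite sumEFin.
by apply: cvg_EFin; [exact: nearW|exact: c_series].
Qed.

Lemma mixture_tonelli (r : R) : 0 <= r <= 1 ->
  (\sum_(0 <= n <oo) (\int[L]_(x in D) (c n x)%:E) * (r ^+ n)%:E = weighted_laplace L alpha (1 - H r))%E.
Proof.
move=> r01; have rn n : 0 <= r ^+ n by have /andP[] := expr_itv01 n r01.
transitivity (\sum_(0 <= n <oo) (\int[L]_(x in D) (c n x * r ^+ n)%:E))%E.
  apply: eq_eseriesr => n _; under [RHS]eq_integral do rewrite EFinM.
  rewrite ge0_integralZr ?lee_fin//; first exact/measurable_EFinP.
  by move=> x Dx; rewrite lee_fin c_ge0.
rewrite -integral_nneseries//; last 2 first.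
- by move=> n; apply/measurable_EFinP; apply: measurable_funM.
- by move=> n x Dx; rewrite lee_fin mulr_ge0// c_ge0.
apply: eq_integral => x; rewrite inE/= in_itv/= andbT => x0; apply: c_eseries => //; exact: ltW.
Qed.

(** A single mass is at most 2 ^+ n times the generating function at 1/2. *)
Lemma mixture_mass_lty n : (\int[L]_(x in D) (c n x)%:E < +oo)%E.
Proof.
have h : 0 <= (2^-1 : R) <= 1 by lra.
have hn : 0 < 2^-1 ^+ n :> R by rewrite exprn_gt0// invr_gt0.
have ige0 k : (0 <= \int[L]_(x in D) (c k x)%:E)%E.
  by apply: integral_ge0 => x Dx; rewrite lee_fin c_ge0.
have : ((\int[L]_(x in D) (c n x)%:E) * (2^-1 ^+ n)%:E < +oo)%E.
  apply: (@le_lt_trans _ _ (weighted_laplace L alpha (1 - H 2^-1))); last first.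
    by apply: (weighted_laplace_lty m0 m1 Lm alpha0); apply: pgf_lt1; lra.
  rewrite -mixture_tonelli//.
  apply: le_trans (@nneseries_lim_ge R _ xpredT 0 n.+1 _); last first.
    by move=> k _ _; rewrite mule_ge0// lee_fin exprn_ge0//; lra.
  rewrite big_nat_recr//= leeDr// sume_ge0// => k _; rewrite mule_ge0// lee_fin exprn_ge0//; lra.
move: (ige0 n); case: (\int[L]_(x in D) (c n x)%:E)%E => [r||]//= _; first by move=> _; rewrite ltry.
by rewrite gt0_mulye ?lte_fin.
Qed.

Lemma mixture_exists : exists nu : {measure set nat -> \bar R},
  forall n, nu [set n] = (\int[L]_(x in D) (c n x)%:E)%E.
Proof.
have i0 n : (0 <= \int[L]_(x in D) (c n x)%:E)%E.
  by apply: integral_ge0 => x Dx; rewrite lee_fin c_ge0.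
have [nu nuE] := nat_measure_exists (fun n => fine_ge0 (i0 n)).
by exists nu => n; rewrite nuE fineK// ge0_fin_numE// mixture_mass_lty.
Qed.

Variable nu : {measure set nat -> \bar R}.
Hypothesis nuE : forall n, nu [set n] = (\int[L]_(x in D) (c n x)%:E)%E.

Lemma mixture_locally_finite : locally_finite_nat nu.
Proof. by move=> n; rewrite nuE mixture_mass_lty. Qed.

Lemma mixture_pgf (r : R) : 0 <= r <= 1 ->
  (\int[nu]_k (r ^+ k)%:E = weighted_laplace L alpha (1 - H r))%E.
Proof.
move=> r01; rewrite -mixture_tonelli// ge0_integral_nat => [|k]; last first.
  by rewrite lee_fin; have /andP[] := expr_itv01 k r01.
by apply: eq_eseriesr => k _; rewrite nuE.
Qed.

Lemma mixture_pgf_lty (r : R) : 0 <= r < 1 -> (\int[nu]_k (r ^+ k)%:E < +oo)%E.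
Proof.
move=> /[dup] r1 /andP[r0 rl]; rewrite mixture_pgf ?r0 ?ltW//.
by apply: (weighted_laplace_lty m0 m1 Lm alpha0); exact: pgf_lt1.
Qed.

(** The point |z| of [0, 1) provides the domination: there the series has
    nonnegative terms, and its sum is a finite value of weighted_laplace. *)
Lemma mixture_representation : has_representation nu_min alpha nu L.
Proof.
move=> z; rewrite -[1]/(1%:C) normc_ltE => z1 integrand.
have z0 := normc_ge0 z.
have r01 : 0 <= normc z <= 1 by rewrite z0 ltW.
have ph : has_csum (fun n => (p n)%:C * z ^+ n) (genfun nu_min z).
  apply: (@has_csum_genfun R nu_min 1) => //; last exact: ltW.
  by under [X in series X]eq_fun do rewrite expr1n mulr1; exact: cvgP p_sum.
have ca n : (\int[L]_(x in D) (c n x)%:E = (fine (nu [set n]))%:E)%E.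
  by rewrite nuE fineK// ge0_fin_numE ?mixture_mass_lty// integral_ge0// => x Dx; rewrite lee_fin c_ge0.
pose S' x := expR (- ((1 - H (normc z)) * x)) * (1 / (x `^ alpha)).
have cS' x : D x -> series (fun n => c n x * normc z ^+ n) @ \oo --> S' x.
  by rewrite /= in_itv/= andbT => x0; apply: c_series => //; exact: ltW.
have iS' : (\int[L]_(x in D) (S' x)%:E < +oo)%E.
  by apply: (weighted_laplace_lty m0 m1 Lm alpha0); apply: pgf_lt1; rewrite z0.
have fr n : `|Re (z ^+ n)| <= normc z ^+ n by rewrite -normcX; exact: Re_le_normc.
have fi n : `|Im (z ^+ n)| <= normc z ^+ n by rewrite -normcX; exact: Im_le_normc.
have scale x (f : nat -> R) (l : R) : series (fun n => compound_poisson p n x * f n) @ \oo --> l ->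
    series (fun n => c n x * f n) @ \oo --> (1 / (x `^ alpha)) * l.
  move=> h; rewrite (_ : series _ = (fun N => (1 / (x `^ alpha)) * series (fun n => compound_poisson p n x * f n) N)).
    exact: cvgMr.
  by apply/funext => N; rewrite /series/= mulr_sumr; apply: eq_bigr => k _; ring.
have cr x : D x -> series (fun n => c n x * Re (z ^+ n)) @ \oo --> Re (integrand x).
  move=> Dx; have x0 : 0 < x by move: Dx; rewrite /= in_itv/= andbT.
  have [h _] := compound_poisson_genfun p_ge0 p_sum p0 (ltW x0) (ltW z1) ph.
  by rewrite /integrand [cexp _ * _]mulrC ReMl; exact: scale.
have ci x : D x -> series (fun n => c n x * Im (z ^+ n)) @ \oo --> Im (integrand x).
  move=> Dx; have x0 : 0 < x by move: Dx; rewrite /= in_itv/= andbT.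
  have [_ h] := compound_poisson_genfun p_ge0 p_sum p0 (ltW x0) (ltW z1) ph.
  by rewrite /integrand [cexp _ * _]mulrC ImMl; exact: scale.
have [||cv e] := @genfunP R nu z (cintegral L D integrand).
- exact: (@mixture_cvg_series _ _ R L D mD c _ mc c_ge0 ca _ _ _ S' fr cr cS' iS').
- exact: (@mixture_cvg_series _ _ R L D mD c _ mc c_ge0 ca _ _ _ S' fi ci cS' iS').
split => //; split.
- exact: (@mixture_integrable _ _ R L D mD c mc c_ge0 _ _ _ S' fr cr cS' iS').
- exact: (@mixture_integrable _ _ R L D mD c mc c_ge0 _ _ _ S' fi ci cS' iS').
Qed.

Lemma mixture_radius : (1%:E <= convergence_radius nu)%E.
Proof.
apply/lee_addgt0Pr => e e0; rewrite -leeBlDr//.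
have [e1|e1] := leP 1 e.
  apply: (@le_trans _ _ 0%:E); first by rewrite -EFinB lee_fin subr_le0.
  apply: ereal_sup_ubound; exists 0 => //; split => //.
  by rewrite -ge0_integral_nat ?mixture_pgf_lty ?lexx ?ltr01// => k; rewrite lee_fin exprn_ge0.
rewrite -EFinB; apply: ereal_sup_ubound; exists (1 - e) => //; split; first by lra.
rewrite -ge0_integral_nat ?mixture_pgf_lty//; first by apply/andP; split; lra.
by move=> k; rewrite lee_fin exprn_ge0//; lra.
Qed.

Variable xi : probability nat R.
Hypothesis schroeder : forall s : R, 0 <= s < 1 -> 1 - H (pgf xi s) = m * (1 - H s).

(** Through Schroeder's equation, G (F s) = m `^ alpha * G s is the scaling
    relation of weighted_laplace. *)
Lemma mixture_invariant : true_invariant xi (m `^ alpha) nu.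
Proof.
apply: genfun_invariant; first exact: powR_ge0.
- exact: mixture_locally_finite.
- by move=> s /andP[s0 s1]; apply: mixture_pgf_lty; rewrite s1 ltW.
move=> s /andP[s0 s1]; have s01 : 0 <= s <= 1 by rewrite !ltW.
by rewrite !mixture_pgf ?pgf_itv01// schroeder ?s1 ?(ltW s0)// weighted_laplace_scale.
Qed.

End compound_poisson_mixture.

(** * Invariant measures as Laplace transforms *)

Section quantile.
Context {R : realType}.
Local Notation leb := (@lebesgue_measure R).
Variables (w : nat -> R) (r : R).
Hypotheses (w0 : forall i, 0 <= w i) (r01 : 0 <= r <= 1).

(** This is exp (- Q), where Q is the quantile function of the measure with
    mass w i at the point - i ln r: the value r ^+ i is taken on an interval
    of length w i, and past the total mass Q is infinite. *)
Definition quantile (v : R) : R :=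
  if pselect (exists i, v <= series w i.+1) is left ex then r ^+ ex_minn ex else 0.

Let nd_series i j : (i <= j)%N -> series w i <= series w j.
Proof.
move: i j; apply/nondecreasing_seqP => n; rewrite seriesSr lerDl; exact: w0.
Qed.

Lemma quantileE i v : series w i < v <= series w i.+1 -> quantile v = r ^+ i.
Proof.
move=> /andP[iv vi]; rewrite /quantile; case: pselect => [ex|[]]; last by exists i.
case: ex_minnP => j vj jmin; congr (_ ^+ _); apply/eqP.
rewrite eqn_leq jmin//= leqNgt; apply/negP => ji.
by have := lt_le_trans iv (le_trans vj (nd_series ji)); rewrite ltxx.
Qed.

Lemma quantile_itv01 v : 0 <= quantile v <= 1.
Proof.
rewrite /quantile; case: pselect => [ex|_]; last by rewrite lexx ler01.
exact: expr_itv01.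
Qed.

Lemma nonincreasing_quantile : {homo quantile : x y /~ x <= y}.
Proof.
move=> y x xy; rewrite {1}/quantile; case: pselect => [ex|_]; last first.
  by have /andP[] := quantile_itv01 x.
rewrite /quantile; case: pselect => [ex'|[]]; last first.
  by have [i iP] := ex; exists i; exact: le_trans iP.
case: ex_minnP => i yi _; case: ex_minnP => j _ jmin.
have /andP[r0 r1] := r01.
by apply: ler_wiXn2l => //; apply: jmin; exact: le_trans yi.
Qed.

Let band i : set R := `]series w i, series w i.+1]%classic.

Let quantile_band v : 0 < v -> quantile v != 0 -> exists i, band i v.
Proof.
move=> v0; rewrite /quantile; case: pselect => [ex _|_]; last by rewrite eqxx.
case: (ex_minnP ex) => i vi imin; exists i; rewrite /band/= in_itv/= vi andbT.
case: i vi imin => [|i] vi imin; first by rewrite /series/= big_geq.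
by rewrite ltNge; apply/negP => /imin; rewrite ltnn.
Qed.

Let band_disjoint : trivIset setT band.
Proof.
apply: ltn_trivIset => i j ij; apply/seteqP; split => // x [].
rewrite /band/= !in_itv/= => /andP[_ b] /andP[a _].
by have := lt_le_trans a (le_trans b (nd_series ij)); rewrite ltxx.
Qed.

Lemma integral_quantile (theta : R) : 0 < theta ->
  (\int[leb]_(v in `]0%R, +oo[) (quantile v `^ theta)%:E =
   \sum_(0 <= i <oo) (w i * (r ^+ i) `^ theta)%:E)%E.
Proof.
move=> t0.
have mband i : measurable (band i) by exact: measurable_itv.
have bandD i x : band i x -> 0 < x.
  rewrite /band/= in_itv/= => /andP[+ _]; apply: le_lt_trans.
  by rewrite -[0](_ : series w 0 = 0) ?nd_series// /series/= big_geq.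
have mq : measurable_fun setT (fun v => (quantile v `^ theta)%:E).
  apply/measurable_EFinP.
  apply: (measurableT_comp (measurable_powR _)).
  by apply: nonincreasing_measurable => // x y; exact: nonincreasing_quantile.
transitivity (\int[leb]_(v in \bigcup_i band i) (quantile v `^ theta)%:E)%E.
  rewrite [LHS]integral_mkcond [RHS]integral_mkcond; apply: eq_integral => v _.
  rewrite !patchE; case: ifPn; case: ifPn => //.
  - rewrite notin_setE inE/= in_itv/= andbT => nb v0.
    have [->|q0] := eqVneq (quantile v) 0; first by rewrite powR0// gt_eqF.
    by have [i iv] := quantile_band v0 q0; case: nb; exists i.
  - rewrite inE notin_setE/= in_itv/= andbT => -[i _ /bandD ->]; by [].
rewrite ge0_integral_bigcup//; last 2 first.
- exact: measurable_funTS.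
- by move=> x _; rewrite lee_fin powR_ge0.
apply: eq_eseriesr => i _.
rewrite (eq_integral (cst ((r ^+ i) `^ theta)%:E)); last first.
  by move=> v; rewrite inE /band/= in_itv/= => /quantileE ->.
rewrite integral_cst; last exact: measurable_itv.
rewrite mulrC EFinM; congr (_ * _)%E.
rewrite /band /= lebesgue_measure_itv/= lte_fin seriesSr.
have [wi|] := ltP 0 (w i); first by rewrite ltrDl wi -EFinD addrAC subrr add0r.
rewrite le_eqVlt ltNge w0 orbF => /eqP wi; by rewrite wi addr0 ltxx.
Qed.

(** Markov's inequality for a nonincreasing function. *)
Lemma quantile_le_integral (e v : R) : 0 <= e -> 0 < v ->
  ((v * quantile v `^ e)%:E <= \int[leb]_(v in `]0%R, +oo[) (quantile v `^ e)%:E)%E.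
Proof.
move=> e0 v0.
have mq : measurable_fun setT (fun v => (quantile v `^ e)%:E).
  apply/measurable_EFinP.
  apply: (measurableT_comp (measurable_powR _)).
  by apply: nonincreasing_measurable => // x y; exact: nonincreasing_quantile.
apply: (@le_trans _ _ (\int[leb]_(x in `]0%R, v]) (quantile x `^ e)%:E)%E).
  apply: (@le_trans _ _ (\int[leb]_(x in `]0%R, v]) (quantile v `^ e)%:E)%E).
    rewrite integral_cst//.
    by rewrite /= lebesgue_measure_itv/= lte_fin v0 sube0 -EFinM mulrC.
  apply: ge0_le_integral => //.
  - by move=> x _; rewrite lee_fin powR_ge0.
  - exact: measurable_funTS.
  - move=> x; rewrite /= in_itv/= => /andP[x0 xv]; rewrite lee_fin.
    apply: ge0_ler_powR_base => //; last exact: nonincreasing_quantile.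
    by have /andP[] := quantile_itv01 v.
apply: ge0_subset_integral => //.
- exact: measurable_funTS.
- by move=> x _; rewrite lee_fin powR_ge0.
- by move=> x; rewrite /= !in_itv/= => /andP[-> _].
Qed.

End quantile.

Section invariant_measure.
Context {R : realType}.
Variables (xi : probability nat R) (m : R).
Hypotheses (xi_mean : (\int[xi]_k (k%:R : R)%:E)%E = m%:E) (m0 : 0 < m) (m1 : m < 1).
Variables (d : measure_display) (T : measurableType d) (P : probability T R)
  (Z : nat -> {RV P >-> nat}) (nu_min : probability nat R).
Hypotheses (Z_gw : galton_watson_from xi Z 1%N) (nu_minP : yaglom_limit Z nu_min).
Variables (lambda : R) (nu : {measure set nat -> \bar R}).
Hypotheses (lambda0 : 0 < lambda) (nufin : locally_finite_nat nu)
  (inv : true_invariant xi lambda nu).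
Local Notation F := (pgf xi).
Local Notation H := (pgf nu_min).
Local Notation G s := (\int[nu]_i (s ^+ i)%:E)%E.
Local Notation leb := (@lebesgue_measure R).
Local Notation V n s := (log_survival xi n s).

Lemma iter_pgf_itv01 (s : R) n : 0 <= s <= 1 -> 0 <= iter n F s <= 1.
Proof. by move=> s01; elim: n => //= n; exact: pgf_itv01. Qed.

Lemma invariant_genfun_iter n (s : R) : 0 <= s <= 1 ->
  (G (iter n F s) = (lambda ^+ n)%:E * G s)%E.
Proof.
move=> s01; elim: n => [|n IH]; first by rewrite mul1e.
rewrite [LHS](invariant_genfun (iter_pgf_itv01 n s01) (ltW lambda0) inv).
by rewrite IH muleA -EFinM -exprS.
Qed.

(** The iterates F_n 0 tend to 1, and G (F_n 0) = lambda ^+ n * nu {0} is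
    finite. *)
Lemma invariant_genfun_lty (s : R) : 0 <= s < 1 -> (G s < +oo)%E.
Proof.
move=> /andP[s0 s1]; have z1 : 0 <= (0 : R) < 1 by rewrite lexx ltr01.
have z01 : 0 <= (0 : R) <= 1 by rewrite lexx ler01.
have [n sn] : exists n, s <= iter n F 0.
  have := cvg_iter_pgf xi_mean m0 m1 z1 => /cvgrPdist_le.
  have d0 : 0 < 1 - s by rewrite subr_gt0.
  move=> /(_ _ d0)[n _ /(_ n (leqnn n))] /= h; exists n.
  by have := le_trans (ler_norm _) h; rewrite lerD2l lerN2.
apply: (@le_lt_trans _ _ (G (iter n F 0))).
  apply: ge0_le_integral => //.
  - by move=> k _; rewrite lee_fin exprn_ge0.
  - by move=> k _; rewrite lee_fin lerXn2r ?nnegrE// (le_trans s0).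
rewrite invariant_genfun_iter// (eq_integral (fun k => (\1_[set 0%N] k)%:E)).
  rewrite integral_indic// setIT lte_mul_pinfty ?nufin//.
  by rewrite lee_fin exprn_ge0// ltW.
by case=> [|k] _; rewrite expr0n indicE; [rewrite mem_set|rewrite memNset].
Qed.

Lemma powR_iter_pgf0 n k (s : R) i : 0 <= s < 1 ->
  (iter n.+1 F 0 ^+ i) `^ (V k s / V n 0) = iter k.+1 F s ^+ i.
Proof.
move=> s1; have z1 : 0 <= (0 : R) < 1 by rewrite lexx ltr01.
have b0 := iter_pgf_gt0 xi_mean m0 m1 n z1.
have bs := iter_pgf_gt0 xi_mean m0 m1 k s1.
have Vn := log_survival_gt0 xi_mean m0 m1 n z1.
rewrite -powR_mulrn ?(ltW b0)// -powRrM mulrC powRrM powR_mulrn ?powR_ge0//.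
congr (_ ^+ _); rewrite /powR (gt_eqF b0).
rewrite (_ : _ * ln _ = - V k s); last by rewrite /log_survival; field; rewrite -oppr_eq0 gt_eqF.
by rewrite opprK lnK.
Qed.

(** The function exp (- Q) of the measure with mass lambda ^- n.+1 * nu {i} at
    the point i * log_survival n 0. *)
Definition rescaled_quantile n : R -> R :=
  quantile (fun i => lambda ^- n.+1 * fine (nu [set i])) (iter n.+1 F 0).

Let w_ge0 n i : 0 <= lambda ^- n.+1 * fine (nu [set i]).
Proof. by rewrite mulr_ge0 ?fine_ge0// invr_ge0 exprn_ge0// ltW. Qed.

Let r01 n : 0 <= iter n F (0 : R) <= 1.
Proof. by apply: iter_pgf_itv01; rewrite lexx ler01. Qed.

(** The integral is lambda ^- (n + j).+1 * G (F_(n+1) s), and invariance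
    evaluates G (F_(n+1) s) as lambda ^+ n.+1 * G s. *)
Lemma integral_rescaled_quantile n j (s : R) : 0 <= s < 1 ->
  (\int[leb]_(v in `]0%R, +oo[) (rescaled_quantile (n + j) v `^ (V n s / V (n + j) 0))%:E
   = (lambda ^- j)%:E * G s)%E.
Proof.
move=> /[dup] s1 /andP[s0 sl]; have z1 : 0 <= (0 : R) < 1 by rewrite lexx ltr01.
have s01 : 0 <= s <= 1 by rewrite s0 ltW.
rewrite /rescaled_quantile integral_quantile//; last first.
  by rewrite divr_gt0// (log_survival_gt0 xi_mean m0 m1).
have -> : ((lambda ^- j)%:E * G s = (lambda ^- (n + j).+1)%:E * G (iter n.+1 F s))%E.
  rewrite invariant_genfun_iter// muleA -EFinM; congr (_%:E * _)%E.
  by rewrite -addSn exprD; field; rewrite !expf_neq0// gt_eqF.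
rewrite ge0_integral_nat; last first.
  by move=> k; rewrite lee_fin exprn_ge0//; have /andP[] := iter_pgf_itv01 n.+1 s01.
rewrite -nneseriesZl; last first.
  by move=> i _; rewrite mule_ge0// lee_fin exprn_ge0//; have /andP[] := iter_pgf_itv01 n.+1 s01.
apply: eq_eseriesr => i _; rewrite powR_iter_pgf0// !EFinM -muleA fineK//.
by rewrite ge0_fin_numE// nufin.
Qed.

(** For an s with 1 - H s < e, the exponents log_survival n s / log_survival n
    0 are eventually below e, while the integrals with these exponents all
    equal G s. *)
Lemma rescaled_quantile_tight (e : R) : 0 < e ->
  exists C : R, exists N : nat, forall n, (N <= n)%N ->
     forall v, 0 < v -> v * rescaled_quantile n v `^ e <= C.
Proof.
move=> e0; pose t := Num.min (e / 2) 1.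
have t01 : 0 < t <= 1 by rewrite /t lt_min ge_min lexx orbT divr_gt0//= ltr01.
have te : t < e by rewrite /t gt_min ltr_pdivrMr// mulr_natr mulr2n ltrDl e0.
have [s s1 sE] := pgf_onto (yaglom_mass0 nu_minP) t01.
have z1 : 0 <= (0 : R) < 1 by rewrite lexx ltr01.
have := cvg_log_survival_ratio (j := 0%N) xi_mean m0 m1 Z_gw nu_minP s1.
rewrite expr0 divr1 sE => /cvgr_lt/(_ _ te)[N _ NP].
exists (fine (G s)), N => n Nn v v0.
have /= := NP n Nn; rewrite addn0 => le.
have th0 : 0 < V n s / V n 0 by rewrite divr_gt0// (log_survival_gt0 xi_mean m0 m1).
have e01 := @quantile_itv01 R (fun i => lambda ^- n.+1 * fine (nu [set i])) _ (r01 n.+1) v.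
apply: (@le_trans _ _ (v * rescaled_quantile n v `^ (V n s / V n 0))).
  by rewrite ler_pM2l//; apply: ler_powR_exp => //; exact: ltW.
rewrite -lee_fin fineK; last first.
  rewrite ge0_fin_numE ?invariant_genfun_lty// integral_ge0// => i _.
  by rewrite lee_fin exprn_ge0//; have /andP[] := s1.
have -> : (G s = (lambda ^- 0)%:E * G s)%E by rewrite expr0 invr1 mul1e.
rewrite -(integral_rescaled_quantile n 0 s1) addn0.
by apply: quantile_le_integral => //; exact: ltW.
Qed.

(** Along the subsequence given by compactness, the exponents log_survival (n
    - j) s / log_survival n 0 tend to (1 - H s) / m ^+ j and the integrals
    stay equal to lambda ^- j * G s. *)
Lemma invariant_laplace : exists M : {measure set (measurableTypeR R) -> \bar R},
  forall (s : R) j, 0 <= s < 1 ->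
    (\int[M]_(x in `[0%R, +oo[) (expR (- ((1 - H s) / m ^+ j) * x))%:E
     = (lambda ^- j)%:E * G s)%E.
Proof.
have [|||M [n_ [nk MP]]] := @laplace_compactness R rescaled_quantile.
- by move=> n; exact: nonincreasing_quantile.
- by move=> n x; exact: quantile_itv01.
- exact: rescaled_quantile_tight.
exists M => s j s1.
have t0 : 0 < (1 - H s) / m ^+ j.
  by rewrite divr_gt0 ?exprn_gt0// (yaglom_pgf_lt1 nu_minP).
pose t_ k := V (n_ k - j)%N s / V (n_ k - j + j)%N 0.
have n_oo : (fun k => (n_ k - j)%N) @ \oo --> \oo.
  apply/cvgnyPge => A; near=> k.
  have h : (A + j <= k)%N by near: k; exact: nbhs_infty_ge.
  by rewrite -(addnK j A) leq_sub2r// (leq_trans h).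
have ct : t_ @ \oo --> (1 - H s) / m ^+ j.
  exact: (cvg_comp _ _ n_oo (cvg_log_survival_ratio (j := j) xi_mean m0 m1 Z_gw nu_minP s1)).
have h := MP t_ _ t0 ct.
apply: (cvg_unique (@ereal_hausdorff R) h).
apply: cvg_near_cst; near=> k.
have jk : (j <= n_ k)%N by apply: leq_trans (nk k); near: k; exact: nbhs_infty_ge.
have := integral_rescaled_quantile (n_ k - j) j s1.
by rewrite /t_ subnK.
Unshelve. all: by end_near. Qed.

End invariant_measure.

(** * Homogeneous Laplace transforms *)

Lemma mule_solve (R : realType) (k l : R) (x y : \bar R) :
  l != 0 -> (k%:E * x = l%:E * y)%E -> y = ((l^-1 * k)%:E * x)%E.
Proof. by move=> l0 kl; rewrite EFinM -muleA kl muleA -EFinM mulVf// mul1e. Qed.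

Lemma le0_ler_powR_base (R : realType) (r x y : R) :
  r <= 0 -> 0 < x -> x <= y -> y `^ r <= x `^ r.
Proof.
move=> r0 x0 xy; rewrite -[r]opprK !(powRN _ (- r)).
rewrite lef_pV2 ?posrE ?powR_gt0//; last exact: lt_le_trans xy.
by apply: ge0_ler_powR_base; rewrite ?oppr_ge0// ltW.
Qed.

Section homogeneous_laplace.
Context {R : realType}.
Local Notation D := (`]0, +oo[%classic : set (measurableTypeR R)).
Local Notation D0 := (`[0, +oo[%classic : set (measurableTypeR R)).
Variables (m alpha : R).
Hypotheses (m0 : 0 < m) (m1 : m < 1) (alpha0 : alpha < 0).
Variable M : {measure set (measurableTypeR R) -> \bar R}.
Local Notation phi t := (\int[M]_(x in D0) (expR (- t * x))%:E)%E.
Hypotheses (phi_lty : forall t, 0 < t -> (phi t < +oo)%E)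
  (phi_scale : forall t, 0 < t -> (phi (m * t)%R = (m `^ alpha)%:E * phi t)%E).

Let mD : measurable D. Proof. exact: measurable_itv. Qed.
Let mD0 : measurable D0. Proof. exact: measurable_itv. Qed.

Let lambda_gt1 : 1 < m `^ alpha.
Proof.
rewrite -[alpha]opprK powRN invf_gt1 ?powR_gt0//.
rewrite -[X in _ < X](_ : 1 `^ (- alpha) = 1); last by rewrite powR1.
apply: gt0_ltr_powR; rewrite ?oppr_gt0 ?nnegrE ?ler01//; exact: ltW.
Qed.

Let phi_pow j : phi (m ^- j) = (((m `^ alpha) ^- j)%:E * phi 1)%E.
Proof.
have l0 : m `^ alpha != 0 by rewrite gt_eqF// powR_gt0.
elim: j => [|j IH]; first by rewrite !expr0 !invr1 mul1e.
have t0 : 0 < m ^- j.+1 by rewrite invr_gt0 exprn_gt0.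
have e : m * m ^- j.+1 = m ^- j by rewrite exprS invfM mulrA divff ?mul1r// gt_eqF.
have := phi_scale t0; rewrite e IH => h.
have -> : (m `^ alpha) ^- j.+1 = (m `^ alpha)^-1 * (m `^ alpha) ^- j by rewrite exprS invfM.
exact: mule_solve h.
Qed.

Let geometric_bound (a : R) (b : \bar R) : (0 <= b)%E ->
  (forall j, (b <= ((m `^ alpha) ^- j)%:E * a%:E)%E) -> b = 0%E.
Proof.
move=> b0 le; apply/eqP; rewrite eq_le b0 andbT.
have c : (fun j => (m `^ alpha) ^- j * a) @ \oo --> (0 : R).
  rewrite -(mul0r a); apply: cvgMl.
  under eq_fun do rewrite -exprVn.
  by apply: cvg_expr; rewrite ger0_norm ?invr_ge0 ?powR_ge0// invf_lt1 ?powR_gt0.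
have -> : 0%E = (limn (fun j => (m `^ alpha) ^- j * a))%:E.
  by rewrite (cvg_lim (@Rhausdorff R) c).
rewrite -EFin_lim; last exact: cvgP c.
apply: lime_ge; first by apply/cvg_ex; exists 0%:E; apply: cvg_EFin; [exact: nearW|exact: c].
by apply: nearW => j /=; rewrite EFinM.
Qed.

(** The mass at 0 is at most phi (m ^- j), which is phi 1 divided by the j-th
    power of m `^ alpha > 1. *)
Lemma homogeneous_mass0 : M [set 0] = 0%E.
Proof.
have m00 : measurable ([set 0] : set (measurableTypeR R)) by exact: measurable_set1.
have le j : (M [set 0%R] <= ((m `^ alpha) ^- j)%:E * phi 1)%E.
  rewrite -phi_pow; apply: (@le_trans _ _ (\int[M]_(x in [set 0%R]) (expR (- m ^- j * x))%:E)%E).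
    rewrite (eq_integral (cst 1%E)); first by rewrite integral_cst// mul1e.
    by move=> x; rewrite inE/= => ->; rewrite mulr0 expR0.
  apply: ge0_subset_integral => //.
  - apply/measurable_EFinP; exact: measurable_expRZ.
  - by move=> x /= ->; rewrite in_itv/= lexx.
have phi1 : phi 1 = (fine (phi 1))%:E.
  by rewrite fineK// ge0_fin_numE ?phi_lty// integral_ge0// => x _; rewrite lee_fin expR_ge0.
rewrite phi1 in le; by apply: geometric_bound le; exact: measure_ge0.
Qed.

Let mulm (x : measurableTypeR R) : measurableTypeR R := m * x.
Let mmulm : measurable_fun setT mulm.
Proof. exact: measurable_funM. Qed.

Let lambda_nng : {nonneg R} := NngNum (powR_ge0 m alpha).

(** Homogeneity of phi says that the image of M under x |-> m x and m `^ alpha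
    times M have the same Laplace transform. *)
Lemma homogeneous_pushforward (A : set (measurableTypeR R)) : measurable A -> A `<=` D0 ->
  M (mulm @^-1` A) = ((m `^ alpha)%:E * M A)%E.
Proof.
move=> mA AD0.
pose N0 : {measure set (measurableTypeR R) -> \bar R} := pushforward M mulm.
pose N := N0 mmulm.
pose N' : {measure set (measurableTypeR R) -> \bar R} := mscale lambda_nng M.
have mexp t : measurable_fun D0 (fun x : measurableTypeR R => (expR (- t * x))%:E).
  by apply/measurable_EFinP; exact: measurable_expRZ.
have NE t : (\int[N]_(x in D0) (expR (- t * x))%:E = phi (m * t)%R)%E.
  have -> : (\int[N]_(x in D0) (expR (- t * x))%:E =
      \int[M]_(x in mulm @^-1` D0) (expR (- t * (m * x)))%:E)%E.
    apply: (@ge0_integral_pushforward _ _ _ _ _ mulm mmulm M D0 (fun x => (expR (- t * x))%:E)) => //.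
  rewrite (_ : mulm @^-1` D0 = D0).
    by apply: eq_integral => x _; congr (expR _)%:E; ring.
  by apply/seteqP; split => x; rewrite /= /mulm/= !in_itv/= !andbT pmulr_rge0.
have N'E t : (\int[N']_(x in D0) (expR (- t * x))%:E = (m `^ alpha)%:E * phi t)%E.
  by rewrite ge0_integral_mscale// => x _; rewrite lee_fin expR_ge0.
apply: (@laplace_inj R N N') => // t t0; first by rewrite NE phi_lty// mulr_gt0.
by rewrite NE N'E phi_scale.
Qed.

Let w (x : measurableTypeR R) : R := if 0 < x then x `^ alpha else 0.

Let w0 x : 0 <= w x.
Proof. by rewrite /w; case: ifP => // _; exact: powR_ge0. Qed.

Let mw : measurable_fun setT w.
Proof.
apply: measurable_fun_ifT => //; first exact: measurable_fun_ltr.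
Qed.

(** L is x `^ alpha M(dx) on (0, +oo): the factor m `^ alpha by which scaling
    multiplies M is compensated by that of the density. Local finiteness comes
    from comparing x `^ alpha with expR (- x) on a ball away from 0. *)
Lemma homogeneous_laplace_density : exists L : {measure set (measurableTypeR R) -> \bar R},
  scale_invariant_measure m L /\
  forall t, 0 < t -> weighted_laplace L alpha t = phi t.
Proof.
have [L LE] := density_measure_exists M w0 mw.
have mexp A t : measurable_fun A (fun x : measurableTypeR R => (expR (- t * x))%:E).
  by apply/measurable_EFinP; exact: measurable_expRZ.
have mwE A : measurable_fun A (fun x : measurableTypeR R => (w x)%:E).
  by apply/measurable_EFinP; exact: measurable_funTS.
exists L; split; last first.
  move=> t t0; rewrite /weighted_laplace (ge0_integral_density w0 mw LE)//; last 2 first.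
  - by apply/measurable_EFinP; exact: measurable_weighted_exp.
  - by move=> x _; rewrite lee_fin mulr_ge0 ?expR_ge0 ?weight_ge0.
  have m00 : measurable ([set 0] : set (measurableTypeR R)) by exact: measurable_set1.
  rewrite [RHS](ge0_negligible_integral m00)//; last exact: homogeneous_mass0.
  have -> : D0 `\` [set 0] = D.
    apply/seteqP; split => x; rewrite /= !in_itv/= !andbT.
      by move=> [x0 /eqP xn]; rewrite lt_def xn.
    by move=> x0; split; [exact: ltW|apply/eqP; rewrite gt_eqF].
  apply: eq_integral => x; rewrite inE/= in_itv/= andbT => x0.
  rewrite -EFinM /w x0 -mulrA mul1r mulVf ?gt_eqF ?powR_gt0// mulr1.
  by rewrite mulNr.
split.
- rewrite LE; last exact: measurableC.
  rewrite (eq_integral (cst 0%E)) ?integral_cst ?mul0e//; first exact: measurableC.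
  move=> x; rewrite inE/= in_itv/= andbT => /negP x0.
  by rewrite /w (negbTE x0).
- move=> x x0; exists (x / 2); first by rewrite divr_gt0.
  have mB : measurable (ball x (x / 2) : set (measurableTypeR R)) by exact: measurable_ball.
  rewrite LE//; pose C := (x / 2) `^ alpha * expR (2 * x).
  have C0 : 0 <= C by rewrite mulr_ge0 ?powR_ge0 ?expR_ge0.
  apply: (@le_lt_trans _ _ (\int[M]_(y in ball x (x / 2)) (C%:E * (expR (- 1 * y))%:E))%E).
    apply: ge0_le_integral => //.
    + by move=> y _; rewrite lee_fin.
    + by apply: emeasurable_funM => //; exact: mexp.
    + move=> y; rewrite /= /ball/= ltr_norml => /andP[b a]; rewrite -EFinM lee_fin.
      have y0 : 0 < y by lra.
      have xy : x / 2 <= y by lra.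
      have yx : y <= 2 * x by lra.
      rewrite /w y0 /C -mulrA -expRD -[leLHS]mulr1; apply: ler_pM => //.
      * exact: powR_ge0.
      * by apply: le0_ler_powR_base => //; [exact: ltW|rewrite divr_gt0].
      * by apply: le_trans (expR_ge1Dx _); lra.
  rewrite ge0_integralZl//.
  apply: lte_mul_pinfty; rewrite ?lee_fin//.
  apply: le_lt_trans (phi_lty (@ltr01 R)).
  apply: ge0_subset_integral => //.
  + by move=> y; rewrite /= /ball/= ltr_norml in_itv/= andbT => /andP[b a]; lra.
- move=> A mA AD.
  have [mB imE] : measurable [set m * a | a in A] /\ A = mulm @^-1` [set m * a | a in A].
    have -> : [set m * a | a in A] = (fun x : measurableTypeR R => m^-1 * x) @^-1` A.
      apply/seteqP; split => [_ [a Aa <-]|x /= Ax]; first by rewrite /= mulKf// gt_eqF.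
      by exists (m^-1 * x) => //; rewrite mulVKf// gt_eqF.
    split; last by apply/seteqP; split => x; rewrite /= /mulm/= mulKf// gt_eqF.
    rewrite -[X in measurable X]setTI; have : measurable_fun setT (fun x : measurableTypeR R => m^-1 * x) by exact: measurable_funM.
    exact.
  set B := [set m * a | a in A] in mB imE *.
  have BD : B `<=` D.
    move=> _ [a /AD + <-]; by rewrite /= !in_itv/= !andbT => a0; rewrite mulr_gt0.
  have BD0 : B `<=` D0.
    by move=> x /BD; rewrite /= !in_itv/= !andbT; exact: ltW.
  rewrite !LE// [in LHS]imE.
  have l0 : (m `^ alpha) != 0 by rewrite gt_eqF// powR_gt0.
  pose N0 : {measure set (measurableTypeR R) -> \bar R} := pushforward M mulm.
pose N := N0 mmulm.
  pose N' : {measure set (measurableTypeR R) -> \bar R} := mscale lambda_nng M.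
  have e1 : (\int[N]_(x in B) (w x)%:E = \int[N']_(x in B) (w x)%:E)%E.
    apply: eq_measure_integral => X mX XB.
    by apply: homogeneous_pushforward => // x /XB; exact: BD0.
  have e2 : (\int[N']_(x in B) (w x)%:E = (m `^ alpha)%:E * \int[M]_(x in B) (w x)%:E)%E.
    by rewrite ge0_integral_mscale// => x _; rewrite lee_fin.
  have e3 : (\int[N]_(x in B) (w x)%:E = (m `^ alpha)%:E * \int[M]_(x in mulm @^-1` B) (w x)%:E)%E.
    have -> : (\int[N]_(x in B) (w x)%:E = \int[M]_(x in mulm @^-1` B) (w (m * x))%:E)%E.
      apply: (@ge0_integral_pushforward _ _ _ _ _ mulm mmulm M B (fun x => (w x)%:E)) => //.
      by move=> x _; rewrite lee_fin.
    rewrite -imE -ge0_integralZl ?lee_fin ?powR_ge0//; last by move=> x _; rewrite lee_fin.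
    apply: eq_integral => x _; rewrite -EFinM /w pmulr_rgt0//.
    case: ifP => [x0|_]; last by rewrite mulr0.
    by rewrite powRM ?ltW.
  have : ((m `^ alpha)%:E * \int[M]_(x in mulm @^-1` B) (w x)%:E =
          (m `^ alpha)%:E * \int[M]_(x in B) (w x)%:E)%E by rewrite -e3 e1 e2.
  by move=> /(mule_solve l0) ->; rewrite mulVf// mul1e.
Qed.

End homogeneous_laplace.

Section weighted_laplace_uniqueness.
Context {R : realType}.
Local Notation D := (`]0, +oo[%classic : set (measurableTypeR R)).
Local Notation D0 := (`[0, +oo[%classic : set (measurableTypeR R)).
Variables (m alpha : R).
Hypotheses (m0 : 0 < m) (m1 : m < 1) (alpha0 : alpha < 0).

Let w (x : measurableTypeR R) : R := if 0 < x then 1 / (x `^ alpha) else 0.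

Let w0 x : 0 <= w x.
Proof. by rewrite /w; case: ifP => // _; exact: weight_ge0. Qed.

Let mw : measurable_fun setT w.
Proof.
apply: measurable_fun_ifT => //; first exact: measurable_fun_ltr.
exact: measurable_weight.
Qed.

Let v (x : measurableTypeR R) : R := x `^ alpha.

Let mv A : measurable_fun A (fun x => (v x)%:E).
Proof. by apply/measurable_EFinP; apply: measurable_funTS; exact: measurable_powR. Qed.

Lemma weighted_laplace_density (L N : {measure set (measurableTypeR R) -> \bar R}) :
  (forall A, measurable A -> N A = \int[L]_(x in A) (w x)%:E)%E ->
  (forall t : R, \int[N]_(x in D0) (expR (- t * x))%:E = weighted_laplace L alpha t)%E /\
  (forall A, measurable A -> A `<=` D -> L A = \int[N]_(x in A) (v x)%:E)%E.
Proof.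
move=> NE; split.
  move=> t; rewrite (ge0_integral_density w0 mw NE)//.
    rewrite /weighted_laplace [LHS]integral_mkcond [RHS]integral_mkcond.
    apply: eq_integral => x _; rewrite !patchE !mem_setE !in_itv/= !andbT /w -EFinM mulNr.
    by case: ltgtP => // _; rewrite mulr0.
  by apply/measurable_EFinP; exact: measurable_expRZ.
move=> A mA AD; rewrite (ge0_integral_density w0 mw NE)//.
  rewrite (eq_integral (cst 1%E)) ?integral_cst ?mul1e// => x.
  rewrite inE => /AD; rewrite /= in_itv/= andbT => x0.
  by rewrite -EFinM /v /w x0 mul1r divff// gt_eqF// powR_gt0.
by move=> x _; rewrite lee_fin powR_ge0.
Qed.

(** The transform determines x `^ (- alpha) L(dx), from which L is recovered
    with the density x `^ alpha. *)
Lemma weighted_laplace_inj (L L' : {measure set (measurableTypeR R) -> \bar R}) :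
  scale_invariant_measure m L -> scale_invariant_measure m L' ->
  (forall t, 0 < t -> weighted_laplace L alpha t = weighted_laplace L' alpha t) ->
  forall A : set (measurableTypeR R), measurable A -> L A = L' A.
Proof.
move=> Lm Lm' e A mA.
have [N NE] := density_measure_exists L w0 mw.
have [N' NE'] := density_measure_exists L' w0 mw.
have [lN dN] := weighted_laplace_density NE.
have [lN' dN'] := weighted_laplace_density NE'.
have mD : measurable D by exact: measurable_itv.
have restrict (K : {measure set (measurableTypeR R) -> \bar R}) :
    scale_invariant_measure m K -> K A = K (A `&` D).
  move=> [K0 _ _]; rewrite -[in LHS](setIT A) -(setUv D) setIUr.
  apply: measureU0; [exact: measurableI|apply: measurableI => //; exact: measurableC|].
  apply: (@subset_measure0 _ _ _ K _ (~` D)) => //; [|exact: measurableC].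
  by apply: measurableI => //; exact: measurableC.
have mAD : measurable (A `&` D) by exact: measurableI.
rewrite (restrict L)// (restrict L')// dN// dN'//.
apply: eq_measure_integral => B mB BAD.
apply: (@laplace_inj R) => //.
- by move=> t t0; rewrite lN; exact: (weighted_laplace_lty m0 m1 Lm alpha0).
- by move=> t t0; rewrite lN lN' e.
- by move=> x /BAD [_]; rewrite /= !in_itv/= !andbT; exact: ltW.
Qed.

End weighted_laplace_uniqueness.

(** * Invariant measures of the process *)

Section mass_function.
Context {R : realType}.
Variables nu nu' : {measure set nat -> \bar R}.
Hypothesis eq_mass : forall k, nu [set k] = nu' [set k].

Lemma eq_mass_invariant xi (lambda : R) :
  true_invariant xi lambda nu -> true_invariant xi lambda nu'.
Proof.
move=> inv j; rewrite -eq_mass -inv; apply: eq_eseriesr => i _.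
by rewrite eq_mass.
Qed.

Lemma eq_mass_representation (nu_min : probability nat R) alpha
    (L : {measure set (measurableTypeR R) -> \bar R}) :
  has_representation nu_min alpha nu L -> has_representation nu_min alpha nu' L.
Proof.
move=> h z z1; have := h z z1.
suff e : genfun_series nu z = genfun_series nu' z by rewrite /genfun e.
apply/funext => n; rewrite /genfun_series /series/=; apply: eq_bigr => k _.
by rewrite eq_mass.
Qed.

End mass_function.

Section representation_masses.
Context {R : realType}.
Local Open Scope complex_scope.

(** At the points of (0, 1) the representation gives the value of the power
    series of the masses. *)
Lemma representation_mass (nu_min : probability nat R) (alpha : R)
    (nu nu' : {measure set nat -> \bar R})
    (L : {measure set (measurableTypeR R) -> \bar R}) :
  locally_finite_nat nu -> locally_finite_nat nu' ->
  has_representation nu_min alpha nu L -> has_representation nu_min alpha nu' L ->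
  forall k, nu [set k] = nu' [set k].
Proof.
move=> nufin nu'fin h h'.
have E (mu : {measure set nat -> \bar R}) (s : R) : locally_finite_nat mu -> 0 < s < 1 ->
    has_representation nu_min alpha mu L ->
    (\int[mu]_k (s ^+ k)%:E = (complex.Re (genfun mu s%:C))%:E)%E.
  move=> mufin /andP[s0 s1] hmu; apply: integral_nat_series => //.
    by move=> k; rewrite exprn_ge0// ltW.
  have [|cv _ _] := hmu s%:C; last exact: cvg_genfun_real.
  by rewrite -[1]/(1%:C) normc_ltE normc_real ger0_norm ?ltW.
have G (s : R) : 0 < s < 1 -> genfun nu s%:C = genfun nu' s%:C.
  move=> /andP[s0 s1]; have z1 : `|s%:C| < 1.
    by rewrite -[1]/(1%:C) normc_ltE normc_real ger0_norm ?ltW.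
  by have [_ _ ->] := h _ z1; have [_ _ ->] := h' _ z1.
apply: power_series_inj => s s1; first by rewrite (E _ _ nufin)// ltry.
by rewrite (E _ _ nufin)// (E _ _ nu'fin)// G.
Qed.

End representation_masses.

Section conclusion.
Context {R : realType}.
Variables (xi : probability nat R) (m : R).
Hypotheses (xi_mean : (\int[xi]_k (k%:R : R)%:E)%E = m%:E) (m0 : 0 < m) (m1 : m < 1).
Variables (d : measure_display) (T : measurableType d) (P : probability T R)
  (Z : nat -> {RV P >-> nat}) (nu_min : probability nat R).
Hypotheses (Z_gw : galton_watson_from xi Z 1%N) (nu_minP : yaglom_limit Z nu_min).
Local Notation F := (pgf xi).
Local Notation H := (pgf nu_min).
Local Notation D0 := (`[0, +oo[%classic : set (measurableTypeR R)).

Let schroeder : forall s : R, 0 <= s < 1 -> 1 - H (F s) = m * (1 - H s).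
Proof. by move=> s; exact: (yaglom_schroeder xi_mean m0 m1 Z_gw nu_minP). Qed.

Let H_lt1 : forall s : R, 0 <= s < 1 -> 0 < 1 - H s.
Proof. by move=> s; exact: (yaglom_pgf_lt1 nu_minP). Qed.

Let mass0 : nu_min [set 0%N] = 0%E := yaglom_mass0 nu_minP.

(** The range of 1 - H on [0, 1) is (0, 1]; a power of m brings any t into it.
    What is known at the points 1 - H s thus extends by scaling to all
    positive arguments. *)
Lemma yaglom_cover (t : R) : 0 < t -> exists (s : R) (j : nat), 0 <= s < 1 /\ t = (1 - H s) / m ^+ j.
Proof.
move=> t0.
have [j jt] : exists j, t * m ^+ j <= 1.
  have c : (fun n => t * m ^+ n) @ \oo --> (0 : R).
    by rewrite -(mulr0 t); apply: cvgMr; apply: cvg_expr; rewrite ger0_norm ?ltW.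
  have /cvgr_le/(_ _ ltr01)[n _ h] := c.
  by exists n; exact: h n (leqnn n).
have [|s s1 sE] := pgf_onto mass0 (t := t * m ^+ j).
  by rewrite jt mulr_gt0// exprn_gt0.
by exists s, j; split => //; rewrite sE mulfK// expf_neq0// gt_eqF.
Qed.

Section negative_alpha.
Variable alpha : R.
Hypothesis alpha0 : alpha < 0.

Lemma invariant_of_scale_invariant (L : {measure set (measurableTypeR R) -> \bar R}) :
  scale_invariant_measure m L ->
  exists nu : {measure set nat -> \bar R},
    [/\ locally_finite_nat nu, true_invariant xi (m `^ alpha) nu,
        has_representation nu_min alpha nu L, (1%:E <= convergence_radius nu)%E &
        forall s : R, 0 <= s < 1 ->
          (\int[nu]_k (s ^+ k)%:E = weighted_laplace L alpha (1 - H s))%E].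
Proof.
move=> Lm; have [nu nuE] := mixture_exists m0 m1 Lm alpha0 mass0 H_lt1.
exists nu; split.
- exact: (mixture_locally_finite m0 m1 Lm alpha0 mass0 H_lt1 nuE).
- exact: (mixture_invariant m0 m1 Lm alpha0 mass0 H_lt1 nuE schroeder).
- exact: (mixture_representation m0 m1 Lm alpha0 mass0 H_lt1 nuE).
- exact: (mixture_radius m0 m1 Lm alpha0 mass0 H_lt1 nuE).
- by move=> s /andP[s0 s1]; apply: (mixture_pgf mass0 nuE); rewrite s0 ltW.
Qed.

(** By Schroeder's equation, replacing s by F s multiplies t = (1 - H s) / m
    ^+ j by m, so that the transform found in invariant_laplace is
    homogeneous. The mixture built from the resulting L has the same power
    series as nu on (0, 1), hence the same masses, and passes its complex
    representation on to nu. *)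
Lemma invariant_has_representation (nu : {measure set nat -> \bar R}) :
  locally_finite_nat nu -> true_invariant xi (m `^ alpha) nu ->
  exists L : {measure set (measurableTypeR R) -> \bar R},
    scale_invariant_measure m L /\ has_representation nu_min alpha nu L.
Proof.
move=> nufin inv; have l0 : 0 < m `^ alpha by rewrite powR_gt0.
have [M ME] := invariant_laplace xi_mean m0 m1 Z_gw nu_minP l0 nufin inv.
have Gfin (s : R) : 0 <= s < 1 -> (\int[nu]_i (s ^+ i)%:E < +oo)%E.
  by move=> s1; exact: (invariant_genfun_lty xi_mean m0 m1 l0 nufin inv).
have phi_lty (t : R) : 0 < t -> (\int[M]_(x in D0) (expR (- t * x))%:E < +oo)%E.
  move=> /yaglom_cover[s [j [s1 ->]]]; rewrite ME// lte_mul_pinfty ?Gfin//.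
  by rewrite lee_fin invr_ge0 exprn_ge0// ltW.
have phi_scale (t : R) : 0 < t -> (\int[M]_(x in D0) (expR (- (m * t) * x))%:E =
    (m `^ alpha)%:E * \int[M]_(x in D0) (expR (- t * x))%:E)%E.
  move=> /yaglom_cover[s [j [s1 ->]]].
  have Fs1 : 0 <= F s < 1 by have := iter_pgf_itv xi_mean m0 1 s1.
  rewrite mulrA -schroeder// !ME// (invariant_genfun _ (ltW l0) inv).
    by rewrite muleCA.
  by have /andP[-> /ltW] := s1.
have [L [Lm LE]] := homogeneous_laplace_density m0 m1 alpha0 phi_lty phi_scale.
exists L; split => //.
have [nu' [nu'fin _ rep _ nu'E]] := invariant_of_scale_invariant Lm.
apply: eq_mass_representation rep.
have e (s : R) : 0 < s < 1 -> (\int[nu']_k (s ^+ k)%:E = \int[nu]_k (s ^+ k)%:E)%E.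
  move=> /andP[s0 s1]; have s1' : 0 <= s < 1 by rewrite s1 ltW.
  rewrite nu'E// LE ?H_lt1//; have := ME s 0%N s1'.
  by rewrite !expr0 divr1 invr1 mul1e.
apply: power_series_inj => s s1; last exact: e.
by rewrite e// Gfin//; have /andP[/ltW -> ->] := s1.
Qed.

(** nu has the same masses as the mixture built from L. *)
Lemma representation_invariant (nu : {measure set nat -> \bar R})
    (L : {measure set (measurableTypeR R) -> \bar R}) :
  locally_finite_nat nu -> scale_invariant_measure m L ->
  has_representation nu_min alpha nu L -> true_invariant xi (m `^ alpha) nu.
Proof.
move=> nufin Lm rep.
have [nu' [nu'fin inv' rep' _ _]] := invariant_of_scale_invariant Lm.
apply: (eq_mass_invariant _ inv'); exact: representation_mass rep' rep.
Qed.

(** The values at real points give both transforms on (0, 1], and scale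
    invariance gives them elsewhere. *)
Lemma representation_unique (nu : {measure set nat -> \bar R})
    (L L' : {measure set (measurableTypeR R) -> \bar R}) :
  locally_finite_nat nu ->
  scale_invariant_measure m L -> scale_invariant_measure m L' ->
  has_representation nu_min alpha nu L -> has_representation nu_min alpha nu L' ->
  forall A : set (measurableTypeR R), measurable A -> L A = L' A.
Proof.
move=> nufin Lm Lm' rep rep'.
have W (K : {measure set (measurableTypeR R) -> \bar R}) (s : R) :
    scale_invariant_measure m K -> has_representation nu_min alpha nu K -> 0 <= s < 1 ->
    (weighted_laplace K alpha (1 - H s) = \int[nu]_k (s ^+ k)%:E)%E.
  move=> Km repK s1; have [mu [mufin _ repmu _ muE]] := invariant_of_scale_invariant Km.
  rewrite -muE//; have mE := representation_mass mufin nufin repmu repK.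
  have /andP[s0 _] := s1.
  rewrite !ge0_integral_nat; try by move=> k; rewrite lee_fin exprn_ge0.
  by apply: eq_eseriesr => k _; rewrite mE.
have l0 : m `^ alpha != 0 by rewrite gt_eqF// powR_gt0.
have S (K : {measure set (measurableTypeR R) -> \bar R}) (t : R) j : scale_invariant_measure m K ->
    (weighted_laplace K alpha (t / m ^+ j) = ((m `^ alpha) ^- j)%:E * weighted_laplace K alpha t)%E.
  move=> Km; elim: j => [|j IH]; first by rewrite !expr0 divr1 invr1 mul1e.
  have := weighted_laplace_scale m0 Km alpha (t / m ^+ j.+1).
  have -> : m * (t / m ^+ j.+1) = t / m ^+ j.
    by rewrite exprS invfM mulrCA mulVKf// gt_eqF.
  rewrite (_ : (m `^ alpha) ^- j.+1 = (m `^ alpha)^-1 * (m `^ alpha) ^- j); last by rewrite exprS invfM.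
  by rewrite IH => /(mule_solve l0).
apply: (weighted_laplace_inj m0 m1 alpha0 Lm Lm') => t /yaglom_cover[s [j [s1 ->]]].
by rewrite !S// !W.
Qed.

End negative_alpha.

Let z01 : 0 <= (0 : R) <= 1. Proof. by rewrite lexx ler01. Qed.

Let F0 : 0 < F 0. Proof. exact: (pgf0_gt0 xi_mean m1). Qed.

(** P_0(i, 0) = F(0) ^+ i: each of the i individuals must have no offspring. *)
Lemma invariant_at0 (lambda : R) (nu : {measure set nat -> \bar R}) :
  true_invariant xi lambda nu ->
  (\sum_(0 <= i <oo) nu [set i] * (F 0 ^+ i)%:E = lambda%:E * nu [set 0%N])%E.
Proof.
move=> /(_ 0%N) <-; apply: eq_eseriesr => i _; congr (_ * _%:E)%E.
have c := @transition_pgf R xi i 0 z01.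
rewrite -(cvg_lim (@Rhausdorff R) c); apply: (cvg_lim (@Rhausdorff R)).
apply: cvg_near_cst; near=> n; have n0 : (0 < n)%N by near: n; exact: nbhs_infty_gt.
rewrite /series/= (big_ltn n0) expr0 mulr1 big_nat big1 ?addr0// => k /andP[k0 _].
by rewrite expr0n gtn_eqF// mulr0.
Unshelve. all: by end_near. Qed.

Let term_ge0 (nu : {measure set nat -> \bar R}) i : (0 <= nu [set i] * (F 0 ^+ i)%:E)%E.
Proof. by rewrite mule_ge0// lee_fin exprn_ge0// ltW. Qed.

(** The term i = 0 of invariant_at0 is nu {0} itself. *)
Lemma invariant_tail (lambda : R) (nu : {measure set nat -> \bar R}) :
  locally_finite_nat nu -> true_invariant xi lambda nu ->
  (\sum_(1 <= i <oo) nu [set i] * (F 0 ^+ i)%:E =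
   ((lambda - 1) * fine (nu [set 0%N]))%:E)%E.
Proof.
move=> nufin /invariant_at0; rewrite (nneseries_split 0 1)// add0n.
have solve (x : R) (y : \bar R) : (x%:E + y = lambda%:E * x%:E -> y = ((lambda - 1) * x)%:E)%E.
  by move=> h; rewrite mulrBl mul1r EFinB EFinM -h [(x%:E + y)%E]addeC addeK.
by rewrite big_nat1 expr0 mule1 => h; apply: solve; rewrite -(nat_massE nufin).
Qed.

Lemma tail_eq0 (nu : {measure set nat -> \bar R}) k :
  (\sum_(1 <= i <oo) nu [set i] * (F 0 ^+ i)%:E = 0)%E -> (0 < k)%N -> nu [set k] = 0%E.
Proof.
move=> e k0; have : (nu [set k] * (F 0 ^+ k)%:E <= 0)%E.
  rewrite -e; apply: le_trans (@nneseries_lim_ge R _ xpredT 1 k.+1 _) => //.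
  by rewrite big_nat_recr//= leeDr// sume_ge0.
move=> h; apply/eqP; have : (nu [set k] * (F 0 ^+ k)%:E == 0)%E by rewrite eq_le h term_ge0.
by rewrite mule_eq0 => /orP[//|]; rewrite eqe expf_eq0 (gt_eqF F0) andbF.
Qed.

(** The tail is nonnegative and (lambda - 1) nu {0} is nonpositive, so both
    vanish, and F(0) > 0 leaves no mass anywhere. *)
Lemma no_invariant_lt1 (lambda : R) (nu : {measure set nat -> \bar R}) (A : set nat) :
  lambda < 1 -> locally_finite_nat nu -> true_invariant xi lambda nu -> nu A = 0%E.
Proof.
move=> l1 nufin inv; have e := invariant_tail nufin inv.
have a0 : 0 <= fine (nu [set 0%N]) by exact: fine_ge0.
have h : 0 <= (lambda - 1) * fine (nu [set 0%N]).
  by rewrite -lee_fin -e; apply: nneseries_ge0.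
have a_eq0 : fine (nu [set 0%N]) = 0 by nra.
rewrite a_eq0 mulr0 in e.
rewrite measure_nat_series eseries0// => k _ _.
have [->|k0] := posnP k; first by rewrite (nat_massE nufin) a_eq0 mul0e.
by rewrite (tail_eq0 e k0) mul0e.
Qed.

Lemma invariant1_iff (nu : {measure set nat -> \bar R}) : locally_finite_nat nu ->
  true_invariant xi 1 nu <->
  exists2 c : R, 0 <= c & forall A : set nat, nu A = (c%:E * \d_(0%N) A)%E.
Proof.
move=> nufin; split => [inv|[c c0 nuE] j].
  have e := invariant_tail nufin inv; rewrite subrr mul0r in e.
  exists (fine (nu [set 0%N])); first exact: fine_ge0.
  move=> A; rewrite measure_nat_series (nneseries_split 0 1)//.
  rewrite add0n big_nat1 eseries0 ?adde0; last first.
    by move=> k k0 _; rewrite (tail_eq0 e k0) mul0e.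
  by rewrite (nat_massE nufin) diracE indicE.
have nu0 i : (0 < i)%N -> nu [set i] = 0%E.
  by move=> i0; rewrite nuE diracE memNset ?mule0//= => i0E; rewrite -i0E in i0.
rewrite mul1e (nneseries_split 0 1)//; last first.
  by move=> k _; rewrite mule_ge0// lee_fin transition_ge0.
rewrite add0n big_nat1 eseries0 ?adde0; last first.
  by move=> k k0 _; rewrite nu0// mul0e.
rewrite /transition/=; have [->|j0] := posnP j; first by rewrite mule1.
by rewrite mule0 nu0.
Qed.

End conclusion.

Theorem theorem11 (R : realType) (xi : probability nat R) (m : R)
    (m_mean : (\int[xi]_k (k%:R : R)%:E)%E = m%:E) (m_gt0 : 0 < m) (m_lt1 : m < 1)
    (d : measure_display) (T : measurableType d) (P1 : probability T R)
    (Z : nat -> {RV P1 >-> nat}) (Z_gw : galton_watson_from xi Z 1%N)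
    (nu_min : probability nat R) (nu_minP : yaglom_limit Z nu_min) :
  [/\
      forall lambda : R, lambda < 1 ->
        ~ exists nu : {measure set nat -> \bar R},
            [/\ locally_finite_nat nu, true_invariant xi lambda nu
              & exists A : set nat, nu A <> 0%E],

      forall nu : {measure set nat -> \bar R}, locally_finite_nat nu ->
        (true_invariant xi 1 nu <->
         exists2 c : R, 0 <= c &
           forall A : set nat, nu A = (c%:E * \d_(0%N) A)%E)
    &
      forall alpha : R, alpha < 0 ->
        [/\ forall nu : {measure set nat -> \bar R}, locally_finite_nat nu ->
              (true_invariant xi (m `^ alpha) nu <->
               exists Lambda : {measure set (measurableTypeR R) -> \bar R},
                 scale_invariant_measure m Lambda /\
                 has_representation nu_min alpha nu Lambda),
            forall (nu : {measure set nat -> \bar R})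
                (Lambda Lambda' : {measure set (measurableTypeR R) -> \bar R}),
              locally_finite_nat nu ->
              scale_invariant_measure m Lambda ->
              scale_invariant_measure m Lambda' ->
              has_representation nu_min alpha nu Lambda ->
              has_representation nu_min alpha nu Lambda' ->
              forall A : set (measurableTypeR R), measurable A ->
                Lambda A = Lambda' A
          & forall Lambda : {measure set (measurableTypeR R) -> \bar R},
              scale_invariant_measure m Lambda ->
              exists nu : {measure set nat -> \bar R},
                [/\ locally_finite_nat nu, true_invariant xi (m `^ alpha) nu,
                    has_representation nu_min alpha nu Lambda
                  & (1%:E <= convergence_radius nu)%E]]].
Proof.
split.
- move=> lambda l1 [nu [nufin inv [A]]]; apply.
  exact: (no_invariant_lt1 m_mean m_lt1 _ l1 nufin inv).
- by move=> nu nufin; exact: (invariant1_iff m_mean m_lt1 nufin).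
move=> alpha alpha0; split.
- move=> nu nufin; split => [inv|[L [Lm rep]]].
    exact: (invariant_has_representation m_mean m_gt0 m_lt1 Z_gw nu_minP alpha0 nufin inv).
  exact: (representation_invariant m_mean m_gt0 m_lt1 Z_gw nu_minP alpha0 nufin Lm rep).
- move=> nu L L' nufin Lm Lm' rep rep'.
  exact: (representation_unique m_mean m_gt0 m_lt1 Z_gw nu_minP alpha0 nufin Lm Lm' rep rep').
- move=> L Lm.
  have [nu [nufin inv rep rad _]] :=
    invariant_of_scale_invariant m_mean m_gt0 m_lt1 Z_gw nu_minP alpha0 Lm.
  by exists nu.
Qed.
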